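(* For $n\ge 2$, cubes in $\mathcal{P}^n(11,5,2)$ with nontrivial full autotopy group exist if and only if $2\le n\le 11$. The number of such cubes up to equivalence is $1$, $10178$, $443$, $8$, $7$, $4$, $2$, $1$, $1$, $1$ for $n=2,3,4,5,6,7,8,9,10,11$, respectively.
   Context: An incidence matrix of a symmetric $(v,k,\lambda)$ design is a $v\times v$ matrix $A$ with $\{0,1\}$-entries satisfying $AA^t=(k-\lambda)I+\lambda J$, where $I$ is the identity matrix and $J$ the all-ones matrix. For $n\ge 2$, $\mathcal{P}^n(v,k,\lambda)$ is the set of all functions $C:\{1,\ldots,v\}^n\to\{0,1\}$ such that for all $1\le x<y\le n$ the $2$-projection $\Pi_{xy}(C)$ is an incidence matrix of a symmetric $(v,k,\lambda)$ design; here $\Pi_{xy}(C)$ is the $v\times v$ matrix whose $(i_x,i_y)$-entry is the sum (in characteristic $0$) of $C(i_1,\ldots,i_n)$ over all $n$-tuples in $\{1,\ldots,v\}^n$ with the given coordinates $i_x,i_y$. Two functions $C,C':\{1,\ldots,v\}^n\to\{0,1\}$ are isotopic if there is $(\pi_1,\ldots,\pi_n)\in (S_v)^n$ (an isotopy from $C$ to $C'$) with $C'(i_1,\ldots,i_n)=C(\pi_1^{-1}(i_1),\ldots,\pi_n^{-1}(i_n))$ for all $i_1,\ldots,i_n$. For $\gamma\in S_n$, the conjugate is $C^\gamma(i_1,\ldots,i_n)=C(i_{\gamma^{-1}(1)},\ldots,i_{\gamma^{-1}(n)})$. $C$ and $C'$ are equivalent if $C'$ is isotopic to $C^\gamma$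 for some $\gamma\in S_n$. Numbers ''up to equivalence'' are numbers of equivalence classes. An autotopy of $C$ is an isotopy from $C$ to itself; the autotopies form a group under coordinatewise composition, the full autotopy group of $C$. *)

(* Defs.v *)
From HB Require Import structures.
From mathcomp Require Import all_boot all_algebra all_fingroup.
Set Implicit Arguments.
Unset Strict Implicit.
Unset Printing Implicit Defensive.
Import GRing.Theory.

(* Points, as well as coordinates, are numbered from 0: {1, ..., m} is 'I_m. *)

Definition incidence_matrix (v k l : nat) (A : 'M[int]_v) : bool :=
  [forall i, forall j, (A i j == 0%R) || (A i j == 1%R)] &&
  (A *m A^T == (k%:R - l%:R)%:M + const_mx l%:R)%R.

Notation cube n v := {ffun {ffun 'I_n -> 'I_v} -> bool}.

Definition projection n v (x y : 'I_n) (C : cube n v) : 'M[int]_v :=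
  (\matrix_(a, b)
     \sum_(i : {ffun 'I_n -> 'I_v} | (i x == a) && (i y == b)) (C i)%:R)%R.

Definition Pcubes (n v k l : nat) : {set cube n v} :=
  [set C : cube n v | [forall x : 'I_n, forall y : 'I_n,
     (x < y)%N ==> incidence_matrix k l (projection x y C)]].

(* The non-dependent {ffun 'I_n -> 'S_v} has no group structure in MathComp;
   {dffun _} carries the coordinatewise product. *)
Notation isotopy n v := {dffun forall _ : 'I_n, 'S_v}.

Section Equivalence.
Variables n v : nat.
Implicit Types (C : cube n v) (p q : isotopy n v) (g h : 'S_n).

Definition isotope C p : cube n v :=
  [ffun i : {ffun 'I_n -> 'I_v} => C [ffun k => ((p k)^-1)%g (i k)]].

Definition isotopic C C' : bool := [exists p, C' == isotope C p].

Definition conjugate C g : cube n v :=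
  [ffun i : {ffun 'I_n -> 'I_v} => C [ffun k => i ((g^-1)%g k)]].

Definition equivalent C C' : bool := [exists g, isotopic (conjugate C g) C'].

Definition autotopies C : {set isotopy n v} := [set p | isotope C p == C].

Lemma isotope1 C : isotope C 1%g = C.
Proof.
apply/ffunP=> i; rewrite ffunE; congr (C _).
by apply/ffunP=> k; rewrite !ffunE invg1 perm1.
Qed.

(* The product in 'S_v composes from left to right, hence a right action. *)
Lemma isotopeM C p q : isotope C (p * q)%g = isotope (isotope C p) q.
Proof.
apply/ffunP=> i; rewrite !ffunE; congr (C _).
by apply/ffunP=> k; rewrite !ffunE invMg permM.
Qed.

Lemma autotopies_group_set C : group_set (autotopies C).
Proof.
apply/group_setP; split=> [|p q]; rewrite !inE ?isotope1 //.
by move=> /eqP Cp /eqP Cq; rewrite isotopeM Cp Cq.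
Qed.

Definition autotopy_group C : {group isotopy n v} :=
  Group (autotopies_group_set C).

Lemma conjugate1 C : conjugate C 1%g = C.
Proof.
apply/ffunP=> i; rewrite ffunE; congr (C _).
by apply/ffunP=> k; rewrite !ffunE invg1 perm1.
Qed.

Lemma conjugateM C g h : conjugate C (h * g)%g = conjugate (conjugate C g) h.
Proof.
apply/ffunP=> i; rewrite !ffunE; congr (C _).
by apply/ffunP=> k; rewrite !ffunE invMg permM.
Qed.

Lemma conjugate_isotope C p g :
  conjugate (isotope C p) g = isotope (conjugate C g) [ffun k => p (g k)].
Proof.
apply/ffunP=> i; rewrite !ffunE; congr (C _).
by apply/ffunP=> k; rewrite !ffunE permKV.
Qed.

Lemma equivalentP C C' :
  reflect (exists g p, C' = isotope (conjugate C g) p) (equivalent C C').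
Proof.
apply: (iffP existsP) => [[g /existsP[p /eqP ->]]|[g [p ->]]].
  by exists g, p.
by exists g; apply/existsP; exists p.
Qed.

Lemma equivalent_equivalence : equivalence_rel equivalent.
Proof.
have refl : reflexive equivalent.
  by move=> C; apply/equivalentP; exists 1%g, 1%g; rewrite conjugate1 isotope1.
have sym C C' : equivalent C C' -> equivalent C' C.
  case/equivalentP=> g [p ->]; apply/equivalentP.
  exists g^-1%g, [ffun k => p (g^-1 k)]^-1%g.
  rewrite conjugate_isotope -isotopeM -conjugateM.
  by rewrite mulVg mulgV conjugate1 isotope1.
have trans : transitive equivalent.
  move=> C2 C1 C3 /equivalentP[g [p ->]] /equivalentP[h [q ->]].
  rewrite conjugate_isotope -isotopeM -conjugateM.
  by apply/equivalentP; do 2!eexists.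
apply/equivalence_relP; split=> // C1 C2 e12 C3.
by apply/idP/idP; apply: trans => //; apply: sym.
Qed.

End Equivalence.

Definition nontrivial_Pcubes (n v k l : nat) : {set cube n v} :=
  [set C in Pcubes n v k l | autotopy_group C :!=: 1%g].

Definition count_up_to_equivalence n v (D : {set cube n v}) : nat :=
  #|equivalence_partition (@equivalent n v) D|.

(* Main.v *)
(** A cube is a family of maps from the 55 flags of the (unique) biplane on 11 points to the coordinates, any two of
    which form a biplane; up to equivalence only the set of kernels of these maps matters (a frame). Moving two kernels
    to the rows and columns of a fixed biplane, a symmetric frame becomes one that is invariant under a fixed Sylow
    subgroup of PSL(2,11), or under a fixed involution, and the remaining freedom is the normaliser of that subgroup.
    The frames that are lexicographically least in their normaliser orbit are enumerated by verified search. With four or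
    more coordinates, counting fixed flags excludes automorphisms of order 2 and 3, and order 11 forces order 5. *)

Require Import Defs.
From mathcomp Require Import all_boot all_order all_algebra all_fingroup cyclic pgroup action sylow.
From Stdlib Require BinNat.
Import Defs.

Set Implicit Arguments. Unset Strict Implicit. Unset Printing Implicit Defensive.

(** The classes are sorted by the order m of the automorphism group of a frame, a divisor of 660 =
    4.3.5.11. If P is a Sylow subgroup of the automorphism groups of two equivalent frames, a
    permutation relating them can be corrected by an automorphism of one of them so that it
    normalises P; this is why orbits of the normaliser are equivalence classes. An involution
    generates a Sylow subgroup only when 4 does not divide m. Three coordinates therefore split into
    four exclusive cases: 4 | m; m even but not divisible by 4; m odd and 3 | m; 5 | m and m prime
    to 6. They have 76, 5066, 4753 and 283 classes, 10178 in all, and exclusiveness is imposed by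
    lists of forbidden automorphisms. From four coordinates on only the prime 5 remains, and frames
    are cliques in the graph of kernels fixed by a group of order 5. No clique gives twelve kernels,
    and this excludes all larger numbers, since a subset of a frame keeps its automorphisms. *)

Module Kernels.
Import GRing.Theory.

(** * Labellings of flags, their kernels, and cubes as families of labellings *)

Section Frames.
Variable F : finType.
Implicit Types (u w : F -> 'I_11) (b : {perm F}).

(** The kernel forgets the names of the labels, which are exactly what an isotopy may change; a
    conjugation then only permutes the kernels. *)
Definition kerf u : {set F * F} := [set z | u z.1 == u z.2].
Definition pullback b (k : {set F * F}) : {set F * F} := [set z | (b z.1, b z.2) \in k].

Definition hits u w a c := [exists m, (u m == a) && (w m == c)].
(** Joint injectivity makes the projection a 0/1 matrix, and the count of common columns is the
    equation for A A^t, entry by entry. *)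
Definition biplane u w :=
  [forall m, forall m', (u m == u m') && (w m == w m') ==> (m == m')] &&
  [forall a, forall a', #|[set c | hits u w a c && hits u w a' c]| == if a == a' then 5 else 2].

Lemma biplane_inj u w m m' : biplane u w -> u m = u m' -> w m = w m' -> m = m'.
Proof.
by case/andP=> /forallP/(_ m)/forallP/(_ m')/implyP H _ eu ew; apply/eqP/H; rewrite eu ew !eqxx.
Qed.

Lemma hitsP u w a c : reflect (exists2 m, u m = a & w m = c) (hits u w a c).
Proof.
apply: (iffP existsP) => [[m /andP[/eqP <- /eqP <-]]|[m <- <-]]; first by exists m.
by exists m; rewrite !eqxx.
Qed.

Lemma hits_count u w a c : biplane u w ->
  #|[set m | (u m == a) && (w m == c)]| = hits u w a c.
Proof.
move=> bp; case: hitsP => [[m um wm]|H].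
  rewrite (_ : [set _ | _] = [set m]) ?cards1 //.
  apply/setP=> m'; rewrite !inE; apply/andP/eqP => [[/eqP um' /eqP wm']|->]; last by rewrite um wm.
  by apply: (biplane_inj bp); rewrite ?um' ?wm'.
apply/eqP; rewrite cards_eq0; apply/eqP/setP=> m; rewrite !inE.
by apply/negP=> /andP[/eqP um /eqP wm]; apply: H; exists m.
Qed.

Lemma biplane_card u w a a' : biplane u w ->
  #|[set c | hits u w a c && hits u w a' c]| = if a == a' then 5 else 2.
Proof. by case/andP=> _ /forallP/(_ a)/forallP/(_ a')/eqP. Qed.

Lemma biplane_surj u w a : biplane u w -> exists m, u m = a.
Proof.
move=> bp; have := biplane_card a a bp; rewrite eqxx.
move=> h; have : 0 < #|[set c | hits u w a c && hits u w a c]| by rewrite h.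
by case/card_gt0P=> c; rewrite inE andbb => /hitsP[m um _]; exists m.
Qed.

Lemma biplane_fiber u w a : biplane u w -> #|[set m | u m == a]| = 5.
Proof.
move=> bp; have := biplane_card a a bp; rewrite eqxx => h; rewrite -[RHS]h.
rewrite (_ : [set c | _] = w @: [set m | u m == a]); last first.
  apply/setP=> c; rewrite inE andbb; apply/hitsP/imsetP => [[m um <-]|[m]].
    by exists m; rewrite ?inE ?um.
  by rewrite inE => /eqP um ->; exists m.
rewrite card_in_imset // => m m'; rewrite !inE => /eqP um /eqP um'.
by apply: (biplane_inj bp); rewrite um um'.
Qed.

Lemma hitsC u w a c : hits u w a c = hits w u c a.
Proof. by apply/hitsP/hitsP=> -[m]; exists m. Qed.

(* The dual of a symmetric design is a symmetric design. *)
Lemma biplane_sym u w : biplane u w -> biplane w u.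
Proof.
move=> bp; apply/andP; split.
  apply/forallP=> m; apply/forallP=> m'; apply/implyP=> /andP[/eqP ew /eqP eu].
  exact/eqP/(biplane_inj bp).
pose N : 'M[rat]_11 := (\matrix_(a, c) (hits u w a c)%:R)%R.
pose J : 'M[rat]_11 := (const_mx 1)%R.
have mul (M : 'I_11 -> 'I_11 -> bool) a a' :
    (\sum_c (M a c)%:R * (M a' c)%:R = #|[set c | M a c && M a' c]|%:R :> rat)%R.
  rewrite -sum1dep_card natr_sum [RHS]big_mkcond /=; apply: eq_bigr => c _.
  by case: (M a c); case: (M a' c); rewrite ?mulr0 ?mul0r ?mulr1.
have NNt : (N *m N^T = 3%:R%:M + 2%:R *: J)%R.
  apply/matrixP=> a a'; rewrite [LHS]mxE.
  under eq_bigr do rewrite [N^T%R _ _]mxE [N _ _]mxE [N _ _]mxE.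
  rewrite mul biplane_card // !mxE; case: eqP => _; by rewrite ?mulr1n ?mulr0n ?add0r ?mulr1 // -natrD.
have NJ : (N *m J = 5%:R *: J)%R.
  apply/matrixP=> a c; rewrite !mxE mulr1.
  have := biplane_card a a bp; rewrite eqxx => h; rewrite -[in RHS]h -mul.
  by apply: eq_bigr => d _; rewrite !mxE mulr1; case: hits; rewrite ?mulr0 ?mulr1.
(* [M] is the inverse of [N], because N (N^t - (2/5) J) = 3 I + 2 J - 2 J. As it is also a left
   inverse, N^t N can be expressed through J N. *)
pose M := (3%:R^-1 *: (N^T - (2%:R / 5%:R) *: J) : 'M[rat]_11)%R.
have NM : (N *m M = 1%:M)%R.
  rewrite -scalemxAr mulmxBr -scalemxAr NJ NNt scalerA divfK // addrK.
  by rewrite scale_scalar_mx mulVf.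
have MN := mulmx1C NM.
have NtN : (N^T *m N = 3%:R%:M + (2%:R / 5%:R) *: (J *m N))%R.
  have : (3%:R *: (M *m N) = 3%:R%:M)%R by rewrite MN scale_scalar_mx mulr1.
  rewrite -scalemxAl scalerA divff // scale1r mulmxBl -scalemxAl => <-.
  by rewrite subrK.
(* An entry of J N is the sum of a column, and for a 0/1 matrix this is a diagonal entry of N^t N.
   The diagonal thus satisfies d = 3 + (2/5) d, whence d = 5. *)
have JN c c' : ((J *m N) c c' = (N^T *m N) c' c')%R.
  rewrite [LHS]mxE [RHS]mxE; apply: eq_bigr => a _; rewrite !mxE mul1r.
  by case: hits; rewrite ?mulr0 ?mulr1.
have d5 c : ((N^T *m N) c c = 5%:R)%R.
  have := congr1 (fun A : 'M[rat]_11 => A c c) NtN.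
  rewrite [RHS]mxE [X in (_ = X + _)%R]mxE eqxx mulr1n [X in (_ = _ + X)%R]mxE JN.
  set d := ((N^T *m N) c c)%R => e; apply: (@mulfI _ (1 - 2%:R / 5%:R)%R) => //.
  by rewrite !mulrBl !mul1r {1}e addrK divfK // -natrB.
apply/forallP=> c; apply/forallP=> c'; apply/eqP.
have := congr1 (fun A : 'M[rat]_11 => A c c') NtN.
rewrite [RHS]mxE [X in (_ = X + _)%R]mxE [X in (_ = _ + X)%R]mxE JN d5 divfK //.
rewrite [LHS]mxE.
under eq_bigr do rewrite [N^T%R _ _]mxE [N _ _]mxE [N _ _]mxE.
rewrite (mul (fun c a => hits u w a c)) => e.
have -> : #|[set a | hits w u c a && hits w u c' a]| = #|[set a | hits u w a c && hits u w a c']|.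
  by apply: eq_card => a; rewrite !inE !(hitsC w u).
move: e; case: eqP => _; rewrite ?mulr1n ?mulr0n ?add0r -?natrD => /eqP; by rewrite Num.Theory.eqr_nat => /eqP.
Qed.

Lemma biplane_surjr u w c : biplane u w -> exists m, w m = c.
Proof. by move/biplane_sym/biplane_surj. Qed.

Definition incmx u w : 'M[int]_11 := (\matrix_(a, c) (hits u w a c)%:R)%R.

Lemma incidence_incmx u w :
  reflect (forall a a', #|[set c | hits u w a c && hits u w a' c]| = if a == a' then 5 else 2)
          (incidence_matrix 5 2 (incmx u w)).
Proof.
have bin a c : ((incmx u w a c == 0) || (incmx u w a c == 1))%R.
  by rewrite mxE; case: hits.
have mul a a' : ((incmx u w *m (incmx u w)^T) a a' =
    #|[set c | hits u w a c && hits u w a' c]|%:R)%R.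
  rewrite mxE -sum1dep_card natr_sum [RHS]big_mkcond /=; apply: eq_bigr => c _.
  by rewrite !mxE; do 2!case: hits; rewrite ?mulr0 ?mul0r ?mulr1.
have rhs a a' : ((((5%:R : int) - 2%:R)%:M + const_mx 2%:R : 'M[int]_11) a a' =
    (if a == a' then 5 else 2)%:R)%R by rewrite !mxE; case: eqP.
apply: (iffP andP) => [[_ /eqP e] a a'|H].
  have := congr1 (fun M : 'M[int]_11 => M a a') e; rewrite mul rhs => /eqP.
  by rewrite Num.Theory.eqr_nat => /eqP.
split; first by apply/forallP=> a; apply/forallP.
by apply/eqP/matrixP=> a a'; rewrite mul rhs H.
Qed.

Section Cubes.
Variable n : nat.
Implicit Types (f : 'I_n -> F -> 'I_11) (C : cube n 11).

Definition tuple_of f m : {ffun 'I_n -> 'I_11} := [ffun x => f x m].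
Definition cube_of f : cube n 11 := [ffun t => [exists m, t == tuple_of f m]].

Definition pairwise_biplane f := forall x y : 'I_n, x < y -> biplane (f x) (f y).

Lemma cube_ofP f t : reflect (exists m, t = tuple_of f m) (cube_of f t).
Proof. by rewrite ffunE; apply: (iffP existsP) => -[m /eqP]; exists m => //; apply/eqP. Qed.

Lemma projection_cube_of f (x y : 'I_n) a c : injective (tuple_of f) ->
  projection x y (cube_of f) a c = (#|[set m | (f x m == a) && (f y m == c)]|%:R)%R.
Proof.
move=> inj; rewrite mxE -(card_imset _ inj) -sum1_card natr_sum.
rewrite [RHS]big_mkcond [LHS]big_mkcond; apply: eq_bigr => t _.
case: ifP => [/andP[/eqP tx /eqP ty]|h].
  case: cube_ofP => [[m tm]|H].
    rewrite ifT //; apply/imsetP; exists m => //.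
    by rewrite inE -tx -ty tm !ffunE !eqxx.
  by rewrite ifF //; apply/imsetP=> -[m _ tm]; apply: H; exists m.
rewrite ifF //; apply/imsetP=> -[m]; rewrite inE => hm tm; move: h.
by rewrite tm !ffunE hm.
Qed.

Lemma pairwise_biplane_inj f : 1 < n -> pairwise_biplane f -> injective (tuple_of f).
Proof.
move=> n2 bp m m' /ffunP e.
have lt01 : Ordinal (ltnW n2) < Ordinal n2 by [].
apply: (biplane_inj (bp _ _ lt01)).
  by have := e (Ordinal (ltnW n2)); rewrite !ffunE.
by have := e (Ordinal n2); rewrite !ffunE.
Qed.

Lemma projection_biplane f x y : injective (tuple_of f) ->
  biplane (f x) (f y) -> projection x y (cube_of f) = incmx (f x) (f y).
Proof.
by move=> inj bp; apply/matrixP=> a c; rewrite projection_cube_of // hits_count // mxE.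
Qed.

Lemma cube_of_Pcubes f : 1 < n -> pairwise_biplane f -> cube_of f \in Pcubes n 11 5 2.
Proof.
move=> n2 bp; rewrite inE; apply/forallP=> x; apply/forallP=> y; apply/implyP=> xy.
have := bp _ _ xy; move=> bxy; rewrite projection_biplane //; last exact: pairwise_biplane_inj.
by apply/incidence_incmx => a a'; exact: biplane_card.
Qed.

(** The support of such a cube has 55 points, so it can be indexed by the flags; the coordinates of
    the indexed point are the labellings. *)
Lemma Pcubes_cube_of C : 1 < n -> #|F| = 55 -> C \in Pcubes n 11 5 2 ->
  exists2 f, pairwise_biplane f & C = cube_of f.
Proof.
move=> n2 cF; rewrite inE => /forallP HC.
have inc (x y : 'I_n) : x < y -> incidence_matrix 5 2 (projection x y C).
  by move: (HC x) => /forallP/(_ y)/implyP.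
pose S := [set t | C t].
have bin (x y : 'I_n) : x < y -> forall a c, (projection x y C a c == 0)%R || (projection x y C a c == 1)%R.
  by move=> xy a c; case/andP: (inc _ _ xy) => /forallP/(_ a)/forallP/(_ c).
have proj (x y : 'I_n) a c : projection x y C a c = (#|[set t in S | (t x == a) && (t y == c)]|%:R)%R.
  rewrite mxE -sum1_card natr_sum [LHS]big_mkcond [RHS]big_mkcond.
  by apply: eq_bigr => t _; rewrite !inE; case: (C t); case: ifP.
have cS : #|S| = 55.
  pose x := Ordinal (ltnW n2); pose y := Ordinal n2.
  have xy : x < y by [].
  pose A := projection x y C.
  (* For a 0/1 matrix the diagonal entries of A A^t are the row sums, so one projection counts 11
     rows of 5 points each. *)
  have sq a c : (A a c * A a c = A a c)%R.
    by case/orP: (bin x y xy a c) => /eqP; rewrite /A => ->; rewrite ?mulr0 ?mulr1.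
  have row a : (\sum_c A a c = 5%:R)%R.
    case/andP: (inc x y xy) => _ /eqP/(congr1 (fun M : 'M[int]_11 => M a a)).
    rewrite [LHS]mxE (eq_bigr (fun c => A a c)) => [->|c _]; last by rewrite [A^T%R _ _]mxE sq.
    by rewrite [LHS]mxE [X in (X + _)%R]mxE [X in (_ + X)%R]mxE eqxx.
  have : (#|S|%:R = \sum_a \sum_c A a c :> int)%R.
    under eq_bigr do under eq_bigr do rewrite /A proj.
    rewrite -sum1_card natr_sum pair_bigA /=.
    under [RHS]eq_bigr do rewrite -sum1_card natr_sum.
    rewrite (exchange_big_dep (mem S)) /=; last by move=> p t _; rewrite inE; case/andP.
    apply: eq_bigr => t tS.
    rewrite (big_pred1 (t x, t y)) // => -[a c] /=; rewrite inE tS /=.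
    by rewrite -pair_eqE /= ![t _ == _]eq_sym.
  under eq_bigr do rewrite row.
  rewrite sumr_const card_ord -mulrnA => /eqP; rewrite Num.Theory.eqr_nat.
  by move/eqP=> ->.
have cFS : #|F| = #|S| by rewrite cF cS.
pose g m := enum_val (cast_ord cFS (enum_rank m)).
have gS m : g m \in S by apply: enum_valP.
have gI : injective g by move=> m m' /enum_val_inj/cast_ord_inj/enum_rank_inj.
have gO t : t \in S -> exists m, t = g m.
  move=> tS; exists (enum_val (cast_ord (esym cFS) (enum_rank_in tS t))).
  by rewrite /g enum_valK cast_ordKV enum_rankK_in.
pose f x m := g m x.
have tg m : tuple_of f m = g m by apply/ffunP=> x; rewrite ffunE.
have Cf : C = cube_of f.
  apply/ffunP=> t; apply/idP/cube_ofP => [Ct|[m ->]].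
    by have [|m tm] := gO t; [rewrite inE | exists m; rewrite tg].
  by rewrite tg; have := gS m; rewrite inE.
have fI : injective (tuple_of f) by move=> m m'; rewrite !tg; apply: gI.
exists f => // x y xy.
have bxy : forall m m', f x m = f x m' -> f y m = f y m' -> m = m'.
  move=> m m' ex ey; have := bin x y xy (f x m) (f y m).
  rewrite {1 2}Cf !projection_cube_of // Num.Theory.pnatr_eq0 Num.Theory.pnatr_eq1 => h.
  have : #|[set m0 | (f x m0 == f x m) && (f y m0 == f y m)]| <= 1 by case/orP: h => /eqP ->.
  by move/card_le1_eqP; apply; rewrite !inE ?ex ?ey !eqxx.
have iI : [forall m, forall m', (f x m == f x m') && (f y m == f y m') ==> (m == m')].
  by apply/forallP=> m; apply/forallP=> m'; apply/implyP=> /andP[/eqP ex /eqP ey]; apply/eqP/bxy.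
rewrite /biplane iI /=; apply/forallP=> a; apply/forallP=> a'; apply/eqP.
have e : projection x y C = incmx (f x) (f y).
  apply/matrixP=> p q; rewrite {1}Cf projection_cube_of // mxE; congr (_%:R)%R.
  case: hitsP => [[m um wm]|H].
    apply/eqP/cards1P; exists m; apply/setP=> m'; rewrite !inE.
    by apply/andP/eqP => [[/eqP e1 /eqP e2]|->]; [apply: bxy; rewrite ?e1 ?e2 | rewrite um wm !eqxx].
  apply/eqP; rewrite cards_eq0; apply/eqP/setP=> m; rewrite !inE.
  by apply/negP=> /andP[/eqP um /eqP wm]; apply: H; exists m.
by have := inc _ _ xy; rewrite e => /incidence_incmx/(_ a a').
Qed.

Lemma pairwise_biplane_surj f x a : 1 < n -> pairwise_biplane f -> exists m, f x m = a.
Proof.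
move=> n2 bp; have [y neq] : exists y : 'I_n, x != y.
  have [e|ne] := eqVneq x (Ordinal n2); last by exists (Ordinal n2).
  by exists (Ordinal (ltnW n2)); rewrite e.
by case: (ltngtP x y) => [xy|yx|/val_inj/eqP e];
  [apply: biplane_surj (bp _ _ xy) | apply: biplane_surjr (bp _ _ yx) | rewrite e in neq].
Qed.

(** Flags index the support of a cube without repetition, since two labellings are jointly
    injective; an equality of supports is therefore a permutation of the flags. *)
Lemma cube_of_isotope f f' (g : 'S_n) (p : isotopy n 11) :
    1 < n -> pairwise_biplane f -> pairwise_biplane f' ->
  (exists b : {perm F}, forall x m, f' x (b m) = p x (f (g x) m)) <->
  cube_of f' = isotope (Defs.conjugate (cube_of f) g) p.
Proof.
move=> n2 bp bp'; have inj := pairwise_biplane_inj n2 bp.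
have back (t : {ffun 'I_n -> 'I_11}) m : tuple_of f m =
    [ffun k => [ffun k0 => ((p k0)^-1)%g (t k0)] ((g^-1)%g k)] <-> t = [ffun x => p x (f (g x) m)].
  split=> [/ffunP e|->]; apply/ffunP=> x; last by rewrite !ffunE permKV permK.
  by have := e (g x); rewrite !ffunE permK => ->; rewrite permKV.
have IE t : isotope (Defs.conjugate (cube_of f) g) p t =
    cube_of f [ffun k => [ffun k0 => ((p k0)^-1)%g (t k0)] ((g^-1)%g k)].
  by rewrite /isotope ffunE /Defs.conjugate ffunE.
split=> [[b hb]|/ffunP e].
  apply/ffunP=> t; rewrite IE; apply/cube_ofP/cube_ofP => -[m].
    move=> ->; exists (b^-1%g m); apply/esym/back/ffunP=> x; rewrite !ffunE.
    by rewrite -hb permKV.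
  by move/esym/back => ->; exists (b m); apply/ffunP=> x; rewrite !ffunE hb.
have ex m : exists m', [forall x, f' x m' == p x (f (g x) m)].
  have := e [ffun x => p x (f (g x) m)]; rewrite IE.
  have -> : cube_of f [ffun k => [ffun k0 => ((p k0)^-1)%g ([ffun x => p x (f (g x) m)] k0)] ((g^-1)%g k)].
    by apply/cube_ofP; exists m; apply/esym/back.
  case/cube_ofP=> m' /ffunP em; exists m'; apply/forallP=> x; apply/eqP.
  by have := em x; rewrite !ffunE.
pose b0 m := xchoose (ex m).
have hb m x : f' x (b0 m) = p x (f (g x) m).
  by have /forallP/(_ x)/eqP := xchooseP (ex m).
have bI : injective b0.
  move=> m m' em; apply: inj; apply/ffunP=> y; rewrite !ffunE.
  by apply: (@perm_inj _ (p (g^-1 y)%g)); rewrite -[y in f y](permKV g) -!hb em.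
by exists (perm bI) => x m; rewrite permE.
Qed.

Lemma pullback_ker b u : pullback b (kerf u) = kerf (u \o b).
Proof. by apply/setP=> z; rewrite !inE. Qed.

Lemma ker_eqP u w : reflect (forall m m', (u m == u m') = (w m == w m')) (kerf u == kerf w).
Proof.
apply: (iffP eqP) => [/setP e m m'|e]; first by have := e (m, m'); rewrite !inE.
by apply/setP=> -[m m']; rewrite !inE.
Qed.

Lemma ker_eq_perm u w : (forall a, exists m, u m = a) -> kerf u = kerf w ->
  exists p : 'S_11, forall m, w m = p (u m).
Proof.
move=> sur /eqP/ker_eqP e.
have ex a : exists m, u m == a by have [m <-] := sur a; exists m.
have pI : injective (fun a => w (xchoose (ex a))).
  move=> a a' /eqP; rewrite -e => /eqP.
  by rewrite (eqP (xchooseP (ex a))) (eqP (xchooseP (ex a'))).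
exists (perm pI) => m; rewrite permE; apply/eqP; rewrite -e.
by rewrite (eqP (xchooseP (ex (u m)))).
Qed.

(** The isotopy disappears from the statement because [ker_eq_perm] recovers it, coordinate by
    coordinate, from an equality of kernels. *)
Lemma equivalent_cube_of f f' : 1 < n -> pairwise_biplane f -> pairwise_biplane f' ->
  reflect (exists (b : {perm F}) (g : 'S_n), forall x, pullback b (kerf (f' x)) = kerf (f (g x)))
    (equivalent (cube_of f) (cube_of f')).
Proof.
move=> n2 bp bp'; apply: (iffP (equivalentP _ _)) => [[g [p]]|[b [g e]]].
  case/cube_of_isotope=> // b hb; exists b, g => x; rewrite pullback_ker; apply/eqP/ker_eqP=> m m'.
  by rewrite /= !hb (inj_eq perm_inj).
have ex x : exists p : 'S_11, [forall m, f' x (b m) == p (f (g x) m)].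
  have /ker_eq_perm[|p hp] : kerf (f (g x)) = kerf (f' x \o b) by rewrite -pullback_ker.
    by move=> a; apply: pairwise_biplane_surj.
  by exists p; apply/forallP=> m; rewrite -hp.
exists g, [ffun x => xchoose (ex x)]; apply/cube_of_isotope=> //; exists b => x m.
by rewrite ffunE; have /forallP/(_ m)/eqP := xchooseP (ex x).
Qed.

(** Nontriviality passes in one direction because labellings are surjective, so that the identity on
    flags forces a trivial autotopy, and in the other because they are jointly injective. *)
Lemma autotopy_cube_of f : 1 < n -> pairwise_biplane f ->
  reflect (exists2 b : {perm F}, b != 1%g & forall x, pullback b (kerf (f x)) = kerf (f x))
    (autotopy_group (cube_of f) != 1%g :> {set _}).
Proof.
move=> n2 bp; have sur x a : exists m, f x m = a by apply: pairwise_biplane_surj.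
have aut (p : isotopy n 11) : (p \in autotopies (cube_of f)) <-> exists b : {perm F}, forall x m, f x (b m) = p x (f x m).
  rewrite inE; split=> [/eqP e|[b hb]].
    have [_] := @cube_of_isotope f f 1%g p n2 bp bp.
    rewrite conjugate1 => /(_ (esym e))[b hb]; exists b => x m; by rewrite hb perm1.
  have [h _] := @cube_of_isotope f f 1%g p n2 bp bp; rewrite conjugate1 in h.
  by apply/eqP/esym/h; exists b => x m; rewrite perm1.
apply: (iffP idP) => [ntA|[b nb e]].
  have [p pA np] := trivgPn _ ntA.
  have /aut[b hb] : p \in autotopies (cube_of f) by [].
  exists b => [|x].
    apply: contraNneq np => b1; apply/eqP/ffunP=> x; apply/permP=> a; rewrite ffunE perm1.
    by have [m <-] := sur x a; rewrite -hb b1 perm1.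
  rewrite pullback_ker; apply/eqP/ker_eqP=> m m'.
  by rewrite /= !hb (inj_eq perm_inj).
have ex x : exists p : 'S_11, [forall m, f x (b m) == p (f x m)].
  have /ker_eq_perm[|p hp] : kerf (f x) = kerf (f x \o b) by rewrite -pullback_ker.
    by [].
  by exists p; apply/forallP=> m; rewrite -hp.
pose p : isotopy n 11 := [ffun x => xchoose (ex x)].
have hp x m : f x (b m) = p x (f x m).
  by rewrite ffunE; have /forallP/(_ m)/eqP := xchooseP (ex x).
apply/trivgPn; exists p; first by apply/aut; exists b.
apply: contraNneq nb => p1; apply/eqP/permP=> m; rewrite perm1.
by apply: (pairwise_biplane_inj n2 bp); apply/ffunP=> x; rewrite !ffunE hp p1 ffunE perm1.
Qed.
End Cubes.
End Frames.
End Kernels.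
Import Kernels.

(** * Backtracking, and uniqueness of the biplane on 11 points *)

Module BiplaneUniqueness.
(* Unlike [all] and [\in], these do not evaluate the whole list under call by value. *)
Fixpoint allb T (f : T -> bool) s := if s is x :: s' then if f x then allb f s' else false else true.
Fixpoint mem_nat x s := if s is y :: s' then if eqn x y then true else mem_nat x s' else false.

Lemma allbE T (f : T -> bool) s : allb f s = all f s.
Proof. by elim: s => //= x s ->; case: (f x). Qed.

Lemma mem_natE x s : mem_nat x s = (x \in s).
Proof. by elim: s => //= y s ->; rewrite inE eqnE; case: (x == y). Qed.

Section Backtrack.
Variables (T : eqType) (cand : seq T) (chk : seq T -> bool).
(** [acc] is the partial solution read backwards: [chk] meets the newest entry first, and every
    prefix is tested as soon as it is formed. *)
Fixpoint backtrack n acc : seq (seq T) :=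
  if n is n'.+1 then flatten [seq if chk (x :: acc) then backtrack n' (x :: acc) else [::] | x <- cand]
  else [:: rev acc].

Lemma backtrack_complete s acc :
    all (fun x => x \in cand) s ->
    (forall k, k < size s -> chk (rev (take k.+1 s) ++ acc)) ->
  rev acc ++ s \in backtrack (size s) acc.
Proof.
elim: s acc => [|x s IH] acc /=; first by rewrite cats0 inE.
case/andP=> xc sc H; apply/flattenP; exists (backtrack (size s) (x :: acc)).
  apply/mapP; exists x => //; have := H 0 isT; rewrite take0 rev_cons cat_rcons /= => -> //.
rewrite -cat_rcons -rev_cons; apply: IH => // k ks.
by have := H k.+1 ks; rewrite rev_cons cat_rcons.
Qed.

Lemma backtrack_sound n acc s : s \in backtrack n acc ->
  exists2 t, s = rev acc ++ t & (size t == n) && all (fun x => x \in cand) t.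
Proof.
elim: n acc s => [|n IH] acc s /=.
  by rewrite inE => /eqP ->; exists [::]; rewrite ?cats0.
case/flattenP=> l /mapP[x xc ->]; case: ifP => // _ /IH[t -> /andP[/eqP st ct]].
by exists (x :: t); rewrite ?rev_cons ?cat_rcons //= st eqxx xc.
Qed.
End Backtrack.

(* [r] lists a sequence backwards; [f] receives the true position of each entry. *)
Fixpoint all_backward T (f : nat -> T -> bool) r :=
  if r is y :: r' then if f (size r') y then all_backward f r' else false else true.

Lemma all_backward_take T x0 (f : nat -> T -> bool) s k : k <= size s ->
  (forall i, i < k -> f i (nth x0 s i)) -> all_backward f (rev (take k s)).
Proof.
elim: k => [|k IH] ks H; first by rewrite take0.
rewrite (take_nth x0) // rev_rcons /= size_rev size_takel ?(ltnW ks) // H //.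
by apply: IH => [|i ik]; [apply: ltnW | apply/H/ltnW].
Qed.

Definition rng := iota 0 11.
Fixpoint mod11 n := if n is m.+4.+4.+3 then mod11 m else n.
(* The biplane of the quadratic residues modulo 11. *)
Definition incn i j := mem_nat (mod11 (j + (11 - i))) [:: 1; 3; 4; 5; 9].

Section Uniqueness.

Fixpoint bits k n : seq (seq bool) :=
  if n is n'.+1 then
    (if k is k'.+1 then [seq true :: s | s <- bits k' n'] else [::]) ++
    [seq false :: s | s <- bits k n']
  else if k is 0 then [:: [::]] else [::].
Fixpoint dotb (s t : seq bool) := match s, t with
  | x :: s', y :: t' => if x then if y then (dotb s' t').+1 else dotb s' t' else dotb s' t'
  | _, _ => 0 end.
Fixpoint lexb (s t : seq bool) := match s, t with
  | x :: s', y :: t' => if x then if y then lexb s' t' else false else if y then true else lexb s' t'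
  | _, _ => true end.

Lemma mem_map_cons (b c : bool) s l : (b :: s \in [seq c :: t | t <- l]) = (b == c) && (s \in l).
Proof.
apply/mapP/andP => [[t tl [-> ->]]|[/eqP -> sl]]; first by rewrite eqxx.
by exists s.
Qed.

Lemma mem_bits k n s : (s \in bits k n) = (size s == n) && (count id s == k).
Proof.
elim: n k s => [|n IH] k s; first by case: k => [|k]; case: s => [|b s].
case: s => [|b s] /=.
  by rewrite mem_cat; apply/negP=> /orP[]; [case: k => [//|k]|]; case/mapP.
rewrite mem_cat mem_map_cons IH.
have -> : (b :: s \in (if k is k'.+1 then [seq true :: s | s <- bits k' n] else [::])) =
    b && (size s == n) && ((count id s).+1 == k).
  by case: k => [|k]; rewrite ?andbF // mem_map_cons IH eqSS eqb_id andbA.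
by rewrite eqSS; case: b; rewrite /= ?orbF.
Qed.

Lemma dotb_map T (f g : T -> bool) s : dotb (map f s) (map g s) = count (fun x => f x && g x) s.
Proof. by elim: s => //= x s ->; case: (f x); case: (g x). Qed.

Lemma lexb_total : total lexb.
Proof. by elim=> [|x s IH] [|y t] //=; case: x; case: y => /=. Qed.

Lemma lexb_trans s t r : size s = size t -> size t = size r -> lexb s t -> lexb t r -> lexb s r.
Proof.
elim: s t r => [|x s IH] [|y t] [|z r] //= [es] [et].
by case: x; case: y; case: z => //=; apply: IH.
Qed.

Lemma lexb_take k s t : lexb s t -> lexb (take k s) (take k t).
Proof. by elim: s t k => [|x s IH] [|y t] [|k] //=; case: x; case: y => //=; apply: IH. Qed.

(** Two of the five columns of row 0 lie together in exactly one other row, so the ten other rows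
    are indexed by the pairs of these columns. *)
Definition pairs := bits 2 5.
Definition colb (rows : seq (seq bool)) j := [seq nth false r j | r <- rows].
(* Rows 1..10 of a biplane whose row 0 is the first five columns: row k+1 meets row 0 in pairs[k];
   the other six columns are in lexicographic order. *)
Definition chkU (acc : seq (seq bool)) := if acc is x :: r then let k := size r in
   if all_backward (fun i y => eqn (dotb x y + dotb (nth [::] pairs k) (nth [::] pairs i)) 2) r
   then let rows := rev acc in allb (fun j => lexb (colb rows j) (colb rows j.+1)) (iota 0 5) else false else true.
(** A row has five ones, two of which are in the columns of row 0; three remain for the other six
    columns. *)
Definition completions := backtrack (bits 3 6) chkU 10 [::].
Definition full_rows (l : seq (seq bool)) :=
  (nseq 5 true ++ nseq 6 false) :: [seq p.1 ++ p.2 | p <- zip pairs l].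
(** Relabellings of rows and columns that carry each of the two completions to the biplane of
    quadratic residues. *)
Definition iso_hints : seq (seq nat * seq nat) :=
  [:: ([:: 0;1;2;4;7;10;6;3;5;9;8], [:: 5;4;3;9;1;8;0;7;10;2;6]);
      ([:: 0;1;2;7;4;10;3;6;9;5;8], [:: 5;4;3;1;9;8;7;0;2;10;6])].
Definition iso_check (x : seq (seq bool) * (seq nat * seq nat)) :=
  all (fun i => all (fun j => nth false (nth [::] (full_rows x.1) i) j == incn (nth 0 x.2.1 i) (nth 0 x.2.2 j)) rng) rng.

Lemma completions_iso : (size completions == 2) &&
  all iso_check (zip completions iso_hints) && all (fun h => perm_eq h.1 rng && perm_eq h.2 rng) iso_hints.
Proof. by vm_compute. Qed.

Variable I : 'I_11 -> 'I_11 -> bool.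
Hypothesis rowI : forall a a', #|[set c | I a c && I a' c]| = if a == a' then 5 else 2.
Hypothesis colI : forall c c', #|[set a | I a c && I a c']| = if c == c' then 5 else 2.

(** Once the rows are indexed by [pairs], only the order of six columns is free. Sorting them puts
    the biplane among the two [completions], for both of which an isomorphism is listed. *)
Lemma unique_biplane : exists (s t : 'S_11), forall a c, I a c = incn (s a) (t c).
Proof.
pose r0 : 'I_11 := ord0; pose C0 := [set c | I r0 c].
have cC0 : #|C0| = 5.
  by have := rowI r0 r0; rewrite eqxx => h; rewrite -[RHS]h; apply: eq_card => c; rewrite !inE andbb.
pose cs := enum C0; have scs : size cs = 5 by rewrite -cardE.
pose c_ i := nth r0 cs i.
have ucs : uniq cs by apply: enum_uniq.
have mcs c : (c \in cs) = I r0 c by rewrite mem_enum inE.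
have c_in i : i < 5 -> I r0 (c_ i) by move=> i5; rewrite -mcs mem_nth ?scs.
(* other rows *)
pose pat a := [seq I a c | c <- cs].
(* Two columns of row [r0] have two rows in common, hence exactly one besides [r0]; by [rowI] that
   row has no third column in common with [r0]. *)
have exr k : k < 10 -> exists a, (a != r0) && (pat a == nth [::] pairs k).
  move=> k10; have : nth [::] pairs k \in pairs by apply: mem_nth.
  rewrite mem_bits => /andP[/eqP sp /eqP cp]; set p := nth _ _ _ in sp cp *.
  have [i [j [ij j5 pE]]] : exists i j, [/\ i < j, j < 5 & forall m, m < 5 -> nth false p m = (m == i) || (m == j)].
    clear -sp cp; move: p sp cp => [|b0 [|b1 [|b2 [|b3 [|b4 []]]]]] //= _.
    have ex i j : i < j -> j < 5 -> all (fun m => nth false [:: b0; b1; b2; b3; b4] m == ((m == i) || (m == j))) (iota 0 5) ->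
        exists i j, [/\ i < j, j < 5 & forall m, m < 5 -> nth false [:: b0; b1; b2; b3; b4] m = (m == i) || (m == j)].
      by move=> ij j5 /allP H; exists i, j; split=> // m m5; apply/eqP/H; rewrite mem_iota.
    move: ex; case: b0; case: b1; case: b2; case: b3; case: b4 => ex ct; try discriminate ct;
      first [exact: (ex 0 1) | exact: (ex 0 2) | exact: (ex 0 3) | exact: (ex 0 4) | exact: (ex 1 2)
      | exact: (ex 1 3) | exact: (ex 1 4) | exact: (ex 2 3) | exact: (ex 2 4) | exact: (ex 3 4)].
  have i5 := ltn_trans ij j5.
  have cij : c_ i != c_ j by rewrite nth_uniq ?scs // ltn_eqF.
  have := colI (c_ i) (c_ j); rewrite (negPf cij) (cardsD1 r0) !inE !c_in //= add1n => -[/eqP/cards1P[a /setP ea]].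
  have := ea a; rewrite !inE eqxx => /and3P[na Ii Ij]; exists a; rewrite na /=.
  have c2 : count (fun c => I a c) cs = 2.
    have := rowI r0 a; rewrite eq_sym (negPf na) => h; rewrite -[RHS]h -size_filter.
    rewrite cardE; apply: perm_size; apply: uniq_perm; [exact: filter_uniq|exact: enum_uniq|move=> c].
    by rewrite mem_filter mcs mem_enum inE andbC.
  apply/eqP/(@eq_from_nth _ false); rewrite size_map scs // => m m5.
  rewrite (nth_map r0) ?scs // pE //; apply/idP/orP => [Im|[/eqP ->|/eqP ->] //].
  apply/orP/negPn/negP; rewrite negb_or => /andP[mi mj].
  have : 3 <= size [seq c <- cs | I a c].
    apply: (@uniq_leq_size _ [:: c_ m; c_ i; c_ j]) => [|c].
      by rewrite /= !inE !nth_uniq ?scs // negb_or mi mj ltn_eqF.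
    by rewrite !inE mem_filter => /or3P[]/eqP ->; rewrite ?Im ?Ii ?Ij mem_nth ?scs.
  by rewrite size_filter c2.
pose rw k := if k is k'.+1 then odflt r0 [pick a | (a != r0) && (pat a == nth [::] pairs k')] else r0.
have rwP k : k < 10 -> (rw k.+1 != r0) /\ pat (rw k.+1) = nth [::] pairs k.
  by move=> /exr[a ha]; rewrite /rw; case: pickP => [b /andP[? /eqP]|/(_ a)]; rewrite ?ha.
pose rows := [seq rw k | k <- rng].
have urows : uniq rows.
  rewrite map_inj_in_uniq ?iota_uniq // => k k'; rewrite !mem_iota /= !add0n.
  case: k k' => [|k] [|k'] //= h h' e.
  - by case: (rwP _ h') => /eqP n _; case: n; symmetry.
  - by case: (rwP _ h) => /eqP n _; case: n.
  have [_ p] := rwP _ h; have [_ p'] := rwP _ h'.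
  have : nth [::] pairs k == nth [::] pairs k' by rewrite -p -p' (e : rw k.+1 = rw k'.+1).
  by rewrite nth_uniq // => /eqP ->.
pose rs k := rw k.+1.
pose vec c := [seq I (rs k) c | k <- iota 0 10].
(* Sorted columns pass the lexicographic test of [chkU] at every stage, because truncation preserves
   the order. *)
pose rest := sort (fun c d => lexb (vec c) (vec d)) (enum (~: C0)).
have srest : size rest = 6 by rewrite size_sort -cardE cardsCs setCK cC0 card_ord.
have mrest c : (c \in rest) = ~~ I r0 c by rewrite mem_sort mem_enum !inE.
pose cols := cs ++ rest.
have ucols : uniq cols.
  rewrite cat_uniq ucs sort_uniq enum_uniq andbT; apply/hasPn=> c.
  by rewrite mem_sort mem_enum !inE mcs.
have pcols : perm_eq cols (enum 'I_11).
  apply: uniq_perm; rewrite ?enum_uniq // => c; rewrite mem_cat mcs mrest mem_enum.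
  by case: (I r0 c).
have count2 a b : count (fun c => I a c && I b c) cols = if a == b then 5 else 2.
  rewrite (seq.permP pcols) -[RHS]rowI -size_filter cardE; apply: perm_size.
  apply: uniq_perm; [exact/filter_uniq/enum_uniq|exact: enum_uniq|move=> c].
  by rewrite mem_filter [RHS]mem_enum inE mem_enum andbT.
have rw_eq k k' : k < 11 -> k' < 11 -> (rw k == rw k') = (k == k').
  move=> h h'; have e m : m < 11 -> rw m = nth r0 rows m.
    by move=> m11; rewrite (nth_map 0) ?size_iota // nth_iota.
  by rewrite !e // nth_uniq.
pose half a := [seq I a c | c <- rest].
pose leaf := [seq half (rs k) | k <- iota 0 10].
have sleaf : size leaf = 10 by rewrite size_map size_iota.
have dot2 k k' : k < 10 -> k' < 10 -> dotb (half (rs k)) (half (rs k')) +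
    dotb (nth [::] pairs k) (nth [::] pairs k') = if k == k' then 5 else 2.
  move=> h h'; have [_ <-] := rwP _ h; have [_ <-] := rwP _ h'.
  rewrite !dotb_map addnC -count_cat count2; congr (if _ then _ else _).
  by rewrite rw_eq.
have leafU : leaf \in completions.
  have -> : leaf = rev [::] ++ leaf by [].
  rewrite /completions -[10]sleaf; apply: backtrack_complete.
    apply/allP=> x /mapP[k]; rewrite mem_iota => /andP[_ h] ->.
    rewrite mem_bits size_map srest eqxx /=; have := dot2 k k h h; rewrite eqxx.
    have -> : dotb (nth [::] pairs k) (nth [::] pairs k) = 2.
      by move: h; do 10?[case: k => [|k] //].
    rewrite dotb_map => /eqP; rewrite -[5]/(3 + 2) eqn_add2r => /eqP <-.
    by rewrite count_map; apply/eqP/eq_count => c /=; rewrite andbb.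
  move=> k; rewrite sleaf cats0 => k10.
  rewrite (take_nth [::]) ?sleaf // rev_rcons /chkU.
  have -> : size (rev (take k leaf)) = k by rewrite size_rev size_takel ?sleaf // ltnW.
  rewrite -rev_rcons revK -(take_nth [::]) ?sleaf //.
  have nl j : j < 10 -> nth [::] leaf j = half (rs j).
    by move=> h; rewrite (nth_map 0) ?size_iota // nth_iota.
  rewrite (all_backward_take (x0 := [::])) ?sleaf //; last first.
  - move=> j jk; have j10 := ltn_trans jk k10.
    rewrite !nl // eqnE dot2 //.
    by rewrite [k == j]gtn_eqF.
  - exact: ltnW.
  rewrite allbE; apply/allP=> j; rewrite mem_iota add0n => /andP[_ j5].
  have colE i : i < 6 -> colb (take k.+1 leaf) i = take k.+1 (vec (nth r0 rest i)).
    move=> i6; rewrite /colb /leaf -map_take -map_comp -map_take; apply: eq_map => m /=.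
    by rewrite (nth_map r0) ?srest.
  rewrite !colE //; last exact: ltnW.
  apply: lexb_take; have : sorted (fun c d => lexb (vec c) (vec d)) rest.
    by apply: sort_sorted => c d; apply: lexb_total.
  by move/(sortedP r0)/(_ j); rewrite srest; apply.
have /andP[/andP[/eqP sU chk] ph] := completions_iso.
pose i0 := index leaf completions; have i0s : i0 < 2 by rewrite -sU index_mem.
pose h := nth ([::], [::]) iso_hints i0.
have /andP[p1 p2] : perm_eq h.1 rng && perm_eq h.2 rng by apply: (allP ph); rewrite mem_nth.
have chk1 : iso_check (leaf, h).
  apply: (allP chk); rewrite -[leaf](nth_index [::] leafU) -[(_, _)]nth_zip ?sU //.
  by apply: mem_nth; rewrite size_zip sU.
have fr i j : i < 11 -> j < 11 -> nth false (nth [::] (full_rows leaf) i) j = I (rw i) (nth r0 cols j).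
  move=> i11 j11; rewrite nth_cat scs; case: i i11 => [|i] i11.
    have -> : nth false (nth [::] (full_rows leaf) 0) j = (j < 5).
      by move: j11; do 11?[case: j => [|j] //].
    case: ltnP => j5; first by rewrite c_in.
    by apply/esym/negbTE; rewrite -mrest mem_nth // srest ltn_subLR.
  have i10 : i < 10 by [].
  have -> : nth [::] (full_rows leaf) i.+1 = nth [::] [seq p.1 ++ p.2 | p <- zip pairs leaf] i by [].
  rewrite (nth_map ([::], [::])) ?size_zip ?sleaf // nth_zip ?sleaf //.
  rewrite nth_cat (nth_map 0) ?size_iota // nth_iota // [half _]/(half (rw i.+1)).
  have [_ pp] := rwP _ i10; move: (rw i.+1) pp => w pp.
  rewrite -pp size_map scs; case: ltnP => j5; first by rewrite (nth_map r0) ?scs.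
  by rewrite (nth_map r0) // srest ltn_subLR.
have srows : size rows = 11 by [].
have scols : size cols = 11 by rewrite size_cat scs srest.
have mrows a : a \in rows.
  have /subset_cardP/(_ (subset_predT _)) -> // : #|rows| = #|'I_11|.
  by rewrite (card_uniqP urows) card_ord.
have mcols c : c \in cols by rewrite (perm_mem pcols) mem_enum.
have perm_of (l : seq 'I_11) (q : seq nat) : (forall a, a \in l) -> size l = 11 -> perm_eq q rng ->
    exists s : 'S_11, forall a, s a = nth 0 q (index a l) :> nat.
  move=> ml sl pq; have sq : size q = 11 by rewrite (perm_size pq).
  have il a : index a l < 11 by have := ml a; rewrite -index_mem; move: (index a l) => i; rewrite sl.
  have lt a : nth 0 q (index a l) < 11.
    have : nth 0 q (index a l) \in rng by rewrite -(perm_mem pq) mem_nth // sq.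
    by rewrite mem_iota.
  have inj : injective (fun a => Ordinal (lt a)).
    move=> a b [] /eqP; rewrite nth_uniq ?sq ?il ?(perm_uniq pq) // => /eqP e.
    by rewrite -[a](nth_index r0 (ml a)) e nth_index.
  by exists (perm inj) => a; rewrite permE.
have [s hs] := perm_of rows h.1 mrows srows p1.
have [t ht] := perm_of cols h.2 mcols scols p2.
exists s, t => a c; rewrite hs ht.
have ia : index a rows < 11 by have := mrows a; rewrite -index_mem; move: (index a rows) => i; rewrite srows.
have ic : index c cols < 11 by have := mcols c; rewrite -index_mem; move: (index c cols) => i; rewrite scols.
have := allP chk1 (index a rows); rewrite mem_iota => /(_ ia)/allP/(_ (index c cols)).
rewrite mem_iota => /(_ ic)/eqP /= <-; rewrite fr // nth_index //.
suff -> : rw (index a rows) = a by [].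
by rewrite -[RHS](nth_index r0 (mrows a)) (nth_map 0) ?size_iota // nth_iota.
Qed.
End Uniqueness.
End BiplaneUniqueness.
Import BiplaneUniqueness.

(** * The programs of the search, on lists of natural numbers *)

Module Search.
Fixpoint findd (f : nat -> bool) s := if s is x :: s' then if f x then x else findd f s' else 0.
Fixpoint pos_in x s := if s is y :: s' then if eqn x y then 0 else (pos_in x s').+1 else 0.
Fixpoint cmps (s t : seq nat) : comparison :=
  match s, t with
  | x :: s', y :: t' => (fix cmp m n := match m, n with
      | 0, 0 => cmps s' t' | 0, _.+1 => Lt | _.+1, 0 => Gt | m'.+1, n'.+1 => cmp m' n' end) x y
  | [::], [::] => Eq | [::], _ => Lt | _, _ => Gt end.
Definition les s t := if cmps s t is Gt then false else true.
Fixpoint eqs (s t : seq nat) := match s, t with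
  | [::], [::] => true | x :: s', y :: t' => if eqn x y then eqs s' t' else false | _, _ => false end.

Definition Brow := [seq [seq j <- rng | incn i j] | i <- rng].
Definition Bcol := [seq [seq i <- rng | incn i j] | j <- rng].
Definition brow i := nth [::] Brow i.
Definition bcol j := nth [::] Bcol j.
Definition ap (p : seq nat) i := nth 0 p i.
Definition invp p := [seq pos_in i p | i <- rng].
Definition mulp p q := map (ap q) p.
Definition autcol a := [seq findd (fun c => allb (fun i => mem_nat (ap a i) (bcol c)) (bcol j)) rng | j <- rng].
Definition isaut a := let t := autcol a in allb (fun j => let c := bcol (ap t j) in allb (fun i => mem_nat (ap a i) c) (bcol j)) rng.

(** A flag is a row together with the position of its column in the list [brow] of that row. A [mat]
    stores the label of every flag, a [table] the image of every flag under a map. *)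
Definition table := seq (seq (nat * nat)).
Definition mat := seq (seq nat).
Definition colp i p := nth 0 (brow i) p.
Definition at_ (M : mat) (m : nat * nat) := nth 0 (nth [::] M m.1) m.2.
Definition mktab (f : nat -> nat -> nat * nat) : table := [seq [seq f i p | p <- iota 0 5] | i <- rng].
Definition pull (t : table) (M : mat) : mat := map (map (at_ M)) t.
Definition flag i j := (i, pos_in j (brow i)).
Definition atab (a b : seq nat) := mktab (fun i p => flag (ap a i) (ap b (colp i p))).

Fixpoint has3 (u v w : seq nat) := match u, v, w with
  | x :: u', y :: v', z :: w' => if x is 0 then has3 u' v' w' else if y is 0 then has3 u' v' w' else if z is 0 then has3 u' v' w' else true
  | _, _, _ => false end.
Definition Bvec := [seq [seq nat_of_bool (incn i j) | j <- rng] | i <- rng].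
(** Whether three rows share a point does not depend on the names of the points. This prunes the
    search for automorphisms and tells label systems apart. *)
Definition h3 (V : mat) i j k := has3 (nth [::] V i) (nth [::] V j) (nth [::] V k).

Definition chkaut (acc : seq nat) := if acc is x :: r then
    if mem_nat x r then false else let k := size r in
    all_backward (fun j y => eqb (h3 Bvec k j 0) (h3 Bvec x y 0)) r
  else true.
Definition stab0 := [seq a <- backtrack rng chkaut 10 [:: 0] | isaut a].
Definition shift c := [seq mod11 (i + c) | i <- rng].
(** The shifts are transitive on rows, so every automorphism is one that fixes row 0 followed by a
    shift. *)
Definition K := flatten [seq [seq mulp a (shift c) | c <- rng] | a <- stab0].

Inductive trie (A : Type) := Leaf of option A | Node of trie A & trie A.
Arguments Leaf {A}.
Fixpoint tfind A (k : seq bool) (t : trie A) := match t, k with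
  | Leaf o, _ => o | Node u v, b :: k' => if b then tfind k' u else tfind k' v | _, _ => None end.
(* inserts by combining with the value already present *)
Fixpoint update A (f : option A -> A) (k : seq bool) (t : trie A) := match k with
  | b :: k' => match t with
     | Node u v => if b then Node (update f k' u) v else Node u (update f k' v)
     | Leaf _ => if b then Node (update f k' (Leaf None)) (Leaf None) else Node (Leaf None) (update f k' (Leaf None)) end
  | [::] => Leaf (Some (f (if t is Leaf o then o else None))) end.
Fixpoint leaves A (t : trie A) := match t with Leaf (Some x) => [:: x] | Leaf None => [::] | Node u v => leaves u ++ leaves v end.
Fixpoint tmap A B (f : A -> B) t := match t with Leaf (Some x) => Leaf (Some (f x)) | Leaf None => Leaf None | Node u v => Node (tmap f u) (tmap f v) end.

(** Labels play the part of points: row i carries the labels that form the block n^-1(i) of the base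
    biplane. *)
Definition sysV n : mat := let ni := invp n in [seq nth [::] Bvec (ap ni i) | i <- rng].

(** One image of a kernel under an automorphism of the base biplane: the table of the inverse flag
    map, the normal form of the new row permutation, and the renaming of labels that leads to it. *)
Definition rimage := (table * seq nat * seq nat)%type.
(** A row permutation in normal form with its images. The second list belongs to the inverse
    permutation, which describes a frame of three kernels after the third has exchanged places with
    the columns. *)
Definition entry := (seq nat * (seq rimage * seq rimage))%type.

(** [elts] and [gens] give the group P by row permutations; [nsl] lists the row permutations
    normalising it; [nreps] are those that are automorphisms of the base, modulo P; [drow] and
    [dcol] give a duality normalising P; [keys] are triples of rows that separate label systems up
    to the names of the labels. *)
Record gdata := GD {
  elts : seq (seq nat); gens : seq (seq nat); keys : seq (nat * nat * nat);
  nreps : seq (seq nat); nsl : seq (seq nat); drow : seq nat; dcol : seq nat }.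

(* backwards list of images of rows 0, 1, ...; commutation of the last one with pairs (p, q) *)
Definition chkcomm (pq : seq (seq nat * seq nat * seq nat)) (acc : seq nat) := if acc is x :: r then
   if mem_nat x r then false else
   let s := rev acc in let k := size r in
   allb (fun z : seq nat * seq nat * seq nat => let: (p, p1, q) := z in
      let y := nth 11 s (ap p k) in
      if (if eqn y 11 then true else eqn y (ap q x)) then
        let y := nth 11 s (ap p1 k) in if eqn y 11 then true else eqn x (ap q y)
      else false) pq
  else true.
Fixpoint choices (gs es : seq (seq nat)) : seq (seq (seq nat * seq nat * seq nat)) :=
  if gs is g :: gs' then let l := choices gs' es in flatten [seq map (cons (g, invp g, q)) l | q <- es] else [:: [::]].
(** A normalising permutation conjugates each generator to some element of the group; all choices of
    these elements are tried. *)
Definition normrows gs es := flatten [seq backtrack rng (chkcomm pq) 11 [::] | pq <- choices gs es].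
Fixpoint cosets (es l seen : seq (seq nat)) := if l is a :: l' then
  if has (eqs a) seen then cosets es l' seen else a :: cosets es l' ([seq mulp p a | p <- es] ++ seen) else [::].

Fixpoint uniqn (s : seq nat) := if s is x :: s' then if mem_nat x s' then false else uniqn s' else true.
Section Data.
Variable D : gdata.
Definition key (V : mat) := [seq h3 V t.1.1 t.1.2 t.2 | t <- keys D].
(** Among the row permutations with a given key the one inserted first is kept, and it becomes the
    normal form. *)
Definition trie0 := foldr (fun n t => update (fun o => if o is Some n0 then n0 else n) (key (sysV n)) t) (Leaf None) (nsl D).
Definition imgs (t0 : trie (seq nat)) (nr : seq (seq nat * table)) m : seq rimage :=
  [seq let gm := mulp m g.1 in let n' := if tfind (key (sysV gm)) t0 is Some n then n else [::] in
       (g.2, n', autcol (mulp gm (invp n'))) | g <- nr].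
Definition mktrie : trie entry := let t0 := trie0 in
  let nr := [seq (g, let gi := invp g in atab gi (autcol gi)) | g <- nreps D] in
  tmap (fun n => (n, (imgs t0 nr n, imgs t0 nr (invp n)))) t0.
(** The duality as a map of flags: it exchanges the kernel of the rows and the kernel of the
    columns. *)
Definition dtab : table := let di := invp (drow D) in let ci := invp (dcol D) in mktab (fun i p => flag (ap ci (colp i p)) (ap di i)).
Variable tr : trie entry.
Definition look V : entry := if tfind (key V) tr is Some e then e else ([::], ([::], [::])).
(** Codes begin with the row permutation, so a frame can be least only if no image has a smaller
    one. *)
Definition pre (e : entry) := if allb (fun x : rimage => les e.1 x.1.2) e.2.1 then allb (fun x : rimage => les e.1 x.1.2) e.2.2 else false.
Fixpoint mins (s : seq nat) (l : seq rimage) := if l is x :: l' then mins (if les s x.1.2 then s else x.1.2) l' else s.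
Definition cmin (e : entry) := if e.2.1 is x :: _ then mins (mins x.1.2 e.2.1) e.2.2 else e.1.

(* cells: lists indexed by columns, 0 = empty, i.+1 = row i *)
Fixpoint cput (c : seq nat) j i := match c, j with
  | x :: c', 0 => if x is 0 then Some (i.+1 :: c') else None
  | x :: c', j'.+1 => if cput c' j' i is Some d then Some (x :: d) else None
  | _, _ => None end.
Fixpoint cells (rows c : seq nat) : seq (seq nat) :=
  if rows is i :: rows' then flatten [seq if cput c j i is Some d then cells rows' d else [::] | j <- brow i] else [:: c].
(** Used with [k] = 2: the classes of two labels share exactly two columns and no flag. *)
Fixpoint meet2 k (c d : seq nat) : bool := match c, d with
  | x :: c', y :: d' => if x is i.+1 then if y is j.+1 then
        if k is k'.+1 then if eqn i j then false else meet2 k' c' d' else false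
      else meet2 k c' d' else meet2 k c' d'
  | _, _ => if k is 0 then true else false end.
(* actions: (row perm, inverse col perm) *)
Definition acts := [seq (p, invp (autcol p)) | p <- elts D].
Definition cimg (x : seq nat * seq nat) (c : seq nat) := [seq if nth 0 c (ap x.2 j) is i.+1 then (ap x.1 i).+1 else 0 | j <- rng].
(** The rows of a class determine its label. A group element preserving the rows must therefore fix
    the class, and any other sends it to the class of a different label. *)
Definition options (A : seq (seq nat * seq nat)) rows : seq (seq (seq nat)) :=
  let A := [seq (x, allb (fun i => mem_nat (ap x.1 i) rows) rows) | x <- A] in
  [seq [seq cimg x.1 c | x <- A] | c <- cells rows (nseq 11 0) &
     allb (fun x => let d := cimg x.1 c in if x.2 then eqs c d else meet2 2 c d) A].
Definition colpat (c : seq nat) := [seq if x is 0 then false else true | x <- c].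
Definition otrie := trie (seq (seq (seq nat))).
Definition group_options (l : seq (seq (seq nat))) : otrie :=
  foldr (fun o t => update (fun z => o :: odflt [::] z) (colpat (head [::] o)) t) (Leaf None) l.
(* patterns of the column blocks C_t of k *)
Definition pats k : seq (seq bool) := let V := sysV k in [seq [seq (if nth 0 (nth [::] V (ap (drow D) j)) t is 0 then false else true) | j <- rng] | t <- rng].
Definition blockrows n s := [seq ap n i | i <- bcol s].
Definition labact n p := autcol (mulp (mulp n p) (invp n)).
Fixpoint labreps (l : seq (seq nat)) ss seen := if ss is s :: ss' then if mem_nat s seen then labreps l ss' seen else
   let o := [seq ap x s | x <- l] in (s, allb (eqn s) o) :: labreps l ss' (o ++ seen) else [::].
Definition labacts n := [seq labact n p | p <- elts D].
(** Labels fixed by the group come first, since their classes have to be invariant, which leaves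
    fewer choices. *)
Definition ordreps n := let l := labreps (labacts n) rng [::] in
   [seq x.1 | x <- [seq x <- l | x.2] ++ [seq x <- l | ~~ x.2]].

Definition compat (o o' : seq (seq nat)) := if o is c :: _ then allb (meet2 2 c) o' else true.
(** The fuel has to exceed the number of orbits of labels; [search] passes 12, enough for 11
    labels. *)
Fixpoint dfs m (ls : seq (seq nat * seq (seq (seq nat)))) acc : seq (seq (nat * seq nat)) :=
  if m is m'.+1 then if ls is (ss, l) :: t then
    flatten [seq dfs m' [seq (x.1, [seq o' <- x.2 | compat o o']) | x <- t] (zip ss o ++ acc) | o <- l]
  else [:: acc] else [::].
Definition search (ct : seq (seq nat * otrie)) (ps : seq (seq bool)) :=
  dfs 12 [seq (x.1, flatten [seq if tfind p x.2 is Some l then l else [::] | p <- ps]) | x <- ct] [::].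
Definition ctries (A : seq (seq nat * seq nat)) n : seq (seq nat * otrie) := let l := labacts n in
  [seq ([seq ap x s | x <- l], group_options (options A (blockrows n s))) | s <- ordreps n].

Fixpoint assoc s (o : seq (nat * seq nat)) := if o is x :: o' then if eqn s x.1 then x.2 else assoc s o' else [::].
Definition tocells o := [seq assoc s o | s <- rng].
Fixpoint zipcons (u : seq nat) (t : mat) := match u, t with x :: u', y :: t' => (x :: y) :: zipcons u' t' | _, _ => [::] end.
Definition transp (c : mat) : mat := foldr zipcons (nseq 11 [::]) c.
Definition build (tc : mat) : mat := [seq [seq pos_in i.+1 (nth [::] tc j) | j <- brow i] | i <- rng].
Definition drows (V : mat) : mat := let di := invp (drow D) in [seq nth [::] V (ap di i) | i <- rng].

(** The renaming of the labels of [M] after which its rows carry the blocks prescribed by [n]. *)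
Definition relabmap n (M : mat) := let ni := invp n in
  [seq findd (fun c => allb (fun i => eqb (mem_nat s (nth [::] M i)) (incn (ap ni i) c)) rng) rng | s <- rng].
Definition relab k (M : mat) : mat := map (map (ap k)) M.
(** The flag with row i and column j goes to the flag of row n(i) with label j. Pulling back along
    this map keeps the kernel of the rows and turns the kernel of [M] into that of the columns. *)
Definition rtab n (M : mat) : table := mktab (fun i p => let i0 := ap n i in (i0, pos_in (colp i p) (nth [::] M i0))).
Definition le1 (n : seq nat) (f : seq nat) (x : rimage) (M : mat) := match cmps n x.1.2 with Lt => true | Gt => false
  | Eq => les f (flatten (relab x.2 (pull x.1.1 M))) end.
Definition axis n f (e : entry) M :=
  if allb (fun x => le1 n f x M) e.2.1 then let Mr := pull (rtab e.1 M) Brow in allb (fun x => le1 n f x Mr) e.2.2 else false.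
Fixpoint eqpat (p : seq bool) (c : seq nat) := match p, c with b :: p', x :: c' => if (if x is 0 then negb b else b) then eqpat p' c' else false
  | [::], [::] => true | _, _ => false end.
(** In a frame of three kernels any of the three may become the rows, and each call of [axis] treats
    one choice. The comparisons [r2] and [r3] with the least row permutation on the second and third
    axis settle these axes unless there is a tie. *)
Definition canon1 (e : entry) (r2 : comparison) (e2 : entry) (lam : seq nat) (cs : mat) (M : mat) :=
  let n := e.1 in
  let e3 := look (drows cs) in
  let r3 := cmps n (cmin e3) in
  if r3 is Gt then false else
  let f := flatten M in
  if axis n f e M then
    if (if r2 is Eq then let M2 := pull dtab M in axis n f e2 (relab lam M2) else true) then
    if r3 is Eq then let M3 := pull dtab (pull (rtab n M) Brow) in axis n f e3 (relab (relabmap e3.1 M3) M3) else true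
    else false else false.
Fixpoint eqmat (M M' : mat) := match M, M' with [::], [::] => true | r :: N, r' :: N' => if eqs r r' then eqmat N N' else false | _, _ => false end.
(* the automorphism x of B with column action b, and label action l *)
Definition invariant (t : table) (l : seq nat) (M : mat) := eqmat (pull t M) (relab l M).
Definition rows_ok n (M : mat) := let ni := invp n in
  allb (fun i => allb (fun s => mem_nat s (nth [::] M i)) (brow (ap ni i))) rng.
Definition cols_ok (ps : seq (seq bool)) (lam : seq nat) (cs : mat) :=
  allb (fun s => eqpat (nth [::] ps (ap lam s)) (nth [::] cs s)) rng.
Definition lambda (ps : seq (seq bool)) (cs : mat) := [seq findd (fun t => eqpat (nth [::] ps t) c) rng | c <- cs].
Definition conjact n x := mulp (mulp n x) (invp n).
Definition actions n (X : seq (seq nat * table)) : seq (table * seq nat) :=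
  [seq (x.2, autcol (conjact n x.1)) | x <- X & isaut (conjact n x.1)].
Fixpoint dedup (l : seq mat) := if l is M :: l' then if has (eqmat M) l' then dedup l' else M :: dedup l' else [::].
(** [can] restricts to canonical frames; [Gn] are automorphisms that must preserve the labelling,
    [Xn] automorphisms that must not. *)
Definition check (can : bool) (e : entry) r2 (e2 : entry) ps Gn Xn (o : seq (nat * seq nat)) : seq mat :=
  let cs := tocells o in let M := build (transp cs) in let lam := lambda ps cs in
  if (if can then canon1 e r2 e2 lam cs M else true) then
  if rows_ok e.1 M then if cols_ok ps lam cs then if uniqn lam then
  if allb (fun z => invariant z.1 z.2 M) Gn then
  if allb (fun z => ~~ invariant z.1 z.2 M) Xn then [:: M] else [::] else [::] else [::] else [::] else [::] else [::].
(** For each row system of the labelling, [y] runs over the row systems that its dual may have;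
    these prescribe the sets of columns of the label classes. *)
Definition sols (can : bool) (X : seq (seq nat)) : seq (seq (entry*mat)) :=
  let T := [seq (e, (cmin e, pats e.1)) | e <- leaves tr] in let A := acts in
  let withtab := map (fun x => (x, atab x (autcol x))) in
  let G := withtab (gens D) in let X := withtab X in
  [seq let e := x.1 in let n := e.1 in let ct := ctries A n in let Gn := actions n G in let Xn := actions n X in
     [seq (e, M) | M <- dedup (flatten [seq let r2 := cmps n y.2.1 in
       if (if can then (if r2 is Gt then true else false) else false) then [::] else
       flatten [seq check can e r2 y.1 y.2.2 Gn Xn o | o <- search ct y.2.2] | y <- T])]
   | x <- [seq x <- T | if can then pre x.1 else true]].

(* several vertices *)
Definition frame := seq (entry * mat).
Definition rowvecs (M : mat) : mat := [seq [seq nat_of_bool (mem_nat s r) | s <- rng] | r <- M].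
Definition norm (M : mat) : entry * mat := let e := look (rowvecs M) in (e, relab (relabmap e.1 M) M).
(** Each kernel of the frame in turn takes the place of the columns, and the former columns, [Brow],
    take its place in the list. *)
Fixpoint rhos (S1 S2 : frame) : seq frame := if S2 is v :: S2' then
   let t := rtab v.1.1 v.2 in
   [seq norm (pull t M) | M <- [seq w.2 | w <- S1] ++ Brow :: [seq w.2 | w <- S2']] :: rhos (rcons S1 v) S2' else [::].
Definition delta (Q : frame) : frame := [seq norm (pull dtab v.2) | v <- Q].
Definition code (v : seq nat * mat) := v.1 ++ flatten v.2.
Fixpoint insc (x : seq nat) s := if s is y :: s' then if les x y then x :: s else y :: insc x s' else [:: x].
(** Sorting makes the code of a frame independent of the order of its kernels, and puts its least
    kernel first. *)
Definition codes (Q : seq (seq nat * mat)) := flatten (foldr insc [::] (map code Q)).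
Definition gimage j (v : entry * mat) : seq nat * mat :=
  let x := nth ([::], [::], [::]) v.1.2.1 j in (x.1.2, relab x.2 (pull x.1.1 v.2)).
Definition axisS c (Z : frame) := allb (fun Z' => allb (fun j => les c (codes (map (gimage j) Z'))) (iota 0 (size (nreps D)))) (Z :: rhos [::] Z).
(** Any kernel may become the rows: the rows themselves, the columns through [delta], and every
    other kernel through [rhos] followed by [delta]. *)
Definition canonS (Q : frame) := let c := codes [seq (v.1.1, v.2) | v <- Q] in
  if axisS c Q then if axisS c (delta Q) then allb (fun R => axisS c (delta R)) (rhos [::] Q) else false else false.
End Data.
End Search.
Import Search.

(** * Larger frames as cliques of compatible kernels *)

Module Cliques.
Definition count_common (u w : seq nat) := count (fun x => mem_nat x w) u.
Fixpoint pairwise2 (l : seq (seq nat)) := if l is u :: l' then if allb (fun w => eqn (count_common u w) 2) l' then pairwise2 l' else false else true.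
Definition cellsM (M : mat) : seq (seq (nat * nat)) :=
  [seq flatten [seq [seq (i, p) | p <- iota 0 5 & eqn (at_ M (i, p)) s] | i <- rng] | s <- rng].
Fixpoint cliques A (r : A -> A -> bool) k (cand : seq A) : seq (seq A) := if k is k'.+1 then
  (fix go c := if c is v :: c' then let f := r v in [seq v :: Q | Q <- cliques r k' [seq w <- c' | f w]] ++ go c' else [::]) cand
  else [:: [::]].
Definition compatM (v : entry * mat) := let cv := cellsM v.2 in fun w : entry * mat => if allb (fun c => uniqn (map (at_ w.2) c)) cv then
  pairwise2 [seq [seq at_ w.2 m | m <- c] | c <- cv] else false.
(** The least vertex of a canonical frame is canonical by itself, so it is taken from [L1]; all
    other vertices have larger codes. *)
Definition candidates (L1 V : frame) : seq (entry * mat * frame) :=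
  [seq (v, let f := compatM v in [seq w <- V | if f w then negb (les (code (w.1.1, w.2)) (code (v.1.1, v.2))) else false]) | v <- L1].
Definition frames D tr k (cand : seq (entry * mat * frame)) : seq frame :=
  flatten [seq [seq x.1 :: Q | Q <- cliques compatM k x.2 & canonS D tr (x.1 :: Q)] | x <- cand].
End Cliques.
Import Cliques.

(** * The base biplane and the action of flag permutations on kernels *)

Module BaseBiplane.
Import GroupScope.

Notation I11 := ('I_11).
Notation flagT := ('I_11 * 'I_5)%type.
Notation kernel := {set flagT * flagT}.

Definition rowF (m : flagT) : I11 := m.1.
Definition colF (m : flagT) : I11 := inord (colp m.1 m.2).

Lemma all_rng (P : pred nat) : all P rng -> forall i, i < 11 -> P i.
Proof. by move/allP=> H i i11; apply: H; rewrite mem_iota. Qed.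

Lemma all_rng2 (P : nat -> nat -> bool) : all (fun i => all (P i) rng) rng ->
  forall i j, i < 11 -> j < 11 -> P i j.
Proof. by move=> H i j i11 j11; apply: (all_rng (all_rng H i11)). Qed.

Lemma size_rng : size rng = 11. Proof. by []. Qed.
Lemma nth_rng x0 i : i < 11 -> nth x0 rng i = i. Proof. exact: nth_iota. Qed.
Lemma mem_rng i : (i \in rng) = (i < 11). Proof. by rewrite mem_iota. Qed.

Lemma colp_lt (i : I11) (p : 'I_5) : colp i p < 11.
Proof.
have : all (fun i => all (fun p => colp i p < 11) (iota 0 5)) rng by vm_compute.
by move/all_rng=> /(_ i (ltn_ord i))/allP; apply; rewrite mem_iota ltn_ord.
Qed.

Lemma colF_val m : colF m = colp m.1 m.2 :> nat.
Proof. by rewrite inordK ?colp_lt. Qed.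

Lemma incn_flag m : incn (rowF m) (colF m).
Proof.
rewrite colF_val.
have : all (fun i => all (fun p => incn i (colp i p)) (iota 0 5)) rng by vm_compute.
by move/all_rng=> /(_ _ (ltn_ord m.1))/allP; apply; rewrite mem_iota ltn_ord.
Qed.

Lemma pos_in_lt i j : i < 11 -> j < 11 -> incn i j -> (pos_in j (brow i) < 5) && (colp i (pos_in j (brow i)) == j).
Proof.
move=> i11 j11; apply/implyP; move: i j i11 j11; apply: all_rng2; by vm_compute.
Qed.

Definition mkflag (i j : I11) : flagT := (i, inord (pos_in j (brow i))).

Lemma mkflagP (i j : I11) : incn i j -> rowF (mkflag i j) = i /\ colF (mkflag i j) = j.
Proof.
move=> h; have /andP[p5 /eqP e] := pos_in_lt (ltn_ord i) (ltn_ord j) h.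
by split=> //; apply: val_inj; rewrite [LHS]colF_val [_.2]/= inordK.
Qed.

Lemma flag_inj m m' : rowF m = rowF m' -> colF m = colF m' -> m = m'.
Proof.
case: m m' => [i p] [i' p']; rewrite /rowF /= => -> /(congr1 (@nat_of_ord 11)); rewrite !colF_val /=.
have : all (fun i => all (fun p => all (fun q => (colp i p == colp i q) ==> (p == q)) (iota 0 5)) (iota 0 5)) rng by vm_compute.
move/all_rng=> /(_ _ (ltn_ord i'))/allP/(_ p); rewrite mem_iota ltn_ord => /(_ isT)/allP/(_ p').
by rewrite mem_iota ltn_ord => /(_ isT)/implyP H /eqP/H/eqP/val_inj ->.
Qed.

Lemma hits_base (i j : I11) : hits rowF colF i j = incn i j.
Proof.
apply/hitsP/idP => [[m <- <-]|h]; first exact: incn_flag.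
by have [? ?] := mkflagP h; exists (mkflag i j).
Qed.

Lemma card_incn (p : nat -> bool) : #|[set c : I11 | p c]| = count p rng.
Proof.
rewrite cardE -(size_map val) -size_filter; apply: perm_size; apply: uniq_perm.
- by rewrite (map_inj_uniq val_inj) enum_uniq.
- by rewrite filter_uniq ?iota_uniq.
move=> c; rewrite mem_filter mem_rng; apply/mapP/andP => [[d]|[pc c11]].
  by rewrite mem_enum inE => pd ->; rewrite pd ltn_ord.
by exists (Ordinal c11); rewrite // mem_enum inE.
Qed.

Lemma base_biplane : biplane rowF colF.
Proof.
apply/andP; split.
  apply/forallP=> m; apply/forallP=> m'; apply/implyP=> /andP[/eqP er /eqP ec].
  by apply/eqP/flag_inj.
apply/forallP=> a; apply/forallP=> a'; apply/eqP.
have -> : #|[set c | hits rowF colF a c & hits rowF colF a' c]| = count (fun c => incn a c && incn a' c) rng.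
  by rewrite -(card_incn (fun c => incn a c && incn a' c)); apply: eq_card => c; rewrite !inE !hits_base.
have : all (fun a => all (fun b => count (fun c => incn a c && incn b c) rng == if a == b then 5 else 2) rng) rng.
  by vm_compute.
move/all_rng2/(_ a a' (ltn_ord _) (ltn_ord _))/eqP ->.
by rewrite -(inj_eq val_inj).
Qed.

Lemma card_flagT : #|{: flagT}| = 55. Proof. by rewrite card_prod !card_ord. Qed.

Notation kr := (kerf rowF).
Notation kc := (kerf colF).

Definition bpk (k k' : kernel) : Prop := exists u w, [/\ kerf u = k, kerf w = k' & biplane u w].

Lemma bpk_sym k k' : bpk k k' -> bpk k' k.
Proof. by case=> u [w [e e' b]]; exists w, u; split=> //; apply: biplane_sym. Qed.

Lemma biplane_comp (F F' : finType) (u w : F -> I11) (h : F' -> F) : bijective h -> biplane u w -> biplane (u \o h) (w \o h).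
Proof.
case=> h' hK h'K bp; apply/andP; split.
  apply/forallP=> m; apply/forallP=> m'; apply/implyP=> /andP[/eqP eu /eqP ew].
  by apply/eqP/(can_inj hK)/(biplane_inj bp).
have E a c : hits (u \o h) (w \o h) a c = hits u w a c.
  by apply/hitsP/hitsP=> -[m] /= um wm; [exists (h m) | exists (h' m); rewrite /= h'K].
apply/forallP=> a; apply/forallP=> a'; apply/eqP; rewrite -(biplane_card a a' bp).
by apply: eq_card => c; rewrite !inE !E.
Qed.

Lemma pullbackM (b b' : {perm flagT}) k : pullback (b * b') k = pullback b (pullback b' k).
Proof. by apply/setP=> z; rewrite !inE !permM. Qed.

Lemma pullback1 (k : kernel) : pullback 1 k = k.
Proof. by apply/setP=> -[x y]; rewrite !inE !perm1. Qed.

Lemma pullbackK (b : {perm flagT}) : cancel (pullback b) (pullback b^-1).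
Proof. by move=> k; rewrite -pullbackM mulVg pullback1. Qed.

Lemma pullbackVK (b : {perm flagT}) : cancel (pullback b^-1) (pullback b).
Proof. by move=> k; rewrite -pullbackM mulgV pullback1. Qed.

Lemma pullback_inj (b : {perm flagT}) : injective (pullback b).
Proof. exact: can_inj (pullbackK b). Qed.

Lemma bpk_pullback (b : {perm flagT}) k k' : bpk k k' -> bpk (pullback b k) (pullback b k').
Proof.
case=> u [w [<- <- bp]]; exists (u \o b), (w \o b); rewrite !pullback_ker; split=> //.
by apply: biplane_comp => //; exists b^-1; [apply: permK | apply: permKV].
Qed.

Lemma bpk_base : bpk kr kc. Proof. by exists rowF, colF; split=> //; apply: base_biplane. Qed.

Lemma bpk_neq k k' : bpk k k' -> k != k'.
Proof.
case=> u [w [<- <- bp]]; apply/eqP=> e.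
have := biplane_fiber ord0 bp; set A := [set m | _] => cA.
have /card_gt1P[m [m' [mA m'A nm]]] : 1 < #|A| by rewrite cA.
move: mA m'A; rewrite !inE => /eqP um /eqP um'.
have : (m, m') \in kerf u by rewrite inE /= um um'.
by rewrite e inE /= => /eqP ew; rewrite (biplane_inj bp (etrans um (esym um')) ew) eqxx in nm.
Qed.

(* Every symmetric (11,5,2) design is the base biplane up to relabelling. *)
Lemma bpk_base_change k k' : bpk k k' -> exists2 b : {perm flagT}, pullback b kr = k & pullback b kc = k'.
Proof.
case=> u [w [<- <- bp]].
have [|c c'|s [t st]] := @unique_biplane (fun a c => hits u w a c) _ _.
- by move=> a a'; rewrite (biplane_card a a' bp).
- rewrite -(biplane_card c c' (biplane_sym bp)).
  by apply: eq_card => a; rewrite !inE !(hitsC w u).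
have inc m : incn (s (u m)) (t (w m)) by rewrite -st; apply/hitsP; exists m.
pose b0 m := mkflag (s (u m)) (t (w m)).
have br m : rowF (b0 m) = s (u m) by case: (mkflagP (inc m)).
have bc m : colF (b0 m) = t (w m) by case: (mkflagP (inc m)).
have bI : injective b0.
  move=> m m' e; apply: (biplane_inj bp); first by apply: (@perm_inj _ s); rewrite -!br e.
  by apply: (@perm_inj _ t); rewrite -!bc e.
exists (perm bI); apply/setP=> z; rewrite !inE !permE.
  by rewrite !br (inj_eq perm_inj).
by rewrite !bc (inj_eq perm_inj).
Qed.

Definition stab (l : seq kernel) : {set {perm flagT}} := [set b | all (fun k => pullback b k == k) l].

Lemma stabP l b : reflect {in l, forall k, pullback b k = k} (b \in stab l).
Proof. by rewrite inE; apply: (iffP allP) => H k kl; [apply/eqP/H | apply/eqP/H]. Qed.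

Lemma group_set_stab l : group_set (stab l).
Proof.
apply/group_setP; split=> [|x y /stabP xs /stabP ys]; first by apply/stabP=> k _; rewrite pullback1.
by apply/stabP=> k kl; rewrite pullbackM ys ?xs.
Qed.
Canonical stab_group l := Group (group_set_stab l).

Lemma stab_map b l : stab (map (pullback b) l) = stab l :^ b^-1.
Proof.
apply/setP=> x; rewrite mem_conjg invgK; apply/stabP/stabP=> H k kl.
  apply: (@pullback_inj b); rewrite -pullbackM.
  by have := H _ (map_f (pullback b) kl); rewrite -!pullbackM conjgE !mulgA mulgV mul1g.
case/mapP: kl => k' k'l ->; have := H _ k'l; rewrite conjgE => {2}<-.
by rewrite -!pullbackM !mulgA mulgV mul1g.
Qed.

Lemma stab_perm l l' : l =i l' -> stab l = stab l'.
Proof. by move=> e; apply/setP=> x; apply/stabP/stabP=> H k kl; apply: H; rewrite ?e // -e. Qed.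

Notation autB := (stab [:: kr; kc]).
Notation autBG := (stab_group [:: kr; kc]).
End BaseBiplane.
Import BaseBiplane.

(** * List encodings of permutations, labellings and flag maps *)

Module Encodings.
Import GroupScope.

Definition mkp (s : I11 -> I11) : seq nat := [seq val (s (inord i)) | i <- rng].
Definition mkM (u : flagT -> I11) : mat := [seq [seq val (u (inord i, inord p)) | p <- iota 0 5] | i <- rng].
Definition mkT (t : flagT -> flagT) : table :=
  [seq [seq (val (t (inord i, inord p)).1, val (t (inord i, inord p)).2) | p <- iota 0 5] | i <- rng].
Definition mkV (f : I11 -> I11 -> bool) : mat := [seq [seq nat_of_bool (f (inord i) (inord s)) | s <- rng] | i <- rng].

Arguments mkp : simpl never.
Arguments mkM : simpl never.
Arguments mkT : simpl never.
Arguments mkV : simpl never.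
Arguments invp : simpl never.
Arguments mulp : simpl never.
Arguments autcol : simpl never.
Arguments isaut : simpl never.
Arguments atab : simpl never.
Arguments sysV : simpl never.
Arguments pull : simpl never.
Arguments relab : simpl never.
Arguments rtab : simpl never.
Arguments ap : simpl never.
Arguments K : simpl never.

Lemma nth_map_rng T (x0 : T) (f : nat -> T) i : i < 11 -> nth x0 [seq f i | i <- rng] i = f i.
Proof. by move=> i11; rewrite (nth_map 0) ?size_rng // nth_rng. Qed.

Lemma nth_map5 T (x0 : T) (f : nat -> T) i : i < 5 -> nth x0 [seq f i | i <- iota 0 5] i = f i.
Proof. by move=> i5; rewrite (nth_map 0) ?size_iota // nth_iota. Qed.

Lemma eq_map_rng T (f g : nat -> T) : (forall i : I11, f i = g i) -> map f rng = map g rng.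
Proof. by move=> e; apply/eq_in_map => i; rewrite mem_rng => i11; exact: (e (Ordinal i11)). Qed.

Lemma eq_map5 T (f g : nat -> T) : (forall i : 'I_5, f i = g i) -> map f (iota 0 5) = map g (iota 0 5).
Proof. by move=> e; apply/eq_in_map => i; rewrite mem_iota => i5; exact: (e (Ordinal i5)). Qed.

Lemma eq_map2 T (f g : nat -> nat -> T) : (forall (i : I11) (p : 'I_5), f i p = g i p) ->
  [seq [seq f i p | p <- iota 0 5] | i <- rng] = [seq [seq g i p | p <- iota 0 5] | i <- rng].
Proof. by move=> e; apply: eq_map_rng => i; apply: eq_map5 => p. Qed.

Lemma all_rngE (P : pred nat) : reflect (forall i : I11, P i) (all P rng).
Proof.
apply: (iffP idP) => [H i|H]; first exact: (all_rng H).
by apply/allP=> i; rewrite mem_rng => i11; exact: (H (Ordinal i11)).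
Qed.

Lemma ap_mkp s (i : I11) : ap (mkp s) i = s i.
Proof. by rewrite /ap nth_map_rng // inord_val. Qed.

Lemma eq_mkp s t : s =1 t -> mkp s = mkp t.
Proof. by move=> e; apply: eq_map => i; rewrite e. Qed.

Lemma mkp_inj s t : mkp s = mkp t -> s =1 t.
Proof. by move=> e i; apply: val_inj; rewrite /= -!ap_mkp e. Qed.

Lemma mkp_id : mkp id = rng.
Proof. by rewrite -[RHS]map_id; apply: eq_map_rng => i; rewrite inord_val. Qed.

Lemma mkp_perm a : perm_eq a rng -> exists s : 'S_11, a = mkp s.
Proof.
move=> pa; have sa : size a = 11 by rewrite (perm_size pa).
have lt i : i < 11 -> nth 0 a i < 11 by move=> i11; rewrite -mem_rng -(perm_mem pa) mem_nth ?sa.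
have inj : injective (fun i : I11 => inord (nth 0 a i) : I11).
  move=> i j /(congr1 val); rewrite /= !inordK ?lt // => /eqP.
  by rewrite nth_uniq ?sa // ?(perm_uniq pa) ?iota_uniq // => /eqP/val_inj.
exists (perm inj); apply: (@eq_from_nth _ 0) => [|i]; rewrite ?size_map // sa => i11.
rewrite /mkp nth_map_rng // permE (inordK i11) [RHS]/= inordK //; exact: lt.
Qed.

Lemma at_mkM u m : at_ (mkM u) (nat_of_ord m.1, nat_of_ord m.2) = u m.
Proof. by rewrite /at_ /= nth_map_rng // nth_map5 // !inord_val -surjective_pairing. Qed.

Lemma eq_mkM u v : u =1 v -> mkM u = mkM v.
Proof. by move=> e; apply: eq_map => i; apply: eq_map => p; rewrite e. Qed.

Lemma mkM_inj u v : mkM u = mkM v -> u =1 v.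
Proof. by move=> e m; apply: val_inj; rewrite /= -(at_mkM u) e at_mkM. Qed.

Lemma eq_mkT t t' : t =1 t' -> mkT t = mkT t'.
Proof. by move=> e; apply: eq_map => i; apply: eq_map => p; rewrite e. Qed.

Lemma eq_mkV f g : f =2 g -> mkV f = mkV g.
Proof. by move=> e; apply: eq_map => i; apply: eq_map => p; rewrite e. Qed.

Lemma pull_mk t u : pull (mkT t) (mkM u) = mkM (u \o t).
Proof.
apply: etrans (esym (map_comp _ _ _)) _; apply: eq_map => i; apply: etrans (esym (map_comp _ _ _)) _.
by apply: eq_map => p; rewrite /= at_mkM.
Qed.

Lemma relab_mk k u : relab (mkp k) (mkM u) = mkM (k \o u).
Proof.
apply: etrans (esym (map_comp _ _ _)) _; apply: eq_map => i; apply: etrans (esym (map_comp _ _ _)) _.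
by apply: eq_map => p; rewrite /= ap_mkp.
Qed.

Lemma mulp_mk s t : mulp (mkp s) (mkp t) = mkp (t \o s).
Proof. by apply: etrans (esym (map_comp _ _ _)) _; apply: eq_map => i; rewrite /= ap_mkp. Qed.

Lemma mulp_mkM (s t : 'S_11) : mulp (mkp s) (mkp t) = mkp (s * t).
Proof. by rewrite mulp_mk; apply: eq_mkp => i; rewrite /= permM. Qed.

Lemma pos_inE x s : pos_in x s = index x s.
Proof. by elim: s => //= y s ->; rewrite eqnE eq_sym; case: eqP. Qed.

Lemma invp_mk (s : 'S_11) : invp (mkp s) = mkp s^-1.
Proof.
apply: eq_map_rng => i; rewrite inord_val pos_inE.
have us : uniq (mkp s).
  rewrite map_inj_in_uniq ?iota_uniq // => j k; rewrite !mem_rng => j11 k11 /val_inj/perm_inj.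
  by move/(congr1 val); rewrite /= !inordK.
have <- : nth 0 (mkp s) (s^-1 i) = i by rewrite -/(ap _ _) ap_mkp permKV.
by rewrite index_uniq // size_map.
Qed.

Lemma size_brow (i : I11) : size (brow i) = 5.
Proof. by apply/eqP; apply: (@all_rng (fun i => size (brow i) == 5)) (ltn_ord i); vm_compute. Qed.

Lemma mem_brow (i j : I11) : (nat_of_ord j \in brow i) = incn i j.
Proof. by rewrite /brow nth_map_rng // mem_filter mem_rng ltn_ord andbT. Qed.

Lemma mem_bcol (i j : I11) : (nat_of_ord i \in bcol j) = incn i j.
Proof. by rewrite /bcol nth_map_rng // mem_filter mem_rng ltn_ord andbT. Qed.

Lemma bcol_lt j i : i \in bcol j -> i < 11.
Proof.
case: (ltnP j 11) => [j11|j11]; last by rewrite /bcol nth_default.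
by rewrite /bcol nth_map_rng // mem_filter mem_rng => /andP[].
Qed.

Lemma brow_lt j i : i \in brow j -> i < 11.
Proof.
case: (ltnP j 11) => [j11|j11]; last by rewrite /brow nth_default.
by rewrite /brow nth_map_rng // mem_filter mem_rng => /andP[].
Qed.

Lemma all_bcol (P : pred nat) (j : I11) : reflect (forall i : I11, incn i j -> P i) (all P (bcol j)).
Proof.
apply: (iffP allP) => [H i ij|H i ij]; first by apply: H; rewrite mem_bcol.
by apply: (H (Ordinal (bcol_lt ij))); rewrite -mem_bcol.
Qed.

Lemma all_brow (P : pred nat) (i : I11) : reflect (forall j : I11, incn i j -> P j) (all P (brow i)).
Proof.
apply: (iffP allP) => [H j ij|H j ij]; first by apply: H; rewrite mem_brow.
by apply: (H (Ordinal (brow_lt ij))); rewrite -mem_brow.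
Qed.

Lemma Brow_mk : Brow = mkM colF.
Proof.
apply: (@eq_from_nth _ [::]) => // i; rewrite size_map size_rng => i11.
have -> : nth [::] Brow i = brow (Ordinal i11) by [].
rewrite /mkM nth_map_rng //; apply: (@eq_from_nth _ 0) => [|p]; rewrite size_brow // => p5.
by rewrite nth_map5 // [val _]colF_val /= !inordK.
Qed.

Lemma mktab_mk (f : nat -> nat -> nat * nat) (t : flagT -> flagT) :
  (forall m : flagT, f m.1 m.2 = (nat_of_ord (t m).1, nat_of_ord (t m).2)) -> mktab f = mkT t.
Proof. by move=> H; apply: eq_map2 => i p; rewrite !inord_val -(H (i, p)). Qed.

Lemma flag_mk (i j : I11) : incn i j -> flag i j = (nat_of_ord (mkflag i j).1, nat_of_ord (mkflag i j).2).
Proof. by move=> h; have /andP[p5 _] := pos_in_lt (ltn_ord i) (ltn_ord j) h; rewrite /flag /= inordK. Qed.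

(* Permutations of the rows and the columns that preserve the incidence. *)
Definition aut_by (s t : 'S_11) := forall i j : I11, incn (s i) (t j) = incn i j.
Definition acts_by (b : flagT -> flagT) (s t : I11 -> I11) := forall m, rowF (b m) = s (rowF m) /\ colF (b m) = t (colF m).

Lemma acts_by_inj b b' s t : acts_by b s t -> acts_by b' s t -> b =1 b'.
Proof. by move=> H H' m; have [? ?] := H m; have [? ?] := H' m; apply: flag_inj; congruence. Qed.

Lemma rowF_surj i : exists m, rowF m = i. Proof. exact: biplane_surj base_biplane. Qed.
Lemma colF_surj i : exists m, colF m = i. Proof. exact: biplane_surjr base_biplane. Qed.

Lemma in_autB b : reflect (pullback b kr = kr /\ pullback b kc = kc) (b \in autB).
Proof. by rewrite inE /= andbT; apply: (iffP andP) => -[/eqP ? /eqP ?]. Qed.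

Lemma autB_acts b : b \in autB -> exists s t, aut_by s t /\ acts_by b s t.
Proof.
case/in_autB=> er ec; rewrite pullback_ker in er; rewrite pullback_ker in ec.
have [s hs] := ker_eq_perm rowF_surj (esym er); have [t ht] := ker_eq_perm colF_surj (esym ec).
exists s, t; split=> [i j|m]; last by rewrite -hs -ht.
rewrite -!hits_base; apply/hitsP/hitsP=> [[m em em']|[m <- <-]]; last by exists (b m); [apply: hs|apply: ht].
exists (b^-1 m); [apply: (@perm_inj _ s)|apply: (@perm_inj _ t)].
  by rewrite -hs /= permKV.
by rewrite -ht /= permKV.
Qed.

Lemma aut_by_perm s t : aut_by s t -> exists2 b : {perm flagT}, b \in autB & acts_by b s t.
Proof.
move=> H; pose b m := mkflag (s (rowF m)) (t (colF m)).
have B : acts_by b s t by move=> m; apply: mkflagP; rewrite H incn_flag.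
have inj : injective b.
  move=> m m' e; have [r c] := B m; have [r' c'] := B m'; rewrite e in r c.
  by apply: flag_inj; [apply: (@perm_inj _ s)|apply: (@perm_inj _ t)]; congruence.
exists (perm inj); last by move=> m; rewrite permE.
apply/in_autB; split; apply/setP=> z; rewrite !inE !permE.
  by have [-> _] := B z.1; have [-> _] := B z.2; rewrite (inj_eq perm_inj).
by have [_ ->] := B z.1; have [_ ->] := B z.2; rewrite (inj_eq perm_inj).
Qed.

Lemma bcol_inj (j k : I11) : (forall i : I11, incn i j -> incn i k) -> j = k.
Proof.
move=> H; apply: val_inj; apply/eqP.
have /all_rng2/(_ j k (ltn_ord _) (ltn_ord _))/implyP : all (fun j => all (fun k => all (fun i => incn i k) (bcol j) ==> (j == k)) rng) rng by vm_compute.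
by apply; apply/all_bcol.
Qed.

Lemma brow_inj (j k : I11) : (forall i : I11, incn j i -> incn k i) -> j = k.
Proof.
move=> H; apply: val_inj; apply/eqP.
have /all_rng2/(_ j k (ltn_ord _) (ltn_ord _))/implyP : all (fun j => all (fun k => all (fun i => incn k i) (brow j) ==> (j == k)) rng) rng by vm_compute.
by apply; apply/all_brow.
Qed.

Lemma findd_eq (f : nat -> bool) (j : I11) : f (nat_of_ord j) -> (forall k : I11, f k -> k = j) -> findd f rng = j.
Proof.
move=> fj u; have : forall s, (nat_of_ord j \in s) -> all (fun k => k < 11) s -> findd f s = j.
  elim=> //= k s IH; rewrite inE => /orP[/eqP <-|js] /andP[k11 s11]; first by rewrite fj.
  by case: ifP => [fk|_]; [rewrite -(u (Ordinal k11))|exact: IH].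
by apply; [rewrite mem_rng|].
Qed.

Lemma findd_lt f : findd f rng < 11.
Proof.
have : all (fun k => k < 11) rng by [].
by elim: rng => //= k s IH /andP[k11 s11]; case: ifP => // _; apply: IH.
Qed.

Lemma autcol_mk s t : aut_by s t -> autcol (mkp s) = mkp t.
Proof.
move=> H; apply: eq_map_rng => j; rewrite inord_val; apply: findd_eq => [|k].
  by rewrite allbE; apply/all_bcol=> i ij; rewrite mem_natE ap_mkp mem_bcol H.
rewrite allbE => /all_bcol h; apply: bcol_inj.
suff : forall i : I11, incn i (t j) -> incn i k by move/bcol_inj=> <-.
by move=> i; rewrite -{1}[i](permKV s) H => /h; rewrite mem_natE ap_mkp mem_bcol permKV.
Qed.

Lemma isautE a : isaut a = allb (fun j => allb (fun i => mem_nat (ap a i) (bcol (ap (autcol a) j))) (bcol j)) rng.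
Proof. by []. Qed.

(** [isaut] tests only that the image of a block is contained in a block. All blocks have five
    elements, so they are equal, and the induced map of columns is injective. *)
Lemma isautP s : reflect (exists t, aut_by s t) (isaut (mkp s)).
Proof.
apply: (iffP idP) => [|[t H]]; last first.
  rewrite isautE (autcol_mk H) allbE; apply/all_rngE => j; rewrite allbE.
  by apply/all_bcol => i ij; rewrite !ap_mkp mem_natE mem_bcol H.
rewrite isautE allbE => /all_rngE H.
have lt j : j < 11 -> ap (autcol (mkp s)) j < 11.
  by move=> j11; rewrite /ap nth_map_rng //; apply: findd_lt.
pose c (j : I11) : I11 := inord (ap (autcol (mkp s)) j).
have sub (i j : I11) : incn i j -> incn (s i) (c j).
  move=> ij; have := H j; rewrite allbE => /all_bcol/(_ i ij).
  by rewrite mem_natE ap_mkp -[ap (autcol _) j](inordK (lt j (ltn_ord j))) mem_bcol.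
have card (j : I11) : #|[set i : I11 | incn i j]| = 5.
  rewrite (card_incn (fun i => incn i j)); apply/eqP.
  by apply: (@all_rng (fun j => count (fun i => incn i j) rng == 5) _ j (ltn_ord j)); vm_compute.
have full (i j : I11) : incn (s i) (c j) = incn i j.
  have /eqP/setP/(_ (s i)) : s @: [set i : I11 | incn i j] == [set i : I11 | incn i (c j)].
    rewrite eqEcard card_imset ?card ?leqnn ?andbT; last exact: perm_inj.
    by apply/subsetP=> x /imsetP[k]; rewrite inE => kj ->; rewrite inE; apply: sub.
  by rewrite mem_imset ?inE //; exact: perm_inj.
have inj : injective c by move=> j k e; apply: bcol_inj => i; rewrite -(full i j) e full.
by exists (perm inj) => i j; rewrite permE full.
Qed.
End Encodings.
Import Encodings.

(** * The list of all automorphisms of the base biplane *)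

Module Automorphisms.
Import GroupScope.

Lemma has3_map T (f g h : T -> bool) (s : seq T) :
  has3 [seq nat_of_bool (f x) | x <- s] [seq nat_of_bool (g x) | x <- s] [seq nat_of_bool (h x) | x <- s] =
  has (fun x => [&& f x, g x & h x]) s.
Proof. by elim: s => //= x s ->; case: (f x); case: (g x); case: (h x). Qed.

Lemma hasrngP (P : pred nat) : reflect (exists i : I11, P i) (has P rng).
Proof.
apply: (iffP hasP) => [[i]|[i Pi]]; last by exists (nat_of_ord i); rewrite ?mem_rng.
by rewrite mem_rng => i11 Pi; exists (Ordinal i11).
Qed.

Lemma h3_mkV (f : I11 -> I11 -> bool) (i j k : I11) : reflect (exists s, [/\ f i s, f j s & f k s]) (h3 (mkV f) i j k).
Proof.
rewrite /h3 !nth_map_rng // !inord_val has3_map.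
apply: (iffP (hasrngP _)) => -[s]; last by case=> f1 f2 f3; exists s; rewrite inord_val f1 f2.
by rewrite inord_val => /and3P[f1 f2 f3]; exists s.
Qed.

Lemma Bvec_mk : Bvec = mkV (fun i j => incn i j).
Proof. by apply: eq_map_rng => i; apply: eq_map_rng => j; rewrite !inord_val. Qed.

Lemma size_mkp s : size (mkp s) = 11. Proof. by rewrite size_map. Qed.

Lemma take_mkp s (k : I11) : take k.+1 (mkp s) = rcons (take k (mkp s)) (s k).
Proof. by rewrite (take_nth 0) ?size_mkp // -/(ap _ _) ap_mkp. Qed.

Lemma mem_take_mkp (s : I11 -> I11) (k : I11) (n : nat) : reflect (exists2 j : I11, j < k & n = s j) (n \in take k (mkp s)).
Proof.
apply: (iffP idP) => [/(nthP 0)[j]|[j jk ->]].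
  rewrite size_takel ?size_mkp ?(ltnW (ltn_ord k)) // => jk <-.
  have j11 := ltn_trans jk (ltn_ord k); exists (Ordinal j11) => //.
  by rewrite nth_take // -(ap_mkp s (Ordinal j11)).
by rewrite -ap_mkp /ap -(nth_take 0 jk); apply: mem_nth; rewrite size_takel // size_mkp ltnW.
Qed.

Lemma eqs_E s t : eqs s t = (s == t).
Proof. by elim: s t => [|x s IH] [|y t] //=; rewrite eqnE eqseq_cons IH; case: (x == y). Qed.

Lemma h3_aut s t (i j k : I11) : aut_by s t -> h3 Bvec (s i) (s j) (s k) = h3 Bvec i j k.
Proof.
move=> H; rewrite Bvec_mk; apply/h3_mkV/h3_mkV=> -[c [h1 h2 h3]]; last by exists (t c); rewrite !H.
by exists (t^-1 c); rewrite -(H i) -(H j) -(H k) permKV.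
Qed.

Lemma chkaut_mk (s t : 'S_11) (k : I11) : aut_by s t -> s ord0 = ord0 -> chkaut (rev (take k.+1 (mkp s))).
Proof.
move=> H s0; rewrite take_mkp rev_rcons /=; rewrite mem_natE mem_rev; case: ifP => [/mem_take_mkp[j jk]|_].
  by move/val_inj/perm_inj=> e; rewrite e ltnn in jk.
rewrite size_rev size_takel ?size_mkp ?(ltnW (ltn_ord k)) //.
apply: (all_backward_take (x0 := 0)) => [|j jk]; first by rewrite size_mkp ltnW.
have j11 := ltn_trans jk (ltn_ord k); rewrite -/(ap _ j) (ap_mkp s (Ordinal j11)).
by apply/eqP; have := h3_aut k (Ordinal j11) ord0 H; rewrite s0.
Qed.

Lemma mem_stab0 (s t : 'S_11) : aut_by s t -> s ord0 = ord0 -> mkp s \in stab0.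
Proof.
move=> H s0; rewrite mem_filter; apply/andP; split; first by apply/isautP; exists t.
have e : mkp s = nat_of_ord (s (inord 0)) :: behead (mkp s) by [].
have i0 : inord 0 = ord0 :> I11 by apply: val_inj; rewrite /= inordK.
rewrite i0 s0 in e; have {}e : mkp s = 0 :: behead (mkp s) := e.
have sz : size (behead (mkp s)) = 10 by rewrite size_behead size_mkp.
have := @backtrack_complete _ rng chkaut (behead (mkp s)) [:: 0]; rewrite sz (_ : rev _ ++ _ = mkp s) ?[RHS]e //; apply.
  apply/allP=> x /mem_behead /mapP[i _ ->]; rewrite mem_rng; exact: ltn_ord.
move=> k k10; have := @chkaut_mk _ _ (Ordinal (k10 : k.+1 < 11)) H s0; rewrite e [take _ _]/= rev_cons cats1; apply.
Qed.

Lemma mod11_lt n : mod11 n < 11.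
Proof.
have [m] := ubnP n; elim: m n => // m IH n; rewrite ltnS => nm.
do 11 (case: n nm => [|n] nm //); apply: (IH n).
by apply: leq_trans nm; do 10 apply: leqW.
Qed.

Definition shiftp c (i : I11) : I11 := inord (mod11 (i + c)).

Lemma shift_mk c : shift c = mkp (shiftp c).
Proof. by apply: eq_map_rng => i; rewrite inord_val /= inordK ?mod11_lt. Qed.

Lemma shiftp_aut c : c < 11 -> exists s : 'S_11, shiftp c =1 s /\ exists t, aut_by s t.
Proof.
move=> c11; have /mkp_perm[s e] : perm_eq (shift c) rng.
  by apply: (@all_rng (fun c => perm_eq (shift c) rng)) c11; vm_compute.
exists s; split; first by apply: mkp_inj; rewrite -shift_mk.
by apply/isautP; rewrite -e; apply: (@all_rng (fun c => isaut (shift c)) _ c c11); vm_compute.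
Qed.

Lemma aut_byM s t s' t' : aut_by s t -> aut_by s' t' -> aut_by (s * s') (t * t').
Proof. by move=> H H' i j; rewrite !permM H' H. Qed.

Lemma aut_byV s t : aut_by s t -> aut_by s^-1 t^-1.
Proof. by move=> H i j; rewrite -H !permKV. Qed.

Lemma aut_by1 : aut_by 1 1.
Proof. by move=> i j; rewrite !perm1. Qed.

Lemma mem_K s t : aut_by s t -> mkp s \in K.
Proof.
move=> H; have [s' [e [t' H']]] := shiftp_aut (ltn_ord (s ord0)).
have s'0 : s' ord0 = s ord0.
  rewrite -e; apply: val_inj; rewrite /= inordK ?mod11_lt // add0n.
  by apply/eqP; apply: (@all_rng (fun i => mod11 i == i) _ _ (ltn_ord (s ord0))); vm_compute.
apply/flattenP; exists [seq mulp (mkp (s * s'^-1)) (shift c) | c <- rng].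
  apply/mapP; exists (mkp (s * s'^-1)) => //.
  by apply: mem_stab0 (aut_byM H (aut_byV H')) _; rewrite permM -s'0 permK.
apply/mapP; exists (nat_of_ord (s ord0)); first by rewrite mem_rng.
by rewrite shift_mk (eq_mkp e) mulp_mkM mulgKV.
Qed.

Lemma perm_stab0 a : a \in stab0 -> exists s t : 'S_11, a = mkp s /\ aut_by s t.
Proof.
move=> aK; have /mkp_perm[s e] : perm_eq a rng.
  by move: a aK; apply/allP; vm_compute.
move: aK; rewrite e mem_filter => /andP[/isautP[t H] _]; by exists s, t.
Qed.

Lemma K_aut a : a \in K -> exists s t : 'S_11, a = mkp s /\ aut_by s t.
Proof.
case/flattenP=> l /mapP[b /perm_stab0[s [t [-> H]]] ->] /mapP[c]; rewrite mem_rng => c11 ->.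
have [s' [e [t' H']]] := shiftp_aut c11.
by exists (s * s'), (t * t'); rewrite shift_mk (eq_mkp e) mulp_mkM; split=> //; apply: aut_byM.
Qed.

(* The row permutation of an automorphism, as a list. *)
Definition rl (b : flagT -> flagT) : seq nat := mkp (fun i => rowF (b (i, ord0))).

Lemma rl_acts b s t : acts_by b s t -> rl b = mkp s.
Proof. by move=> H; apply: eq_mkp => i; case: (H (i, ord0)). Qed.

(** The row permutation of an automorphism determines its column permutation through [autcol], and
    the two together determine the image of every flag. *)
Lemma rl_inj : {in autB &, injective (fun b : {perm flagT} => rl b)}.
Proof.
move=> b b' /autB_acts[s [t [H B]]] /autB_acts[s' [t' [H' B']]]; rewrite (rl_acts B) (rl_acts B') => e.
have ec : mkp t = mkp t' by rewrite -(autcol_mk H) -(autcol_mk H') e.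
apply/permP => m; apply: (acts_by_inj B) => m'; have [-> ->] := B' m'.
by rewrite (mkp_inj e) (mkp_inj ec).
Qed.

Lemma rlM b b' : b \in autB -> b' \in autB -> rl (b * b') = mulp (rl b) (rl b').
Proof.
move=> /autB_acts[s [t [H B]]] /autB_acts[s' [t' [H' B']]]; rewrite (rl_acts B) (rl_acts B') mulp_mkM.
by apply: (@rl_acts _ _ (t * t')) => m; rewrite !permM; have [-> ->] := B' (b m); have [-> ->] := B m.
Qed.

Lemma rl1 : rl (1 : {perm flagT}) = rng.
Proof. by rewrite -mkp_id; apply: eq_mkp => i; rewrite perm1. Qed.

Lemma rl_K b : b \in autB -> rl b \in K.
Proof. by case/autB_acts=> s [t [H B]]; rewrite (rl_acts B) (mem_K H). Qed.

Lemma K_rl a : a \in K -> exists2 b, b \in autB & rl b = a.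
Proof.
by case/K_aut=> s [t [-> H]]; have [b bB B] := aut_by_perm H; exists b => //; apply: rl_acts B.
Qed.

Lemma card_rl (L : seq (seq nat)) : uniq L -> {subset L <= K} -> #|[set b in autB | rl b \in L]| = size L.
Proof.
move=> uL LK; rewrite cardE -(size_map (fun b : {perm flagT} => rl b)); apply/perm_size/uniq_perm => //.
  rewrite map_inj_in_uniq ?enum_uniq // => b b'; rewrite !mem_enum !inE => /andP[bB _] /andP[b'B _].
  by apply: rl_inj; rewrite inE.
move=> a; apply/mapP/idP => [[b]|aL]; first by rewrite mem_enum inE => /andP[_ bL] ->.
by have [b bB e] := K_rl (LK a aL); exists b; rewrite ?mem_enum ?inE ?e ?aL ?andbT //; rewrite inE in bB.
Qed.

(** 660 is the order of PSL(2,11). *)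
Lemma uniq_K : uniq K && (size K == 660).
Proof. by vm_compute. Qed.

Lemma card_autB : #|autB| = 660.
Proof.
have /andP[uK /eqP sK] := uniq_K; apply: etrans sK; rewrite -(card_rl uK (fun a aK => aK)).
apply: eq_card => b; rewrite [in RHS]inE; apply/idP/andP => [bB|[bB _]]; last exact: bB.
exact: conj bB (rl_K bB).
Qed.
End Automorphisms.
Import Automorphisms.

(** * Frames, their automorphism groups, and counting by transversals *)

Module Frames.
Import GroupScope.

Implicit Types (S Z : {set kernel}) (b : {perm flagT}).

Definition act (b : {perm flagT}) (S : {set kernel}) : {set kernel} := pullback b @: S.

Lemma mem_act b S k : (pullback b k \in act b S) = (k \in S).
Proof. by rewrite mem_imset //; apply: pullback_inj. Qed.

Lemma mem_actV b S k : (k \in act b S) = (pullback b^-1 k \in S).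
Proof. by rewrite -(mem_act b) pullbackVK. Qed.

Lemma actM b b' S : act (b * b') S = act b (act b' S).
Proof. by apply/setP=> k; rewrite !mem_actV invMg pullbackM. Qed.

Lemma act1 S : act 1 S = S.
Proof. by apply/setP=> k; rewrite mem_actV invg1 pullback1. Qed.

Lemma actK b S : act b^-1 (act b S) = S. Proof. by rewrite -actM mulVg act1. Qed.
Lemma actVK b S : act b (act b^-1 S) = S. Proof. by rewrite -actM mulgV act1. Qed.

Lemma card_act b S : #|act b S| = #|S|.
Proof. by rewrite card_imset //; apply: pullback_inj. Qed.

Definition framed (S : {set kernel}) := forall k k', k \in S -> k' \in S -> k != k' -> bpk k k'.

Lemma framed_act b S : framed S -> framed (act b S).
Proof.
move=> fS k k'; rewrite !mem_actV => kS k'S ne.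
rewrite -(pullbackVK b k) -(pullbackVK b k'); apply/bpk_pullback/fS => //.
by rewrite (inj_eq (@pullback_inj _)).
Qed.

Definition aut (S : {set kernel}) := stab_group (enum S).

Lemma autP S b : reflect (forall k, k \in S -> pullback b k = k) (b \in aut S).
Proof. by apply: (iffP (stabP _ _)) => H k kS; apply: H; rewrite ?mem_enum // -mem_enum. Qed.

Lemma aut_act b S : aut (act b S) = aut S :^ b^-1 :> {set _}.
Proof.
rewrite -stab_map; apply: stab_perm => k; rewrite mem_enum.
by apply/imsetP/mapP=> -[k' k'S ->]; exists k'; rewrite ?mem_enum // -mem_enum.
Qed.

Definition based S := (kr \in S) && (kc \in S).

Lemma aut_based S : based S -> aut S \subset autB.
Proof. by case/andP=> r c; apply/subsetP=> b /autP H; apply/in_autB; rewrite !H. Qed.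

Section Moves.
Variable P : {group {perm flagT}}.
Hypothesis conjP : forall Q : {group {perm flagT}}, Q \subset autB -> #|Q| = #|P| ->
  exists2 a, a \in autB & Q :^ a = P.

(** When [k] and [k'] have become rows and columns, [Q] lies in the group of the base biplane, and
    [conjP] moves it to [P] without disturbing the base. [conjP] holds for Sylow subgroups, and for
    involutions, which form a single conjugacy class. *)
Lemma base_move S (Q : {group {perm flagT}}) k k' : framed S -> k \in S -> k' \in S -> k != k' ->
    Q \subset aut S -> #|Q| = #|P| ->
  exists b, [/\ pullback b k = kr, pullback b k' = kc & Q :^ b^-1 = P].
Proof.
move=> fS kS k'S ne QS cQ; have [b0 br bc] := bpk_base_change (fS _ _ kS k'S ne).
have [||a aB eQ] := conjP (Q := (Q :^ b0)%G).
- apply/subsetP=> x; rewrite mem_conjg => /(subsetP QS)/autP H; apply/in_autB; set y := x ^ b0^-1 in H.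
  have -> : x = b0^-1 * y * b0 by rewrite /y conjgE invgK !mulgA mulVg mul1g mulgKV.
  clearbody y; by split; rewrite !pullbackM ?br ?bc H // -?br -?bc pullbackK.
- by rewrite cardJg.
have [ar ac] := in_autB _ aB; exists (b0 * a)^-1; split; last by rewrite invgK conjsgM.
  by rewrite invMg pullbackM -br pullbackK -{1}ar pullbackK.
by rewrite invMg pullbackM -bc pullbackK -{1}ac pullbackK.
Qed.

Definition sylow_in S := forall Q : {group {perm flagT}}, Q \subset aut S -> #|Q| = #|P| ->
  exists2 a, a \in aut S & Q :^ a = P.

(** A fusion argument: [P] and its conjugate by [b^-1] both lie in the group of the image, hence are
    conjugate there; correcting [b] by that automorphism of the image does not change the image. *)
Lemma norm_move S b : P \subset aut S -> P \subset aut (act b S) -> sylow_in (act b S) ->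
  exists2 b', b' \in 'N(P) & act b' S = act b S.
Proof.
move=> PS PS' syl; have [|| a aS e] := syl (P :^ b^-1)%G.
- by rewrite aut_act conjSg.
- by rewrite cardJg.
exists (a^-1 * b).
  by rewrite -groupV invMg invgK; apply/normP; rewrite conjsgM.
have aV : a^-1 \in aut (act b S) by rewrite groupV.
rewrite actM; apply/setP=> k; apply/idP/idP.
  by case/imsetP=> k' k'S ->; rewrite (autP _ _ aV).
by move=> kS; rewrite mem_actV invgK (autP _ _ aS).
Qed.

Lemma aut_act_norm b S : b \in 'N(P) -> P \subset aut S -> P \subset aut (act b S).
Proof. by move=> bN PS; rewrite aut_act -(normP (groupVr bN)) conjSg. Qed.

Section Images.
Variables (S : {set kernel}) (d : {perm flagT}).
Hypotheses (fS : framed S) (bS : based S) (PS : P \subset aut S).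
Hypotheses (dN : d \in 'N(P)) (dr : pullback d kr = kc) (dc : pullback d kc = kr).

Definition is_rho (k : kernel) (b : {perm flagT}) := [/\ b \in 'N(P), pullback b kr = kr & pullback b k = kc].
(* The images of [Z] with the same first base point. *)
Definition axis_images (Z Y : {set kernel}) := exists2 g, g \in autB :&: 'N(P) &
  Y = act g Z \/ exists k r, [/\ k \in Z, k != kr, k != kc, is_rho k r & Y = act g (act r Z)].

Lemma rho_exists Z k : framed Z -> based Z -> P \subset aut Z -> k \in Z -> k != kr -> exists r, is_rho k r.
Proof.
move=> fZ /andP[rZ cZ] PZ kZ kr'; have kr'' : kr != k by rewrite eq_sym.
have [b [h1 h2 h3]] := base_move fZ rZ kZ kr'' PZ erefl.
by exists b; split=> //; rewrite -groupV; apply/normP.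
Qed.

Lemma axis_imagesP Z b : framed Z -> based Z -> P \subset aut Z -> b \in 'N(P) -> based (act b Z) ->
  pullback b kr = kr -> axis_images Z (act b Z).
Proof.
move=> fZ bZ PZ bN /andP[]; rewrite !mem_actV => _ cZ br.
have [e|ne] := eqVneq (pullback b^-1 kc) kc.
  exists b; last by left.
  by apply/setIP; split=> //; apply/in_autB; rewrite -{1}e pullbackVK.
have bVr : pullback b^-1 kr = kr by rewrite -{1}br pullbackK.
have ner : pullback b^-1 kc != kr.
  by rewrite -[X in _ != X]bVr (inj_eq (@pullback_inj _)) eq_sym (bpk_neq bpk_base).
have [r [rN rr rk]] := rho_exists fZ bZ PZ cZ ner.
exists (b * r^-1); last first.
  by right; exists (pullback b^-1 kc), r; split=> //; rewrite -actM mulgKV.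
apply/setIP; split; last by rewrite groupM ?groupV.
apply/in_autB; rewrite !pullbackM; split.
  by rewrite -{1}rr pullbackK br.
by rewrite -{1}rk pullbackK pullbackVK.
Qed.

(** The cases distinguish which kernel of [S] becomes the rows: the rows; the columns, which [d]
    brings there; or another one, which first becomes the columns through [r] and then the rows
    through [d]. *)
Lemma based_images b : b \in 'N(P) -> based (act b S) ->
  [\/ axis_images S (act b S), axis_images (act d S) (act b S) |
   exists k r, [/\ k \in S, k != kr, k != kc, is_rho k r & axis_images (act d (act r S)) (act b S)]].
Proof.
move=> bN bbS; have /andP[] := bbS; rewrite !mem_actV => rS cS.
have [e|ner] := eqVneq (pullback b^-1 kr) kr.
  by apply: Or31; apply: axis_imagesP => //; rewrite -{1}e pullbackVK.
have /andP[r0 c0] := bS.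
have bd (Z : {set kernel}) : based Z -> based (act d Z).
  by case/andP=> rZ cZ; rewrite /based !mem_actV -{1}dc -{2}dr !pullbackK rZ cZ.
have main (Z : {set kernel}) c : framed Z -> based Z -> P \subset aut Z -> c \in 'N(P) ->
    act c Z = act b S -> pullback c kc = kr -> axis_images (act d Z) (act b S).
  move=> fZ bZ PZ cN e er; have e' : act b S = act (c * d^-1) (act d Z) by rewrite -actM mulgKV.
  rewrite e'; apply: axis_imagesP.
  - exact: framed_act.
  - exact: bd.
  - exact: aut_act_norm.
  - by rewrite groupM ?groupV.
  - by rewrite -e'.
  by rewrite pullbackM -{1}dc pullbackK.
have [e|nec] := eqVneq (pullback b^-1 kr) kc.
  by apply: Or32; apply: (main S b) => //; rewrite -{1}e pullbackVK.
have [r rho] := rho_exists fS bS PS rS ner; have [rN rr rk] := rho.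
apply: Or33; exists (pullback b^-1 kr), r; split=> //.
apply: (main _ (b * r^-1)).
- exact: framed_act.
- by rewrite /based !mem_actV -{1}rr pullbackK r0 -{1}rk pullbackK rS.
- exact: aut_act_norm.
- by rewrite groupM ?groupV.
- by rewrite -actM mulgKV.
by rewrite pullbackM -{1}rk pullbackK pullbackVK.
Qed.
End Images.
End Moves.

Section Cubes.
Variable n : nat.
Hypothesis n2 : 1 < n.
Implicit Types (f : 'I_n -> flagT -> I11).

Definition kset f : {set kernel} := [set kerf (f x) | x : 'I_n].

(** Being a biplane is a property of kernels, since labellings with equal kernels differ by
    bijections of the labels. *)
Lemma bpkE u w : bpk (kerf u) (kerf w) -> biplane u w.
Proof.
case=> u1 [w1 [eu ew bp]].
have [s hs] := ker_eq_perm (fun a => biplane_surj a bp) eu.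
have [t ht] := ker_eq_perm (fun a => biplane_surjr a bp) ew.
have h a c : hits u w (s a) (t c) = hits u1 w1 a c.
  apply/hitsP/hitsP=> -[m]; rewrite ?hs ?ht; first by move=> /perm_inj <- /perm_inj <-; exists m.
  by move=> <- <-; exists m; rewrite ?hs ?ht.
apply/andP; split.
  apply/forallP=> m; apply/forallP=> m'; apply/implyP; rewrite !hs !ht => /andP[/eqP/perm_inj e /eqP/perm_inj e'].
  by apply/eqP/(biplane_inj bp).
apply/forallP=> a; apply/forallP=> a'; apply/eqP.
rewrite -(permKV s a) -(permKV s a') (inj_eq perm_inj) -(biplane_card _ _ bp) -[RHS](card_imset _ (@perm_inj _ t)).
apply: eq_card => c; rewrite inE; apply/idP/imsetP => [|[c' c'H ->]]; last by move: c'H; rewrite inE !h.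
by rewrite -(permKV t c) !h => H; exists (t^-1 c); rewrite ?inE.
Qed.

Lemma biplane_bpk u w : biplane u w -> bpk (kerf u) (kerf w).
Proof. by move=> bp; exists u, w. Qed.

Lemma kerf_inj f : pairwise_biplane f -> injective (fun x => kerf (f x)).
Proof.
move=> bp x y e; apply: val_inj; case: (ltngtP x y) => // h; have := bpk_neq (biplane_bpk (bp _ _ h)).
  by rewrite e eqxx.
by rewrite -e eqxx.
Qed.

Lemma framed_kset f : pairwise_biplane f -> framed (kset f).
Proof.
move=> bp _ _ /imsetP[x _ ->] /imsetP[y _ ->]; case: (ltngtP x y) => [h|h|/val_inj ->] ne.
- exact: biplane_bpk (bp _ _ h).
- exact: bpk_sym (biplane_bpk (bp _ _ h)).
- by rewrite eqxx in ne.
Qed.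

Lemma card_kset f : pairwise_biplane f -> #|kset f| = n.
Proof. by move=> bp; rewrite card_imset ?card_ord //; apply: kerf_inj. Qed.

Lemma equivalent_kset f f' : pairwise_biplane f -> pairwise_biplane f' ->
  reflect (exists b, act b (kset f') = kset f) (equivalent (cube_of f) (cube_of f')).
Proof.
move=> bp bp'; apply: (iffP (equivalent_cube_of n2 bp bp')) => [[b [g H]]|[b e]]; exists b.
  apply/setP=> k; apply/imsetP/imsetP => [[_ /imsetP[x _ ->] ->]|[x _ ->]].
    by exists (g x); rewrite ?H.
  by exists (kerf (f' (g^-1 x))); rewrite ?imset_f // H permKV.
have ex x : exists y, pullback b (kerf (f' x)) == kerf (f y).
  have : pullback b (kerf (f' x)) \in kset f by rewrite -e imset_f // imset_f.
  by case/imsetP=> y _ ->; exists y.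
pose g x := xchoose (ex x); have gE x : pullback b (kerf (f' x)) = kerf (f (g x)) by apply/eqP/(xchooseP (ex x)).
have gI : injective g.
  by move=> x y eg; apply: (kerf_inj bp'); apply: (@pullback_inj b); rewrite !gE eg.
by exists (perm gI) => x; rewrite gE permE.
Qed.

Lemma nontrivial_kset f : pairwise_biplane f ->
  (cube_of f \in nontrivial_Pcubes n 11 5 2) = (aut (kset f) != 1 :> {set _}).
Proof.
move=> bp; rewrite inE cube_of_Pcubes //=; apply/(autotopy_cube_of n2 bp)/idP.
  case=> b nb H; apply/trivgPn; exists b => //.
  by apply/autP=> _ /imsetP[x _ ->]; apply: H.
case/trivgPn=> b /autP H nb; exists b => // x; apply: H; exact: imset_f.
Qed.

Lemma nontrivialP C : C \in nontrivial_Pcubes n 11 5 2 ->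
  exists f, [/\ pairwise_biplane f, C = cube_of f & aut (kset f) != 1 :> {set _}].
Proof.
move=> CD; have := CD; rewrite inE => /andP[/(Pcubes_cube_of n2 card_flagT)[f bp e] _].
by exists f; split=> //; rewrite -nontrivial_kset // -e.
Qed.

Lemma ksetP (S : {set kernel}) : framed S -> #|S| = n -> exists2 f, pairwise_biplane f & kset f = S.
Proof.
move=> fS cS.
have ex k : k \in S -> exists u : {ffun flagT -> I11}, kerf u == k.
  move=> kS; have [k' k'S ne] : exists2 k', k' \in S & k != k'.
    have : 0 < #|S :\ k| by move: n2; rewrite -cS (cardsD1 k) kS.
    by case/card_gt0P=> k'; rewrite !inE => /andP[ne k'S]; exists k'; rewrite // eq_sym.
  have [u [w [<- _ _]]] := fS _ _ kS k'S ne; exists [ffun x => u x].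
  by apply/ker_eqP=> m m'; rewrite !ffunE.
pose e (x : 'I_n) := enum_val (cast_ord (esym cS) x).
have eS x : e x \in S by apply: enum_valP.
pose f x : flagT -> I11 := xchoose (ex _ (eS x)).
have fE x : kerf (f x) = e x by apply/eqP/(xchooseP (ex _ (eS x))).
have eI : injective e by move=> x y /enum_val_inj/cast_ord_inj.
exists f; first by move=> x y xy; apply: bpkE; rewrite !fE; apply: fS; rewrite ?eS ?(inj_eq eI) // neq_ltn xy.
have -> : kset f = [set e x | x : 'I_n] by apply: eq_imset.
apply/eqP; rewrite eqEcard card_imset // card_ord cS leqnn andbT.
by apply/subsetP=> _ /imsetP[x _ ->].
Qed.

Lemma count_transversal (T : finType) (e : rel T) (D : {set T}) (L : seq T) :
    equivalence_rel e -> uniq L -> {subset L <= D} ->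
    (forall x, x \in D -> exists2 y, y \in L & e x y) ->
    {in L &, forall x y, e x y -> x = y} ->
  #|equivalence_partition e D| = size L.
Proof.
move=> eR uL LD cov inj; rewrite -(card_uniqP uL) -(card_in_imset (f := fun x => [set y in D | e x y])).
  apply: eq_card => B; apply/imsetP/imsetP => -[x xD ->]; last by exists x => //; apply: LD.
  have [y yL exy] := cov x xD; exists y => //.
  by apply/setP=> z; rewrite !inE (eR x y z).2.
move=> x y xL yL /setP/(_ y); rewrite !inE (LD y yL) (eR y y y).1 /=; exact: inj.
Qed.

(** By [equivalent_kset], classes of cubes are orbits of their sets of kernels, so it suffices to
    choose one cube for each frame in [L]. *)
Lemma count_frames (L : seq {set kernel}) : uniq L ->
    (forall S, S \in L -> [/\ framed S, #|S| = n & aut S != 1 :> {set _}]) ->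
    (forall S, framed S -> #|S| = n -> aut S != 1 :> {set _} -> exists b, act b S \in L) ->
    (forall S b, S \in L -> act b S \in L -> act b S = S) ->
  count_up_to_equivalence (nontrivial_Pcubes n 11 5 2) = size L.
Proof.
move=> uL LD cov inj.
have ex S : S \in L -> exists C : cube n 11, [exists f : {ffun 'I_n -> {ffun flagT -> I11}},
   [&& [forall x : 'I_n, forall y : 'I_n, (x < y) ==> biplane (f x) (f y)], kset (fun x => f x) == S & C == cube_of (fun x => f x)]].
  case/LD=> fS cS _; have [f bp e] := ksetP fS cS.
  pose f' := [ffun x => [ffun m => f x m]] : {ffun 'I_n -> {ffun flagT -> I11}}.
  have fE x : f' x =1 f x by move=> m; rewrite !ffunE.
  have kE x : kerf (f' x) = kerf (f x) by apply/eqP/ker_eqP=> m m'; rewrite !fE.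
  exists (cube_of (fun x => f' x)); apply/existsP; exists f'; rewrite eqxx andbT; apply/andP; split.
    by apply/forallP=> x; apply/forallP=> y; apply/implyP=> xy; apply: bpkE; rewrite !kE; apply/biplane_bpk/bp.
  by rewrite -e; apply/eqP/eq_imset.
(* The zero cube is a dummy value outside [L], which makes [C] a total function. *)
pose C S := if S \in L =P true is ReflectT H then xchoose (ex S H) else [ffun=> false].
have CP S : S \in L -> exists f, [/\ pairwise_biplane f, kset f = S & C S = cube_of f].
  move=> SL; rewrite /C; case: eqP => // H; have /existsP[f /and3P[/forallP h1 /eqP h2 /eqP h3]] := xchooseP (ex S H).
  by exists (fun x m => f x m); split=> // x y xy; have /forallP/(_ y)/implyP := h1 x; apply.
rewrite /count_up_to_equivalence (@count_transversal _ _ _ (map C L)) ?size_map //.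
- exact: equivalent_equivalence.
- rewrite map_inj_in_uniq // => S S' SL S'L e; have [f [bp eS eC]] := CP S SL; have [f' [bp' eS' eC']] := CP S' S'L.
  have : equivalent (cube_of f) (cube_of f').
    by rewrite -eC -eC' e; have [H _] := equivalent_equivalence (C S') (C S') (C S').
  by case/(equivalent_kset bp bp')=> b eb; rewrite -eS -eS' -eb; apply: inj; rewrite ?eb ?eS ?eS'.
- move=> _ /mapP[S SL ->]; have [f [bp eS ->]] := CP S SL.
  by rewrite nontrivial_kset // eS; case: (LD S SL).
- move=> c /nontrivialP[f [bp -> nt]]; have [b bL] := cov _ (framed_kset bp) (card_kset bp) nt.
  exists (C (act b (kset f))); first exact: map_f.
  have [f' [bp' eS ->]] := CP _ bL; apply/(equivalent_kset bp bp'); exists b^-1.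
  by rewrite eS actK.
move=> _ _ /mapP[S SL ->] /mapP[S' S'L ->]; have [f [bp eS eC]] := CP S SL; have [f' [bp' eS' eC']] := CP S' S'L.
rewrite eC eC' => /(equivalent_kset bp bp')[b eb]; rewrite -eC -eC'; suff -> : S = S' by [].
by rewrite -eS -eS' -eb; apply: inj; rewrite ?eb ?eS ?eS'.
Qed.
End Cubes.
End Frames.
Import Frames.

(** * Normal forms of single kernels *)

Module NormalForms.
Import GroupScope.

Lemma tfind_tmap A B (f : A -> B) k t : tfind k (tmap f t) = omap f (tfind k t).
Proof. by elim: t k => [[x|]|u IHu v IHv] [|[] k] //=. Qed.

Lemma leaves_tmap A B (f : A -> B) t : leaves (tmap f t) = map f (leaves t).
Proof. by elim: t => [[x|]|u IHu v IHv] //=; rewrite IHu IHv map_cat. Qed.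

(* [s^-1] carries the rows of the label system of [u] to the blocks of the base biplane. *)
Definition rsys (s : 'S_11) (u : flagT -> I11) := forall i j, hits rowF u i j = incn (s^-1 i) j.

Lemma rsys_surj s u : rsys s u -> forall j, exists m, u m = j.
Proof.
move=> H j; have [m <-] := colF_surj j.
by have /hitsP[m' _ <-] : hits rowF u (s (rowF m)) (colF m); [rewrite H permK incn_flag|exists m'].
Qed.

Lemma rsys_comp s u (b : {perm flagT}) (r : 'S_11) : rsys s u -> (forall m, rowF (b m) = r (rowF m)) ->
  rsys (s * r^-1) (u \o b).
Proof.
move=> H hb i j; rewrite invMg invgK permM -H; apply/hitsP/hitsP=> -[m].
  by move=> <- <-; exists (b m).
by move=> e <-; exists (b^-1 m); rewrite /= ?permKV //; apply: (@perm_inj _ r); rewrite -hb permKV.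
Qed.

Lemma rsys_relab s u (s' l : 'S_11) : rsys s u -> (forall i j, incn (s'^-1 i) (l j) = incn (s^-1 i) j) -> rsys s' (l \o u).
Proof.
move=> H hl i j; rewrite -[j](permKV l) hl -H; apply/hitsP/hitsP=> -[m <-]; last by move=> <-; exists m.
by move=> /perm_inj <-; exists m.
Qed.

(** The five flags of a row carry all five labels of a block, so no label repeats within a row; the
    intersections are those of the base blocks. *)
Lemma rsys_biplane s u : rsys s u -> biplane rowF u.
Proof.
move=> H; have inj m m' : rowF m = rowF m' -> u m = u m' -> m = m'.
  have c : #|u @: [set x | rowF x == rowF m]| == #|[set x | rowF x == rowF m]|.
    rewrite (biplane_fiber _ base_biplane); apply/eqP.
    rewrite -[RHS](biplane_fiber (s^-1 (rowF m)) base_biplane).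
    have colI : {in [set x | rowF x == s^-1 (rowF m)] &, injective colF}.
      by move=> x y; rewrite !inE => /eqP ex /eqP ey; apply: flag_inj; rewrite ex ey.
    rewrite -(card_in_imset colI); apply: eq_card => j; apply/imsetP/imsetP=> -[x]; rewrite inE => /eqP ex ->.
      have : incn (s^-1 (rowF m)) (u x) by rewrite -H; apply/hitsP; exists x.
      by rewrite -hits_base => /hitsP[y ey <-]; exists y; rewrite // inE ey.
    have : hits rowF u (rowF m) (colF x) by rewrite H -ex incn_flag.
    by case/hitsP=> y ey <-; exists y; rewrite // inE ey.
  by move=> er eu; move/imset_injP: c => /(_ m m'); rewrite !inE er eqxx; apply.
apply/andP; split.
  by apply/forallP=> m; apply/forallP=> m'; apply/implyP=> /andP[/eqP er /eqP eu]; apply/eqP/inj.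
apply/forallP=> a; apply/forallP=> a'; apply/eqP.
rewrite -(inj_eq (@perm_inj _ s^-1) a a') -(biplane_card _ _ base_biplane).
by apply: eq_card => j; rewrite !inE !H !hits_base.
Qed.

Lemma sysV_mk (s : 'S_11) : sysV (mkp s) = mkV (fun i j => incn (s^-1 i) j).
Proof.
rewrite /sysV invp_mk Bvec_mk; apply: eq_map_rng => i; rewrite ap_mkp /mkV nth_map_rng // !inord_val.
by [].
Qed.

Arguments key : simpl never.

Lemma mem_mkM u (i j : I11) : (nat_of_ord j \in nth [::] (mkM u) i) = hits rowF u i j.
Proof.
rewrite /mkM nth_map_rng // inord_val; apply/mapP/hitsP=> [[p]|[m <- em]].
  by rewrite mem_iota => p5 ej; exists (i, inord p) => //; apply: val_inj; rewrite -ej.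
by exists (nat_of_ord m.2); rewrite ?mem_iota ?ltn_ord // inord_val -em /rowF -surjective_pairing.
Qed.

Section Type_.
Variable D : gdata.
Implicit Types (s t r : 'S_11) (b : {perm flagT}).
Let t0 := trie0 D.
Let tr := mktrie D.
Definition find0 V := tfind (key D V) t0.
Definition reps := leaves t0.

(** This and the next conditions are the finite facts about one group that the proofs need; they are
    verified by evaluation for each group in use. *)
Definition ok_keys := all (fun t : nat * nat * nat => [&& t.1.1 < 11, t.1.2 < 11 & t.2 < 11]) (keys D).
Definition ok_elts := [&& uniq (elts D), rng \in elts D, all (fun p => mem_seq K p) (elts D),
  all (fun p => all (fun q => mulp p q \in elts D) (elts D)) (elts D) & all (fun p => p \in elts D) (gens D)].
(** Words in the generators of length less than the order of the group reach all of its elements. *)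
Definition products := iter (size (elts D)).-1 (fun l => l ++ [seq mulp a g | a <- l, g <- gens D]) [:: rng].
Definition ok_gens := all (fun p => p \in products) (elts D).
Definition normal (n : seq nat) := all (fun p => has (fun q => mulp p n == mulp n q) (elts D)) (elts D).
Definition ok_nreps := all (fun g => [&& isaut g, perm_eq g rng, normal g & normal (invp g)]) (nreps D) &&
  all (fun a => isaut a ==> has (fun g => has (fun p => a == mulp p g) (elts D)) (nreps D)) (nsl D).
Definition ok_find := all (fun m => if find0 (sysV m) is Some n then (n \in reps) && isaut (mulp m (invp n)) else false) (nsl D).
Definition ok_reps := uniq reps && all (fun n => [&& perm_eq n rng, normal n, normal (invp n) & find0 (sysV n) == Some n]) reps.
Definition ok_delta := [&& perm_eq (drow D) rng, perm_eq (dcol D) rng,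
  all (fun i => all (fun j => incn (ap (invp (dcol D)) j) (ap (invp (drow D)) i) == incn i j) rng) rng &
  all (fun p => mulp (mulp (invp (drow D)) (autcol p)) (drow D) \in elts D) (elts D)].

Hypotheses (okk : ok_keys) (oke : ok_elts) (okg : ok_gens) (okn : ok_nreps) (okf : ok_find) (okr : ok_reps) (okd : ok_delta).
Hypothesis nslE : nsl D = normrows (gens D) (elts D).

Definition elt_set := [set b in autB | rl b \in elts D].

Lemma elts_K p : p \in elts D -> p \in K.
Proof. by case/and5P: oke => _ _ /allP H _ _ /H. Qed.

Lemma group_set_elts : group_set elt_set.
Proof.
have /and5P[_ r _ /allP H _] := oke.
apply/group_setP; split; first by apply/setIdP; rewrite group1 rl1.
move=> x y /setIdP[xB xe] /setIdP[yB ye]; apply/setIdP; split; first exact: groupM.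
by rewrite rlM //; have /allP := H _ xe; apply.
Qed.
Definition P := Group group_set_elts.

Lemma PB : P \subset autB. Proof. by apply/subsetP=> b /setIdP[]. Qed.

Lemma card_P : #|P| = size (elts D).
Proof. by rewrite (card_rl (L := elts D)) //; [case/and5P: oke | apply: elts_K]. Qed.

Lemma elts_P p : p \in elts D -> exists2 b, b \in P & rl b = p.
Proof. by move=> pe; have [b bB e] := K_rl (elts_K pe); exists b => //; apply/setIdP; rewrite e. Qed.

Definition normS (s : 'S_11) := forall p, p \in elts D -> exists2 q, q \in elts D & mulp p (mkp s) = mulp (mkp s) q.

Lemma elts_perm p : p \in elts D -> exists s t : 'S_11, p = mkp s /\ aut_by s t.
Proof. by move/elts_K/K_aut. Qed.

Lemma mkp_permI (s t : 'S_11) : mkp s = mkp t -> s = t.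
Proof. by move/mkp_inj=> e; apply/permP. Qed.

(** Take for each generator the element to which [s] conjugates it. Every prefix of [s] then passes
    [chkcomm], which compares only images already known; 11 stands for an unknown one. *)
Lemma normrows_complete s : normS s -> mkp s \in nsl D.
Proof.
move=> nS; rewrite nslE; have gS : {subset gens D <= elts D} by case/and5P: oke => _ _ _ _ /allP.
have [pq pqc Hpq] : exists2 pq, pq \in choices (gens D) (elts D) & forall z, z \in pq ->
    exists p q : 'S_11, [/\ z = (mkp p, mkp p^-1, mkp q) & p * s = s * q].
  elim: (gens D) gS => [|g gs IH] gS /=; first by exists [::].
  have [|pq pqc Hpq] := IH; first by move=> x xg; apply: gS; rewrite inE xg orbT.
  have ge : g \in elts D by apply: gS; rewrite inE eqxx.
  have [q qe e] := nS g ge; have [p [t [ep _]]] := elts_perm ge; have [q' [t' [eq _]]] := elts_perm qe.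
  exists ((g, invp g, q) :: pq).
    by apply/flattenP; exists (map (cons (g, invp g, q)) (choices gs (elts D))); apply: map_f.
  move=> z; rewrite inE => /orP[/eqP ->|/Hpq //]; exists p, q'; split; first by rewrite ep eq invp_mk.
  by apply: mkp_permI; rewrite -!mulp_mkM -ep -eq.
apply/flattenP; exists (backtrack rng (chkcomm pq) 11 [::]); first exact: map_f.
have := @backtrack_complete _ rng (chkcomm pq) (mkp s) [::]; rewrite size_mkp; apply.
  by apply/allP=> x /mapP[i _ ->]; rewrite mem_rng ltn_ord.
move=> k k11; have {k11}[x ->] : exists x : I11, k = x by exists (Ordinal k11).
rewrite cats0 take_mkp rev_rcons /chkcomm mem_natE mem_rev -rev_rcons revK size_rev -take_mkp.
rewrite size_takel ?size_mkp ?(ltnW (ltn_ord x)) //; case: ifP => [/mem_take_mkp[j jk]|_].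
  by move/val_inj/perm_inj=> ej; rewrite -ej ltnn in jk.
rewrite allbE; apply/allP=> z /Hpq[p [q [-> ps]]].
have nth_t (j : I11) : nth 11 (take x.+1 (mkp s)) j = if j <= x then nat_of_ord (s j) else 11.
  case: leqP => jk; last by rewrite nth_default // size_takel // size_mkp.
  by rewrite nth_take // (set_nth_default 0) ?size_mkp // -/(ap _ _) ap_mkp.
have lt (j : I11) : eqn j 11 = false by apply/negbTE; rewrite eqnE neq_ltn ltn_ord.
rewrite !ap_mkp !nth_t.
have psx (y : I11) : s (p y) = q (s y) by rewrite -!permM ps.
have fin : (if eqn (if p^-1 x <= x then nat_of_ord (s (p^-1 x)) else 11) 11 then true
    else eqn (s x) (ap (mkp q) (if p^-1 x <= x then nat_of_ord (s (p^-1 x)) else 11))).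
  by case: (leqP (p^-1 x) x) => _ //; rewrite lt ap_mkp -psx permKV eqnE.
by case: (leqP (p x) x) => _; rewrite ?lt ?psx ?eqnE ?eqxx.
Qed.
Lemma normal_normS s : normal (mkp s) -> normS s.
Proof. by move/allP=> H p pe; have /hasP[q qe /eqP e] := H p pe; exists q. Qed.

Lemma repsP n : n \in reps -> exists s, [/\ n = mkp s, normS s, normS s^-1 & find0 (sysV (mkp s)) = Some (mkp s)].
Proof.
move=> nr; have /andP[_ /allP/(_ n nr)/and4P[/mkp_perm[s e] n1 n2 /eqP f]] := okr.
by exists s; rewrite -e; split=> //; apply: normal_normS; rewrite -?invp_mk -e.
Qed.

Lemma normS_mul s t : normS s -> normS t -> normS (s * t).
Proof.
move=> ns nt p pe; have [q qe e] := ns p pe; have [r re e'] := nt q qe; exists r => //.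
have [p0 [? [ep _]]] := elts_perm pe; have [q0 [? [eq _]]] := elts_perm qe; have [r0 [? [er _]]] := elts_perm re.
move: e e'; rewrite ep eq er !mulp_mkM => /mkp_permI e /mkp_permI e'.
by rewrite mulgA e -mulgA e' mulgA.
Qed.

Lemma normS_row b r : b \in 'N(P) -> (forall m, rowF (b m) = r (rowF m)) -> normS r.
Proof.
move=> bN hb p pe; have [x xP ex] := elts_P pe.
have yP : x ^ b \in P by rewrite memJ_norm.
have /setIdP[xB _] := xP; have /setIdP[yB ye] := yP.
have [s [t [_ B]]] := autB_acts xB; have [s' [t' [_ B']]] := autB_acts yB.
exists (rl (x ^ b)) => //; rewrite -ex (rl_acts B) (rl_acts B') !mulp_mkM; apply: eq_mkp => i.
have [m <-] := rowF_surj i; have [es _] := B m; have [es' _] := B' (b m).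
by rewrite !permM -hb -es' -es -hb -!permM conjgE !mulgA mulgV mul1g.
Qed.

(** The conjugate of an element of [P] fixes both base kernels, so it is an automorphism of the base
    and is determined by its row permutation; that one is in [elts] because [r^-1] normalises. *)
Lemma row_norm (b : {perm flagT}) r k : (forall m, rowF (b m) = r (rowF m)) -> normS r^-1 ->
  pullback b k = kc -> (forall x, x \in P -> pullback x k = k) -> b \in 'N(P).
Proof.
move=> hb nr bk Pk; rewrite -groupV inE; apply/subsetP=> y; rewrite mem_conjgV => xP; set x := y ^ b in xP.
have ey : y = b * x * b^-1 by rewrite /x conjgE !mulgA mulgV mul1g mulgK.
clearbody x; have /setIdP[xB xe] := xP; have [s [t [_ B]]] := autB_acts xB.
have rV m : rowF (b^-1 m) = r^-1 (rowF m) by apply: (@perm_inj _ r); rewrite -hb !permKV.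
have ry m : rowF (y m) = (r * s * r^-1) (rowF m).
  by rewrite ey !permM rV; have [-> _] := B (b m); rewrite hb.
have yc : pullback y kc = kc by rewrite ey !pullbackM -{1}bk pullbackK Pk.
have yr : pullback y kr = kr by apply/setP=> z; rewrite !inE !ry (inj_eq perm_inj).
apply/setIdP; split; first by apply/in_autB.
have [q qe e] := nr _ xe; have -> : rl y = q; last by [].
have [q0 [? [eq _]]] := elts_perm qe; move: e; rewrite (rl_acts B) eq !mulp_mkM => /mkp_permI e.
by apply: eq_mkp => i; rewrite ry -mulgA e mulgA mulgV mul1g.
Qed.

Lemma key_mkV (f f' : I11 -> I11 -> bool) (l : 'S_11) : (forall i j, f' i (l j) = f i j) -> key D (mkV f') = key D (mkV f).
Proof.
move=> H; apply/eq_in_map => -[[i j] k] /(allP okk)/and3P[/= i11 j11 k11].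
apply/(h3_mkV f' (Ordinal i11) (Ordinal j11) (Ordinal k11))/(h3_mkV f (Ordinal i11) (Ordinal j11) (Ordinal k11)).
  by case=> c; rewrite -(permKV l c) !H; exists (l^-1 c).
by case=> c; exists (l c); rewrite !H.
Qed.

Lemma find0_mkV (f f' : I11 -> I11 -> bool) (l : 'S_11) : (forall i j, f' i (l j) = f i j) -> find0 (mkV f') = find0 (mkV f).
Proof. by move=> H; rewrite /find0 (key_mkV H). Qed.

Definition vcode (c : seq nat * mat) (k : kernel) :=
  exists s u, [/\ c = (mkp s, mkM u), mkp s \in reps, rsys s u & kerf u = k].

(** [ok_find] provides an automorphism of the base between the system of [s] and its normal form;
    its action on columns is the renaming [l]. *)
Lemma renorm s u : normS s -> rsys s u -> exists n l : 'S_11,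
  [/\ find0 (sysV (mkp s)) = Some (mkp n), mkp n \in reps, autcol (mulp (mkp s) (invp (mkp n))) = mkp l & rsys n (l \o u)].
Proof.
move=> ns H; have := allP okf _ (normrows_complete ns); case e: (find0 _) => [m|] // /andP[mr].
have [n [em _ _ _]] := repsP mr; rewrite em invp_mk mulp_mkM => /isautP[l hl]; exists n, l; split=> //.
- by rewrite -em.
- by rewrite invp_mk mulp_mkM; apply: autcol_mk.
by apply: (rsys_relab H) => i j; rewrite -(hl (s^-1 i) j) permM permKV.
Qed.

(** Labellings with the same kernel differ by a bijection of labels. It preserves keys, so the row
    permutations agree; then it fixes every block, hence every label. *)
Lemma vcode_uniq c c' k : vcode c k -> vcode c' k -> c = c'.
Proof.
case=> s [u [-> sr H e]] [s' [u' [-> s'r H' e']]].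
have [l hl] := ker_eq_perm (rsys_surj H) (etrans e (esym e')).
have hinc i j : incn (s'^-1 i) (l j) = incn (s^-1 i) j.
  rewrite -H -H'; apply/hitsP/hitsP=> -[m <-]; rewrite ?hl; first by move/perm_inj <-; exists m.
  by move=> <-; exists m.
have [t [et _ _ ft]] := repsP sr; have [t' [et' _ _ ft']] := repsP s'r.
have es : s = s'.
  move: ft ft'; rewrite -et -et' !sysV_mk (find0_mkV hinc) => -> /Some_inj; exact: mkp_permI.
have l1 j : l j = j by apply/esym/bcol_inj => i; rewrite -{1}(permK s i) -hinc es permK.
by congr pair; [rewrite es | apply: eq_mkM => m; rewrite hl l1].
Qed.

Definition fixedK (k : kernel) := forall x, x \in P -> pullback x k = k.

Lemma fixedK_norm b k : b \in 'N(P) -> fixedK k -> fixedK (pullback b k).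
Proof.
by move=> bN H x xP; rewrite -pullbackM conjgC pullbackM H // memJ_norm.
Qed.

Definition ximg (x : rimage) (M : mat) : seq nat * mat := (x.1.2, relab x.2 (pull x.1.1 M)).
Definition img_of m g : rimage := let gm := mulp m g in let n := if find0 (sysV gm) is Some n then n else [::] in
  (let gi := invp g in atab gi (autcol gi), n, autcol (mulp gm (invp n))).
Definition mke n : entry := (n, (map (img_of n) (nreps D), map (img_of (invp n)) (nreps D))).

Lemma trE : tr = tmap mke t0.
Proof.
have e A B (f f' : A -> B) (t : trie A) : f =1 f' -> tmap f t = tmap f' t.
  by move=> ef; elim: t => [[x|]|u IHu v IHv] //=; rewrite ?ef ?IHu ?IHv.
by apply: e => n; congr (n, (_, _)); rewrite /imgs -map_comp.
Qed.

Lemma trP e : e \in leaves tr -> exists2 n, n \in reps & e = mke n.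
Proof. by rewrite trE leaves_tmap => /mapP[n nr ->]; exists n. Qed.

Lemma mke_tr n : n \in reps -> mke n \in leaves tr.
Proof. by move=> nr; rewrite trE leaves_tmap map_f. Qed.

Lemma lookE V n : find0 V = Some n -> look D tr V = mke n.
Proof. by rewrite /find0 => e; rewrite /look trE tfind_tmap e. Qed.

Lemma fixedK_base : fixedK kr /\ fixedK kc.
Proof. by split=> x xP; have /(subsetP PB)/in_autB[] := xP. Qed.

Definition acts_rows b s := forall m, rowF (b m) = s (rowF m).

Lemma nrepsP g : g \in nreps D -> exists b s, [/\ b \in autB :&: 'N(P), rl b = g, g = mkp s, normS s & acts_rows b s].
Proof.
move=> gr; have /andP[/allP/(_ g gr)/and4P[ga /mkp_perm[s e] n1 n2] _] := okn.
rewrite e in ga n1 n2; have [t H] := isautP s ga; have [b bB B] := aut_by_perm H.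
have hb : acts_rows b s by move=> m; case: (B m).
exists b, s; split; [|exact: etrans (rl_acts B) (esym e)|exact: e|exact: normal_normS n1|exact: hb].
rewrite in_setI bB; have [_ fc] := fixedK_base; apply: (row_norm hb _ _ fc).
  by apply: normal_normS; rewrite -invp_mk.
by have [_] := in_autB _ bB.
Qed.

(** The kernels concerned are fixed by [P], so only the coset of [b^-1] modulo [P] matters, and
    [nreps] represents all cosets. *)
Lemma nreps_cover b : b \in autB :&: 'N(P) -> exists g b', [/\ g \in nreps D, b' \in autB :&: 'N(P), rl b' = g &
  forall k, fixedK k -> pullback b k = pullback b'^-1 k].
Proof.
move=> bN; have : b^-1 \in autB :&: 'N(P) by rewrite groupV.
case/setIP=> bB bN'; have [s [t [H B]]] := autB_acts bB.
have ns : normS s by apply: (normS_row bN') => m; case: (B m).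
have /andP[_ /allP/(_ _ (normrows_complete ns))/implyP] := okn.
case/(_ (introT (isautP s) (ex_intro _ t H)))/hasP=> g gr /hasP[p pe /eqP e].
have [b' [s' [b'N eg _ _ _]]] := nrepsP gr; have [x xP ep] := elts_P pe.
have xB := subsetP PB x xP; have /setIP[b'B _] := b'N.
exists g, b'; split=> // k fk; have -> : b = (x * b')^-1.
  apply: invg_inj; rewrite invgK; apply: rl_inj => //; first exact: groupM.
  by rewrite (rl_acts B) rlM // ep eg.
by rewrite invMg pullbackM; congr (pullback _ _); rewrite -{1}(fk x xP) pullbackK.
Qed.

Lemma atab_mk s t x : aut_by s t -> acts_by x s t -> atab (mkp s) (mkp t) = mkT x.
Proof.
move=> H B; apply: mktab_mk => m; rewrite ap_mkp -[colp m.1 m.2](colF_val m) ap_mkp.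
have h : incn (s m.1) (t (colF m)) by rewrite H incn_flag.
rewrite (flag_mk h); have [e1 e2] := mkflagP h; have [f1 f2] := B m.
by have -> : mkflag (s m.1) (t (colF m)) = x m by apply: flag_inj; rewrite ?e1 ?e2 ?f1 ?f2.
Qed.

Lemma img_of_spec s u b g : normS s -> rsys s u -> b \in autB :&: 'N(P) -> rl b = g ->
  vcode (ximg (img_of (mkp s) g) (mkM u)) (pullback b^-1 (kerf u)).
Proof.
move=> ns H bN eg; have /setIP[bB bN'] := bN.
have [s' [t' [H' B']]] := autB_acts bB; have eg' : g = mkp s' by rewrite -eg (rl_acts B').
have ns' : normS s' by apply: (normS_row bN') => m; case: (B' m).
have hV : acts_rows b^-1 s'^-1 by move=> m; have [e _] := B' (b^-1 m); rewrite permKV in e; rewrite e permK.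
have BV : acts_by b^-1 s'^-1 t'^-1.
  move=> m; split; first exact: hV.
  by have [_ e] := B' (b^-1 m); rewrite permKV in e; rewrite e permK.
have H2 := rsys_comp H hV; rewrite invgK in H2.
have [n [l [f nr' el Hl]]] := renorm (normS_mul ns ns') H2; rewrite -mulp_mkM in f el.
rewrite /ximg /img_of /= eg' f el invp_mk (autcol_mk (aut_byV H')).
rewrite (atab_mk (aut_byV H') BV) pull_mk relab_mk; exists n, (l \o (u \o b^-1)); split=> //.
by rewrite pullback_ker; apply/eqP/ker_eqP=> m m'; rewrite /= (inj_eq perm_inj).
Qed.

Lemma pullback_rows b s : acts_rows b s -> pullback b kr = kr.
Proof. by move=> hb; apply/setP=> z; rewrite !inE !hb (inj_eq perm_inj). Qed.

(** The labels in row [s i] are the columns of the base row i, so every flag of row i has exactly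
    one counterpart there. [row_norm] puts the resulting permutation into the normaliser. *)
Lemma rtab_spec s u k : normS s^-1 -> rsys s u -> kerf u = k -> fixedK k -> exists b,
  [/\ is_rho P k b, rtab (mkp s) (mkM u) = mkT b, acts_rows b s & forall m, u (b m) = colF m].
Proof.
move=> ns H ek fk.
have ex m : exists m', (rowF m' == s (rowF m)) && (u m' == colF m).
  have /hitsP[m' e1 e2] : hits rowF u (s (rowF m)) (colF m) by rewrite H permK incn_flag.
  by exists m'; rewrite e1 e2 !eqxx.
pose b0 m := xchoose (ex m).
have b1 m : rowF (b0 m) = s (rowF m) by have /andP[/eqP] := xchooseP (ex m).
have b2 m : u (b0 m) = colF m by have /andP[_ /eqP] := xchooseP (ex m).
have inj : injective b0 by move=> m m' e; apply: flag_inj; [apply: (@perm_inj _ s); rewrite -!b1 e|rewrite -!b2 e].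
have bk : pullback (perm inj) k = kc by apply/setP=> z; rewrite -ek !inE !permE !b2.
have hb : acts_rows (perm inj) s by move=> m; rewrite permE.
exists (perm inj); split=> //; last by move=> m; rewrite permE.
  split=> //; last exact: pullback_rows hb.
  exact: row_norm hb ns bk fk.
apply: mktab_mk => m; rewrite permE /= ap_mkp -[s m.1]/(s (rowF m)) -b1; congr pair.
rewrite -[colp m.1 m.2](colF_val m) -b2 pos_inE /mkM nth_map_rng // inord_val.
have e5 : b0 m = (rowF (b0 m), (b0 m).2) by case: (b0 m).
rewrite [in u (b0 m)]e5; set i := rowF (b0 m); move: (b0 m).2 => p.
have uI : injective (fun p : 'I_5 => u (i, p)).
  move=> p1 p2 eu; have [] // : (i, p1) = (i, p2); exact: (biplane_inj (rsys_biplane H)).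
have -> : nat_of_ord (u (i, p)) = nth 0 [seq nat_of_ord (u (i, inord p)) | p <- iota 0 5] p.
  by rewrite nth_map5 // inord_val.
rewrite index_uniq ?size_map ?size_iota // map_inj_in_uniq ?iota_uniq // => p1 p2.
by rewrite !mem_iota => h1 h2 /val_inj/uI/(congr1 val); rewrite /= !inordK.
Qed.

Lemma dtab_spec : exists (d : {perm flagT}) (ci di : 'S_11), [/\ [/\ d \in 'N(P), pullback d kr = kc & pullback d kc = kr], dtab D = mkT d,
   invp (dcol D) = mkp ci /\ drow D = mkp di^-1 & forall m, rowF (d m) = ci (colF m) /\ colF (d m) = di (rowF m)].
Proof.
have /and4P[/mkp_perm[dr er] /mkp_perm[dc ec] hi he] := okd.
rewrite er ec !invp_mk in hi he.
have inc (i j : I11) : incn (dc^-1 j) (dr^-1 i) = incn i j.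
  by have /eqP := all_rng2 hi (ltn_ord i) (ltn_ord j); rewrite !ap_mkp.
pose d0 m := mkflag (dc^-1 (colF m)) (dr^-1 (rowF m)).
have hd m : rowF (d0 m) = dc^-1 (colF m) /\ colF (d0 m) = dr^-1 (rowF m) by apply: mkflagP; rewrite inc incn_flag.
have inj : injective d0.
  move=> m m' e; have [r1 c1] := hd m; have [r2 c2] := hd m'; rewrite e in r1 c1.
  by apply: flag_inj; [apply: (@perm_inj _ dr^-1)|apply: (@perm_inj _ dc^-1)]; congruence.
have hp m : rowF (perm inj m) = dc^-1 (colF m) /\ colF (perm inj m) = dr^-1 (rowF m) by rewrite permE.
have pr : pullback (perm inj) kr = kc.
  by apply/setP=> z; rewrite !inE; have [-> _] := hp z.1; have [-> _] := hp z.2; rewrite (inj_eq perm_inj).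
have pc : pullback (perm inj) kc = kr.
  by apply/setP=> z; rewrite !inE; have [_ ->] := hp z.1; have [_ ->] := hp z.2; rewrite (inj_eq perm_inj).
exists (perm inj), dc^-1, dr^-1; split=> //; last by rewrite invgK ec invp_mk.
- split=> //; rewrite -groupV inE; apply/subsetP=> y; rewrite mem_conjgV => xP; set x := y ^ _ in xP.
  have ey : y = perm inj * x * (perm inj)^-1 by rewrite /x conjgE !mulgA mulgV mul1g mulgK.
  clearbody x; have /setIdP[xB xe] := xP; have [s [t [H B]]] := autB_acts xB.
  have [xr xc] := in_autB _ xB; apply/setIdP; split.
    by apply/in_autB; rewrite ey !pullbackM -{1}pc -{2}pr !pullbackK xr xc pr pc.
  have := allP he _ xe; rewrite (rl_acts B) (autcol_mk H) !mulp_mkM.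
  suff -> : rl y = mkp (dr^-1 * t * dr) by [].
  apply: eq_mkp => i; rewrite ey !permM; set m := _ (i, ord0).
  have [_ ec'] := hp ((perm inj)^-1 (x m)); rewrite permKV in ec'.
  apply: (@perm_inj _ dr^-1); rewrite -ec' permK; have [_ ->] := B m.
  by have [_ ->] := hp (i, ord0).
apply: mktab_mk => m; rewrite er ec !invp_mk !ap_mkp -[colp m.1 m.2](colF_val m) ap_mkp.
by rewrite (permE inj m); apply: flag_mk; rewrite inc incn_flag.
Qed.

Definition vertex k := [/\ bpk kr k, bpk kc k & fixedK k].

Lemma fixedK_stab (S : {set kernel}) : (forall k, k \in S -> fixedK k) <-> P \subset aut S.
Proof.
split=> [H|/subsetP H k kS x /H/autP]; last exact.
by apply/subsetP=> x xP; apply/autP=> k kS; apply: H.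
Qed.

Section Conj.
Hypothesis conjP : forall Q : {group {perm flagT}}, Q \subset autB -> #|Q| = #|P| ->
  exists2 a, a \in autB & Q :^ a = P.

(** Bring [k] to the columns by some [b] in the normaliser that keeps the rows. Then [colF] composed
    with [b^-1] has kernel [k], and its row system is given by the row permutation of [b]. *)
Lemma vcode_exists k : bpk kr k -> fixedK k -> exists c, vcode c k.
Proof.
move=> bk fk; have [fr fc] := fixedK_base.
have fS : framed [set kr; k].
  by move=> x y; rewrite !inE => /orP[]/eqP-> /orP[]/eqP->; rewrite ?eqxx // => _; apply: bpk_sym.
have [||| b [hr hk /normP]] := base_move conjP fS _ _ (bpk_neq bk) _ (erefl #|P|).
- by rewrite !inE eqxx.
- by rewrite !inE eqxx orbT.
- by apply/fixedK_stab=> x; rewrite !inE => /orP[]/eqP->.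
rewrite groupV => bN.
have er : kr = kerf (rowF \o b) by rewrite -pullback_ker.
have [s hs] := ker_eq_perm rowF_surj er.
have hV : acts_rows b^-1 s^-1 by move=> m; apply: (@perm_inj _ s); rewrite -hs /= !permKV.
have ek : kerf (colF \o b^-1) = k by rewrite -pullback_ker -hk pullbackK.
have Hs : rsys s (colF \o b^-1).
  have := @rsys_comp 1 colF b^-1 s^-1; rewrite mul1g invgK; apply=> // i j.
  by rewrite hits_base invg1 perm1.
have ns : normS s by apply: (normS_row bN) => m; rewrite -hs.
have [n [l [_ nr' _ Hl]]] := renorm ns Hs.
exists (mkp n, mkM (l \o (colF \o b^-1))), n, (l \o (colF \o b^-1)); split=> //.
by rewrite -ek; apply/eqP/ker_eqP=> m m'; rewrite /= (inj_eq perm_inj).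
Qed.

(** [norm] identifies the normal form by its key alone; the renaming is then unique because a point
    is determined by the blocks through it. *)
Lemma normE u k : kerf u = k -> bpk kr k -> fixedK k -> exists2 c, vcode c k & norm D tr (mkM u) = (mke c.1, c.2).
Proof.
move=> ek bk fk; have [c] := vcode_exists bk fk; case=> s [u0 [ec sr H e0]].
exists c; first by exists s, u0.
have [l hl] := ker_eq_perm (rsys_surj H) (etrans e0 (esym ek)).
have rv : rowvecs (mkM u) = mkV (fun i j => hits rowF u i j).
  rewrite /rowvecs {1}/mkM; apply: etrans (esym (map_comp _ _ _)) _; apply: eq_map_rng => i.
  apply: eq_map_rng => j; rewrite mem_natE !inord_val -mem_mkM; congr nat_of_bool.
  by rewrite /mkM nth_map_rng // inord_val.
have hu i j : hits rowF u i (l j) = incn (s^-1 i) j.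
  by rewrite -H; apply/hitsP/hitsP=> -[m <-]; rewrite ?hl; [move/perm_inj <-; exists m|move=> <-; exists m; rewrite ?hl].
have [s' [es _ _ fs]] := repsP sr.
rewrite /norm (@lookE _ (mkp s)); last by rewrite rv (find0_mkV hu) -sysV_mk es.
rewrite ec.
have -> : relabmap (mke (mkp s)).1 (mkM u) = mkp l^-1.
  apply: eq_map_rng => j; rewrite inord_val; apply: findd_eq => [|k'].
    rewrite allbE; apply/all_rngE => i; apply/eqP.
    by rewrite /= invp_mk ap_mkp mem_natE mem_mkM -hu permKV.
  rewrite allbE => /all_rngE hk; apply: bcol_inj => i.
  have /eqP := hk (s i); rewrite /= invp_mk ap_mkp mem_natE mem_mkM permK => <-.
  by rewrite -{1}(permKV l j) hu permK.
by rewrite relab_mk; congr pair; apply: eq_mkM => m; rewrite /= hl permK.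
Qed.
End Conj.
End Type_.
End NormalForms.
Import NormalForms.

(** * Codes of frames and the test for canonical frames *)

Module CanonicalFrames.
Import GroupScope.

Lemma cmps_cons x s y t : cmps (x :: s) (y :: t) = if x < y then Lt else if y < x then Gt else cmps s t.
Proof. by rewrite /=; elim: x y => [|x IH] [|y] //=; rewrite IH !ltnS. Qed.

Lemma cmps_Eq s t : reflect (s = t) (if cmps s t is Eq then true else false).
Proof.
elim: s t => [|x s IH] [|y t]; rewrite ?cmps_cons; try by constructor.
case: (ltngtP x y) => [xy|xy|->]; [by right=> -[e]; rewrite e ltnn in xy|by right=> -[e]; rewrite e ltnn in xy|].
by apply: (iffP (IH t)) => [->|[]].
Qed.

Lemma cmps_cat a b a' b' : size a = size a' -> cmps (a ++ b) (a' ++ b') = if cmps a a' is Eq then cmps b b' else cmps a a'.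
Proof.
elim: a a' => [|x a IH] [|y a'] // [e]; rewrite !cat_cons !cmps_cons IH //.
by case: (ltngtP x y).
Qed.

Lemma les_cons x s y t : les (x :: s) (y :: t) = (x < y) || (x == y) && les s t.
Proof. by rewrite /les cmps_cons; case: (ltngtP x y). Qed.

Lemma les_refl : reflexive les.
Proof. by elim=> // x s IH; rewrite les_cons eqxx IH orbT. Qed.

Lemma les_trans : transitive les.
Proof.
move=> t s r; elim: s t r => [|x s IH] [|y t] [|z r] //; rewrite !les_cons.
case: (ltngtP x y) => //= [xy _|-> st]; last by case: (ltngtP y z) => //= _ tr; exact: IH st tr.
by case: (ltngtP y z) => //= [yz|<-]; rewrite ?(ltn_trans xy yz) ?xy.
Qed.

Lemma les_anti : antisymmetric les.
Proof.
elim=> [|x s IH] [|y t] //; rewrite !les_cons; case: (ltngtP x y) => //= -> /IH -> //.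
Qed.

Lemma les_total : total les.
Proof. by elim=> [|x s IH] [|y t] //; rewrite !les_cons; case: (ltngtP x y) => //= _; apply: IH. Qed.

Lemma insc_perm x s : perm_eq (insc x s) (x :: s).
Proof.
elim: s => //= y s IH; case: ifP => // _.
by apply: (perm_trans (y := y :: x :: s)); rewrite ?perm_cons // -(cat1s y) -(cat1s x) perm_catCA.
Qed.

Lemma insc_sorted x s : sorted les s -> sorted les (insc x s).
Proof.
elim: s => //= y s IH ps; case: ifP => [xy|/negbT nxy]; first by rewrite /= xy.
have yx : les y x by have := les_total x y; rewrite (negbTE nxy).
move: (IH (path_sorted ps)); case: s ps {IH} => [|z s] /=; first by rewrite yx.
by case/andP=> yz ps; case: ifP => [xz|_] /=; rewrite ?yx ?yz.
Qed.

Lemma insort_perm l : perm_eq (foldr insc [::] l) l.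
Proof.
elim: l => //= x l IH; apply: perm_trans (insc_perm _ _) _; by rewrite perm_cons.
Qed.

Lemma insort_sorted l : sorted les (foldr insc [::] l).
Proof. by elim: l => //= x l; apply: insc_sorted. Qed.

Lemma insort_eq l l' : perm_eq l l' -> foldr insc [::] l = foldr insc [::] l'.
Proof.
move=> p; apply: (sorted_eq les_trans les_anti); try exact: insort_sorted.
by rewrite (perm_trans (insort_perm l)) // perm_sym (perm_trans (insort_perm l')) // perm_sym.
Qed.

Lemma codes_perm Q Q' : perm_eq Q Q' -> codes Q = codes Q'.
Proof. by move=> p; rewrite /codes (insort_eq (l' := map code Q')) // perm_map. Qed.

Lemma flatten_mkM_inj u v : flatten (mkM u) = flatten (mkM v) -> mkM u = mkM v.
Proof.
move=> e; have sh w : shape (mkM w) = nseq 11 5.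
  rewrite /shape /mkM -map_comp (eq_map_rng (g := fun=> 5)) // => i; by rewrite /= size_map size_iota.
by rewrite -(flattenK (mkM u)) -(flattenK (mkM v)) e !sh.
Qed.

Lemma size_code_mk s u : size (code (mkp s, mkM u)) = 66.
Proof.
rewrite -[code _]/(mkp s ++ flatten (mkM u)) size_cat size_mkp size_flatten /shape /mkM -map_comp.
by rewrite (eq_map_rng (g := fun=> 5)) // => i; rewrite /= size_map size_iota.
Qed.

Lemma map_eq_cat (T U : Type) (f : T -> U) z A v B : map f z = A ++ v :: B ->
  exists zA y zB, [/\ z = zA ++ y :: zB, A = map f zA, v = f y & B = map f zB].
Proof.
elim: A z => [|w A IH] [|y z] //= [<-]; first by move=> <-; exists [::], y, z.
by case/IH=> zA [x [zB [-> -> -> ->]]]; exists (y :: zA), x, zB.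
Qed.

Lemma pullback_eq (b : {perm flagT}) k k' k'' : pullback b k' = k'' -> (pullback b k == k'') = (k == k').
Proof. by move=> <-; rewrite (inj_eq (@pullback_inj b)). Qed.

Lemma mem_act_eq (b : {perm flagT}) (S : {set kernel}) k k' : pullback b k = k' -> (k' \in act b S) = (k \in S).
Proof. by move=> <-; rewrite mem_act. Qed.

Section Type_.
Variable D : gdata.
Let t0 := trie0 D.
Let tr := mktrie D.
Implicit Types (s t : 'S_11) (b r g d : {perm flagT}) (S Z : {set kernel}).
Hypotheses (okk : ok_keys D) (oke : ok_elts D) (okn : ok_nreps D) (okf : ok_find D) (okr : ok_reps D) (okd : ok_delta D).
Hypothesis nslE : nsl D = normrows (gens D) (elts D).
Let P := P oke.
Hypothesis conjP : forall Q : {group {perm flagT}}, Q \subset autB -> #|Q| = #|P| ->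
  exists2 a, a \in autB & Q :^ a = P.
Notation vcode := (vcode D).
Notation fixedK := (fixedK oke).
Notation vertex := (vertex oke).

Definition crep (z : seq ((seq nat * mat) * kernel)) S :=
  [/\ forall x, x \in z -> vcode x.1 x.2, uniq (kr :: kc :: map snd z) & S =i kr :: kc :: map snd z].
Definition scode S c := exists2 z, crep z S & c = codes (map fst z).

(** Each kernel has only one code by [vcode_uniq], and sorting removes the order of enumeration. *)
Lemma scode_uniq S c c' : scode S c -> scode S c' -> c = c'.
Proof.
case=> z [vz uz Sz] -> [z' [vz' uz' Sz'] ->]; apply: codes_perm.
have p : perm_eq (map snd z) (map snd z').
  have : perm_eq (kr :: kc :: map snd z) (kr :: kc :: map snd z') by apply: uniq_perm => // k; rewrite -Sz Sz'.
  by rewrite !perm_cons.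
pose F k := nth ([::], [::]) (map fst z) (index k (map snd z)).
have FP k : k \in map snd z -> vcode (F k) k.
  move=> kz; have i : index k (map snd z) < size z by rewrite -(size_map snd) index_mem.
  have := vz _ (mem_nth (([::], [::]), set0) i); rewrite /F (nth_map (([::], [::]), set0)) //.
  by rewrite -(nth_map _ set0) // nth_index.
have FE y : (forall x, x \in y -> vcode x.1 x.2) -> {subset map snd y <= map snd z} -> map fst y = map F (map snd y).
  move=> vy sy; rewrite -map_comp; apply/eq_in_map => x xy; apply: (vcode_uniq okk okr (vy _ xy)).
  by apply: FP; apply: sy; apply: map_f.
rewrite (FE z) // (FE z') //; first exact: perm_map.
by move=> k; rewrite (perm_mem p).
Qed.

Lemma code_inj c c' k k' : vcode c k -> vcode c' k' -> code c = code c' -> k = k'.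
Proof.
case=> s [u [-> _ _ <-]] [s' [u' [-> _ _ <-]]] /eqP; rewrite -[code _]/(mkp s ++ flatten (mkM u)) -[code (mkp s', _)]/(mkp s' ++ flatten (mkM u')) eqseq_cat ?size_mkp // => /andP[_ /eqP/flatten_mkM_inj/mkM_inj e].
by apply/eqP/ker_eqP=> m m'; rewrite !e.
Qed.

(** Every kernel code has length 66 = 11 + 55, so the concatenation can be cut apart again, and each
    piece determines its kernel. *)
Lemma scode_inj S S' c : scode S c -> scode S' c -> S = S'.
Proof.
case=> z [vz uz Sz] -> [z' [vz' uz' Sz']] e.
have sz y : (forall x, x \in y -> vcode x.1 x.2) -> shape (foldr insc [::] (map code (map fst y))) = nseq (size y) 66.
  move=> vy; apply: (@eq_from_nth _ 0) => [|i]; rewrite size_map (perm_size (insort_perm _)) !size_map ?size_nseq // => iy.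
  rewrite nth_nseq iy (nth_map [::]) ?(perm_size (insort_perm _)) ?size_map //.
  have : nth [::] (foldr insc [::] (map code (map fst y))) i \in map code (map fst y).
    by rewrite -(perm_mem (insort_perm _)) mem_nth // (perm_size (insort_perm _)) !size_map.
  case/mapP=> _ /mapP[x xy ->] ->; have [s [u [-> _ _ _]]] := vy x xy; exact: size_code_mk.
have s66 y : (forall x, x \in y -> vcode x.1 x.2) -> size (codes (map fst y)) = (66 * size y)%N.
  by move=> vy; rewrite /codes size_flatten sz // sumn_nseq mulnC.
have ee : size z = size z' by apply/eqP; rewrite -(eqn_pmul2l (m := 66)) // -!s66 // e.
have p : perm_eq (map code (map fst z)) (map code (map fst z')).
  rewrite -(permPl (insort_perm _)) -(permPr (insort_perm _)).
  have -> // : foldr insc [::] (map code (map fst z)) = foldr insc [::] (map code (map fst z')).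
  by rewrite -[LHS]flattenK -[RHS]flattenK !sz // ee; congr reshape.
have sub y y' : (forall x, x \in y -> vcode x.1 x.2) -> (forall x, x \in y' -> vcode x.1 x.2) ->
    perm_eq (map code (map fst y)) (map code (map fst y')) -> {subset map snd y <= map snd y'}.
  move=> vy vy' py k /mapP[x xy ->].
  have : code x.1 \in map code (map fst y') by rewrite -(perm_mem py) !map_f.
  by case/mapP=> _ /mapP[x' x'y ->] /(code_inj (vy _ xy) (vy' _ x'y)) ->; rewrite map_f.
apply/setP=> k; rewrite Sz Sz' !inE; congr (_ || (_ || _)).
by apply/idP/idP; apply: sub => //; rewrite perm_sym.
Qed.

Definition vrepr (v : entry * mat) k := [/\ vertex k, v.1 = mke D v.1.1 & vcode (v.1.1, v.2) k].
Definition frepr (Q : frame) S := exists z : seq (entry * mat * kernel),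
  [/\ Q = map fst z, forall x, x \in z -> vrepr x.1 x.2, uniq (kr :: kc :: map snd z) & S =i kr :: kc :: map snd z].
Definition plain (v : entry * mat) := (v.1.1, v.2).

Lemma frepr_scode Q S : frepr Q S -> scode S (codes (map plain Q)).
Proof.
case=> z [-> vz uz Sz]; exists [seq (plain x.1, x.2) | x <- z]; last by rewrite -!map_comp.
by split; rewrite -?map_comp //; move=> _ /mapP[x xz ->]; case: (vz x xz).
Qed.

(* [S] in which the vertex [x] is exchanged for [y], all moved by [b]. *)
Lemma frepr_move b S (us : seq (mat * kernel)) : framed S -> based S -> P \subset aut S -> b \in 'N(P) ->
    based (act b S) -> (forall x, x \in us -> exists2 u, x.1 = mkM u & kerf u = pullback b x.2) ->
    uniq (map snd us) -> (forall k, (k \in map snd us) = [&& k \in S, pullback b k != kr & pullback b k != kc]) ->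
  frepr [seq norm D tr x.1 | x <- us] (act b S).
Proof.
move=> fS bS PS bN bbS Hu uu us_S; exists [seq (norm D tr x.1, pullback b x.2) | x <- us].
have /andP[rS cS] := bbS; have fbS := framed_act (b := b) fS.
have mem x : x \in us -> [&& x.2 \in S, pullback b x.2 != kr & pullback b x.2 != kc] by move=> xu; rewrite -us_S map_f.
have e2 : [seq x.2 | x <- [seq (norm D tr x.1, pullback b x.2) | x <- us]] = map (pullback b) (map snd us) by rewrite -!map_comp.
split; first by rewrite -map_comp.
- move=> _ /mapP[x xu ->] /=; have [u -> eu] := Hu x xu; have /and3P[xS n1 n2] := mem x xu.
  have fk : fixedK x.2 by apply: (fixedK_stab oke S).2.
  have b1 : bpk kr (pullback b x.2) by apply: fbS; rewrite ?mem_act // eq_sym.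
  have b2 : bpk kc (pullback b x.2) by apply: fbS; rewrite ?mem_act // eq_sym.
  have fk' := fixedK_norm bN fk; have [c vc ->] := normE okk okf okr nslE conjP eu b1 fk'; split=> //.
  by case: c vc.
- rewrite e2 /= !inE negb_or (bpk_neq bpk_base) (map_inj_uniq (@pullback_inj b)) uu andbT /=.
  apply/andP; split; apply/negP=> /mapP[_ /mapP[x xu ->] e]; have /and3P[_ n1 n2] := mem x xu.
    by rewrite -e eqxx in n1.
  by rewrite -e eqxx in n2.
move=> k; rewrite e2 !inE; apply/idP/idP => [|/or3P[/eqP ->|/eqP ->|]] //.
  case/imsetP=> k' k'S ->; case: eqVneq => //= n1; case: eqVneq => //= n2.
  by rewrite map_f // us_S k'S n1.
by case/mapP=> k' + ->; rewrite us_S mem_act => /andP[].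
Qed.

Definition axis_ok c S := forall Y c', axis_images P S Y -> scode Y c' -> les c c'.
Definition canonical S := forall b c c', b \in 'N(P) -> based (act b S) -> scode S c -> scode (act b S) c' -> les c c'.

(** [P] fixes every kernel of [S], so the images under the listed coset representatives are all
    images under automorphisms of the base in the normaliser. *)
Lemma gimages_ok c Q S : based S -> P \subset aut S -> frepr Q S ->
  (forall g c', g \in autB :&: 'N(P) -> scode (act g S) c' -> les c c') <->
    (allb (fun j => les c (codes (map (gimage j) Q))) (iota 0 (size (nreps D)))).
Proof.
move=> bS PS [z [eQ vz uz Sz]]; rewrite allbE.
have key j b : j < size (nreps D) -> b \in autB :&: 'N(P) -> rl b = nth [::] (nreps D) j ->
    scode (act b^-1 S) (codes (map (gimage j) Q)).
  move=> jn bN eb; have /setIP[bB bN'] := bN; have bVB : b^-1 \in autB by rewrite groupV.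
  have [br bc] := in_autB _ bVB.
  exists [seq (gimage j x.1, pullback b^-1 x.2) | x <- z]; last by rewrite eQ -!map_comp.
  have e2 : [seq x.2 | x <- [seq (gimage j x.1, pullback b^-1 x.2) | x <- z]] = map (pullback b^-1) (map snd z) by rewrite -!map_comp.
  have e3 : kr :: kc :: map (pullback b^-1) (map snd z) = map (pullback b^-1) (kr :: kc :: map snd z) by rewrite /= br bc.
  split; rewrite ?e2 ?e3 ?(map_inj_uniq (@pullback_inj _)) //.
    move=> _ /mapP[[v k] xz ->]; have [_ ev [s [u [[es eM] sr H <-]]]] := vz _ xz; rewrite /= in es eM ev *.
    have [s' [es' ns _ _]] := repsP okr sr; rewrite -(mkp_permI es') in ns.
    rewrite /gimage ev /= (nth_map [::]) //= es eM.
    exact: (img_of_spec okf okr nslE ns H bN eb).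
  by move=> k; rewrite mem_actV Sz -[k in RHS](pullbackVK b^-1 k) (mem_map (@pullback_inj b^-1)).
split=> [H|/allP H g c' gN sc]; last first.
  have [n0 [b' [n0r b'N eb' hb]]] := nreps_cover okn nslE gN.
  have jn : index n0 (nreps D) < size (nreps D) by rewrite index_mem.
  have jm : index n0 (nreps D) \in iota 0 (size (nreps D)) by rewrite mem_iota.
  have := H _ jm; have <- // : c' = codes (map (gimage (index n0 (nreps D))) Q).
  apply: scode_uniq sc _; have -> : act g S = act b'^-1 S.
    by apply: eq_in_imset => k kS; apply: hb; apply: (fixedK_stab oke S).2.
  by apply: key; rewrite ?nth_index.
apply/allP=> j; rewrite mem_iota => /= jn; have [b [s [bN eb _ _ _]]] := nrepsP oke okn (mem_nth [::] jn).
by apply: (H b^-1); [rewrite groupV | exact: key].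
Qed.

Definition rho1 (A : frame) (v : entry * mat) (B : frame) : frame :=
  [seq norm D tr (pull (rtab v.1.1 v.2) M) | M <- [seq w.2 | w <- A] ++ Brow :: [seq w.2 | w <- B]].

Lemma mem_rhos A0 Q R : (R \in rhos D tr A0 Q) <-> exists A v B, Q = A ++ v :: B /\ R = rho1 (A0 ++ A) v B.
Proof.
elim: Q A0 => [|v Q IH] A0; first by split=> // -[[|? ?] [? [? []]]].
have -> : rhos D tr A0 (v :: Q) = rho1 A0 v Q :: rhos D tr (rcons A0 v) Q by [].
rewrite inE; split.
  case/orP=> [/eqP ->|/IH[A [w [B [-> ->]]]]]; first by exists [::], v, Q; rewrite cats0.
  by exists (v :: A), w, B; rewrite cat_rcons.
case=> -[|v' A] [w [B [[-> eQ] eR]]]; first by rewrite eR eQ cats0 eqxx.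
by apply/orP; right; apply/IH; exists A, w, B; rewrite eR cat_rcons.
Qed.

Lemma based_rho S k r : based S -> k \in S -> is_rho P k r -> based (act r S).
Proof. by case/andP=> rS _ kS [_ rr rk]; rewrite /based (mem_act_eq S rr) (mem_act_eq S rk) rS kS. Qed.

(** The kernel of [x] becomes the columns and the old columns become an ordinary kernel, so [Brow]
    stands where [x] stood. *)
Lemma rho1_spec S (zA zB : seq (entry * mat * kernel)) x : framed S -> based S -> P \subset aut S ->
    (forall y, y \in zA ++ x :: zB -> vrepr y.1 y.2) -> uniq (kr :: kc :: map snd (zA ++ x :: zB)) ->
    S =i kr :: kc :: map snd (zA ++ x :: zB) ->
  exists2 r, is_rho P x.2 r /\ rtab x.1.1.1 x.1.2 = mkT r & frepr (rho1 (map fst zA) x.1 (map fst zB)) (act r S).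
Proof.
move=> fS bS PS vz uz Sz; have xz : x \in zA ++ x :: zB by rewrite mem_cat inE eqxx orbT.
have xS : x.2 \in S by rewrite Sz !inE map_f ?orbT.
have [[_ _ fx] _ [s [u [[es eM] sr H ek]]]] := vz x xz.
have [s' [es' ns ns' _]] := repsP okr sr; rewrite -(mkp_permI es') in ns ns'.
have [r [rho tE hr ur]] := rtab_spec ns' H ek fx; exists r; first by rewrite es eM tE; split.
have [rN rr rk] := rho.
have pk k (u' : flagT -> I11) : kerf u' = k -> pull (rtab x.1.1.1 x.1.2) (mkM u') = mkM (u' \o r) /\ kerf (u' \o r) = pullback r k.
  by rewrite es eM tE pull_mk -pullback_ker => ->.
pose f (y : entry * mat * kernel) := (pull (rtab x.1.1.1 x.1.2) y.1.2, y.2).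
have := @frepr_move r S (map f zA ++ (pull (rtab x.1.1.1 x.1.2) Brow, kc) :: map f zB) fS bS PS rN (based_rho bS xS rho).
rewrite (_ : [seq norm D tr y.1 | y <- _] = rho1 (map fst zA) x.1 (map fst zB)); last first.
  by rewrite /rho1 !map_cat /= -!map_comp.
have e2 : map snd (map f zA ++ (pull (rtab x.1.1.1 x.1.2) Brow, kc) :: map f zB) = map snd zA ++ kc :: map snd zB.
  by rewrite map_cat /= -!map_comp.
move: uz; rewrite map_cat !cons_uniq cat_uniq /= !inE !mem_cat !inE => /and3P[nr nc /and3P[uA nAB /andP[nx uB]]].
move: nAB nr nc; rewrite !negb_or => /andP[xA nAB] /and4P[rc rA rx rB] /and3P[cA cx cB].
apply; rewrite ?e2.
- move=> y; rewrite mem_cat inE => /or3P[/mapP[v vA ->]|/eqP ->|/mapP[v vB ->]].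
  + have [_ _ [s1 [u1 [[_ e1] _ _ k1]]]] : vrepr v.1 v.2 by apply: vz; rewrite mem_cat vA.
    by exists (u1 \o r); rewrite /f [_.1]/= -[v.1.2]/((v.1.1.1, v.1.2).2); have [] := pk _ _ k1; rewrite -e1.
  + by exists (colF \o r); rewrite /= ?Brow_mk; have [] := pk _ _ (erefl kc).
  + have [_ _ [s1 [u1 [[_ e1] _ _ k1]]]] : vrepr v.1 v.2 by apply: vz; rewrite mem_cat inE vB !orbT.
    by exists (u1 \o r); rewrite /f [_.1]/= -[v.1.2]/((v.1.1.1, v.1.2).2); have [] := pk _ _ k1; rewrite -e1.
- by rewrite cat_uniq /= negb_or cA cB uA uB nAB.
move=> k; rewrite mem_cat inE Sz map_cat !inE mem_cat inE (pullback_eq _ rr) (pullback_eq _ rk).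
case: (eqVneq k kr) => [->|_] /=; first by rewrite (negbTE rA) (negbTE rB) (negbTE rc).
case: (eqVneq k x.2) => [->|_] /=; first by rewrite andbF (negbTE xA) (negbTE nx) eq_sym (negbTE cx).
by rewrite andbT; case: (k == kc); rewrite ?orbT.
Qed.

Lemma delta_spec d Q S : framed S -> based S -> P \subset aut S -> frepr Q S ->
  d \in 'N(P) -> pullback d kr = kc -> pullback d kc = kr -> dtab D = mkT d -> frepr (delta D tr Q) (act d S).
Proof.
move=> fS bS PS [z [-> vz uz Sz]] dN dr dc dE.
pose f (y : entry * mat * kernel) := (pull (dtab D) y.1.2, y.2).
have /andP[rS cS] := bS.
have bdS : based (act d S) by rewrite /based (mem_act_eq _ dr) (mem_act_eq _ dc) rS cS.
have := @frepr_move d S (map f z) fS bS PS dN bdS.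
rewrite (_ : [seq norm D tr y.1 | y <- _] = delta D tr (map fst z)); last by rewrite /delta -!map_comp.
have e2 : map snd (map f z) = map snd z by rewrite -map_comp.
move: uz; rewrite !cons_uniq inE negb_or => /and3P[/andP[rc nr] nc uz].
apply; rewrite ?e2 //.
  move=> y /mapP[v vz' ->]; have [_ _ [s1 [u1 [[_ e1] _ _ k1]]]] := vz v vz'.
  by exists (u1 \o d); rewrite /f [_.2]/= ?[_.1]/=; [rewrite -pull_mk -dE -e1|rewrite -k1 pullback_ker].
move=> k; rewrite Sz !inE (pullback_eq _ dr) (pullback_eq _ dc).
case: (eqVneq k kr) => [->|_] /=; first by rewrite (negbTE nr) andbF.
by case: (eqVneq k kc) => [->|_] /=; rewrite ?(negbTE nc) // andbT.
Qed.

Lemma axis_images_act g S Y : g \in autB :&: 'N(P) -> axis_images P (act g S) Y -> axis_images P S Y.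
Proof.
move=> gN [h hN [->|[k [r [kS n1 n2 [rN rr rk] ->]]]]].
  by exists (h * g); [apply: groupM | left; rewrite actM].
have /setIP[gB gN'] := gN; have [gr gc] := in_autB _ gB.
exists h => //; right; exists (pullback g^-1 k), (r * g); split.
- by rewrite -mem_actV.
- by rewrite -(pullback_eq _ gr) pullbackVK.
- by rewrite -(pullback_eq _ gc) pullbackVK.
- by split; rewrite ?groupM // pullbackM ?gr // pullbackVK.
by rewrite actM.
Qed.

(** Two ways of bringing [k] to the columns differ by an automorphism of the base, so the one built
    by [rtab] may stand for any other. *)
Lemma rho_rho S k r r' : is_rho P k r -> is_rho P k r' -> r * r'^-1 \in autB :&: 'N(P).
Proof.
case=> rN rr rk [rN' rr' rk']; apply/setIP; split; last by rewrite groupM ?groupV.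
by apply/in_autB; rewrite !pullbackM; split; apply/eqP; [rewrite (pullback_eq _ rr) -{1}rr'|rewrite (pullback_eq _ rk) -{1}rk']; rewrite pullbackK.
Qed.

Lemma axisS_ok c Q S : framed S -> based S -> P \subset aut S -> frepr Q S -> axisS D tr c Q <-> axis_ok c S.
Proof.
move=> fS bS PS fQ; have [z [eQ vz uz Sz]] := fQ; rewrite /axisS allbE [all _ _]/=.
have rhoP x : x \in z -> exists r A B, [/\ is_rho P x.2 r, based (act r S), P \subset aut (act r S), 
    Q = A ++ x.1 :: B & frepr (rho1 A x.1 B) (act r S)].
  move=> xz; have xS : x.2 \in S by rewrite Sz !inE map_f ?orbT.
  case/splitPr: xz vz uz Sz eQ => zA zB vz uz Sz eQ.
  have [r [rho _] fr] := rho1_spec fS bS PS vz uz Sz; exists r, (map fst zA), (map fst zB); split=> //.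
  - exact: based_rho rho.
  - by apply: aut_act_norm => //; case: rho.
  by rewrite eQ map_cat.
split=> [/andP[/(gimages_ok _ bS PS fQ) H1 /allP H2] Y c' [g gN [->|[k [r [kS n1 n2 rho ->]]]]]|H]; first exact: H1.
  have : k \in kr :: kc :: map snd z by rewrite -Sz.
  rewrite !inE (negbTE n1) (negbTE n2) /= => /mapP[x xz ek]; rewrite ek in rho.
  have [r' [A [B [rho' b' P' eQ' fr]]]] := rhoP x xz.
  have : rho1 A x.1 B \in rhos D tr [::] Q by apply/mem_rhos; exists A, x.1, B.
  move/H2/(gimages_ok _ b' P' fr) => H3 sc; apply: (H3 (g * (r * r'^-1))); first by rewrite groupM // (rho_rho S rho).
  by rewrite -actM -mulgA mulgKV actM.
apply/andP; split.
  by apply/(gimages_ok _ bS PS fQ) => g c' gN; apply: H; exists g => //; left.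
apply/allP=> R /mem_rhos[A [v [B [eQ' ->]]]].
have [zA [y [zB [ez eA -> eB]]]] := map_eq_cat (etrans (esym eQ) eQ').
have yz : y \in z by rewrite ez mem_cat inE eqxx orbT.
have yS : y.2 \in S by rewrite Sz !inE map_f ?orbT.
have [|||r [rho _] fr] := @rho1_spec S zA zB y fS bS PS; rewrite -?ez //.
have b' := based_rho bS yS rho; have rN : r \in 'N(P) by case: rho.
have P' := aut_act_norm rN PS; rewrite eA eB.
apply/(gimages_ok _ b' P' fr) => g c' gN; apply: H; exists g => //; right; exists y.2, r.
have yk : y.2 \in map snd z by apply: map_f.
by split=> //; apply: contraTneq uz => e; rewrite !cons_uniq !inE -e yk ?orbT ?andbF.
Qed.

(** By [based_images], every based image lies on the axis of [S], of its dual, or of the dual of one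
    of its [rhos], and these are the axes that the program tests. *)
Lemma canonSP Q S : framed S -> based S -> P \subset aut S -> frepr Q S -> canonS D tr Q <-> canonical S.
Proof.
move=> fS bS PS fQ; have [d [ci [di [[dN dr dc] dE _ _]]]] := dtab_spec oke okd.
have sc := frepr_scode fQ; rewrite /canonS -/(map plain Q); set c := codes (map plain Q) in sc *.
have bd Z : based Z -> based (act d Z).
  by case/andP=> rZ cZ; rewrite /based (mem_act_eq _ dr) (mem_act_eq _ dc) rZ cZ.
have axd Z R : framed Z -> based Z -> P \subset aut Z -> frepr R Z -> axisS D tr c (delta D tr R) <-> axis_ok c (act d Z).
  move=> fZ bZ PZ fR; apply: axisS_ok; [exact: framed_act | exact: bd | exact: aut_act_norm | exact: (delta_spec fZ bZ PZ fR dN)].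
have H1 := axisS_ok c fS bS PS fQ; have H2 := axd S Q fS bS PS fQ.
have rhoP R : R \in rhos D tr [::] Q -> exists k r, [/\ k \in S, k != kr, k != kc, is_rho P k r & frepr R (act r S)].
  case/mem_rhos=> A [v [B [eQ' ->]]]; have [z [eQ vz uz Sz]] := fQ.
  have [zA [y [zB [ez eA -> eB]]]] := map_eq_cat (etrans (esym eQ) eQ').
  have yz : y \in z by rewrite ez mem_cat inE eqxx orbT.
  have yk : y.2 \in map snd z by apply: map_f.
  have [|||r [rho _] fr] := @rho1_spec S zA zB y fS bS PS; rewrite -?ez //.
  exists y.2, r; rewrite eA eB; split=> //; first by rewrite Sz !inE yk !orbT.
    by apply: contraTneq uz => e; rewrite !cons_uniq !inE -e yk ?orbT ?andbF.
  by apply: contraTneq uz => e; rewrite !cons_uniq !inE -e yk ?orbT ?andbF.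
have rhoE k r : k \in S -> k != kr -> k != kc -> is_rho P k r -> exists2 R, R \in rhos D tr [::] Q &
    exists2 r', is_rho P k r' & frepr R (act r' S).
  move=> kS n1 n2 rho; have [z [eQ vz uz Sz]] := fQ.
  have : k \in kr :: kc :: map snd z by rewrite -Sz.
  rewrite !inE (negbTE n1) (negbTE n2) /= => /mapP[x xz ek]; rewrite ek.
  case/splitPr: xz vz uz Sz eQ => zA zB vz uz Sz eQ.
  have [r' [rho' _] fr] := rho1_spec fS bS PS vz uz Sz; exists (rho1 (map fst zA) x.1 (map fst zB)); last by exists r'.
  by apply/mem_rhos; exists (map fst zA), x.1, (map fst zB); rewrite eQ map_cat.
have aR k r : k \in S -> is_rho P k r -> [/\ framed (act r S), based (act r S) & P \subset aut (act r S)].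
  by move=> kS rho; split; [exact: framed_act | exact: based_rho rho | apply: aut_act_norm => //; case: rho].
split=> [|can].
  case e1: (axisS _ _ _ _) => //; case e2: (axisS _ _ _ _) => //; rewrite allbE => /allP H3.
  move=> b c0 c' bN bb sc0 sc'; rewrite (scode_uniq sc0 sc).
  have [h|h|[k [r [kS n1 n2 rho h]]]] := based_images conjP fS bS PS dN dr dc bN bb.
  - exact: (H1.1 e1) h sc'.
  - exact: (H2.1 e2) h sc'.
  case: (rhoE k r kS n1 n2 rho) => R Rr [r' rho' fr].
  have [f' b' P'] := aR k r' kS rho'.
  (* The program used [r'] in place of [r]. Their quotient is an automorphism of the base, and so is
     its conjugate by [d], which exchanges the two base kernels. *)
  apply: ((axd _ R f' b' P' fr).1 (H3 R Rr)) sc'; apply: (@axis_images_act (d * (r * r'^-1) * d^-1)).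
    have /setIP[gB gN] := rho_rho S rho rho'; apply/setIP; split; last exact: groupM (groupM dN gN) (groupVr dN).
    have [gr gc] := in_autB _ gB; set g := r * r'^-1 in gr gc *; clearbody g.
    have dVr : pullback d^-1 kr = kc by rewrite -dc pullbackK.
    have dVc : pullback d^-1 kc = kr by rewrite -dr pullbackK.
    by apply/in_autB; rewrite !pullbackM dVr dVc gr gc.
  by move: h; rewrite -!actM !mulgA !mulgKV.
have ax b : b \in 'N(P) -> based (act b S) -> axis_ok c (act b S).
  move=> bN /andP[br bc] Y c' [g /setIP[gB gN] h]; have [gr gc] := in_autB _ gB.
  suff [b' b'N [-> bb']] : exists2 b', b' \in 'N(P) & Y = act b' S /\ based (act b' S) by move=> sc'; apply: can bb' sc sc'.
  case: h => [->|[k [r [kS n1 n2 [rN rr rk] ->]]]].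
    exists (g * b); first exact: groupM.
    by rewrite actM; split=> //; rewrite /based (mem_act_eq _ gr) (mem_act_eq _ gc) br.
  exists (g * (r * b)); first by rewrite !groupM.
  rewrite !actM; split=> //; rewrite /based (mem_act_eq _ gr) (mem_act_eq _ gc).
  by rewrite (mem_act_eq _ rr) (mem_act_eq _ rk) br.
have -> : axisS D tr c Q by apply/H1; have := ax 1; rewrite act1 group1; apply.
have -> : axisS D tr c (delta D tr Q) by apply/H2/ax => //; apply: bd.
rewrite allbE; apply/allP=> R /rhoP[k [r [kS n1 n2 rho fr]]]; have [f' b' P'] := aR k r kS rho.
apply/(axd _ _ f' b' P' fr); rewrite -actM; apply: ax; last by rewrite actM; apply: bd.
by rewrite groupM //; case: rho.
Qed.

Lemma vcode_eq v v' k : vrepr v k -> vrepr v' k -> v = v'.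
Proof.
case=> _ e1 c1 [_ e2 c2]; have [en eM] := vcode_uniq okk okr c1 c2.
by rewrite (surjective_pairing v) (surjective_pairing v') e1 e2 en eM.
Qed.

Lemma le1E s f x u : size x.1.2 = 11 -> le1 (mkp s) f x (mkM u) = les (mkp s ++ f) (code (ximg x (mkM u))).
Proof.
move=> sx; rewrite /le1 /les -[code _]/(x.1.2 ++ flatten (relab x.2 (pull x.1.1 (mkM u)))).
by rewrite cmps_cat ?size_mkp //; case: cmps.
Qed.

Lemma frepr1 v S : frepr [:: v] S -> exists k, [/\ vrepr v k, k \in S, k != kr & k != kc].
Proof.
case=> -[|x [|? ?]] [] // [ev] vz uz Sz; exists x.2; split; first by rewrite ev; apply: vz; rewrite inE.
- by rewrite Sz !inE eqxx !orbT.
- by apply: contraTneq uz => e; rewrite !cons_uniq !inE e eqxx orbT.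
by apply: contraTneq uz => e; rewrite !cons_uniq !inE e eqxx andbF.
Qed.

Lemma codes1 c : codes [:: c] = code c. Proof. by rewrite /codes /= cats0. Qed.

Lemma allb_nth (T : Type) (x0 : T) (f : T -> bool) l n : size l = n -> allb f l = allb (fun j => f (nth x0 l j)) (iota 0 n).
Proof. by move=> <-; rewrite !allbE -[X in all f X](mkseq_nth x0) all_map. Qed.

(** With a single further kernel, exchanging it with the columns inverts the row permutation; this
    is why the second list of an [entry] serves for [rhos]. *)
Lemma axis_axisS s f v S : framed S -> based S -> P \subset aut S -> frepr [:: v] S ->
  axis (mkp s) f v.1 v.2 = axisS D tr (mkp s ++ f) [:: v].
Proof.
move=> fS bS PS fv; have [k [vk kS n1 n2]] := frepr1 fv; have [[bk1 bk2 fk] ev [s1 [u [[es eM] sr H ek]]]] := vk.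
have [s' [es' ns ns' _]] := repsP okr sr; rewrite -(mkp_permI es') in ns ns'.
have sz : size (map (img_of D (mkp s1)) (nreps D)) = size (nreps D) by rewrite size_map.
have sz' : size (map (img_of D (invp (mkp s1))) (nreps D)) = size (nreps D) by rewrite size_map.
have [r [rho tE hr ur]] := rtab_spec ns' H ek fk; have [rN rr rk] := rho.
have bS' := based_rho bS kS rho; have fS' := framed_act (b := r) fS.
have ek' : kerf (colF \o r) = pullback r kc by rewrite -pullback_ker.
have cS' : pullback r kc \in act r S by rewrite mem_act; case/andP: bS.
have ner : pullback r kc != kr by rewrite (pullback_eq _ rr) eq_sym (bpk_neq bpk_base).
have nec : pullback r kc != kc by rewrite (pullback_eq _ rk) eq_sym.
have b1 : bpk kr (pullback r kc) by apply: fS'; rewrite // 1?eq_sym //; case/andP: bS'.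
have fk' : fixedK (pullback r kc) by apply: (fixedK_stab oke (act r S)).2; rewrite ?aut_act_norm.
have [c vc en] := normE okk okf okr nslE conjP ek' b1 fk'.
have Hr : rsys s1^-1 (colF \o r).
  by have := @rsys_comp 1 colF r s1; rewrite mul1g; apply=> // i j; rewrite hits_base invg1 perm1.
pose x0 : rimage := ([::], [::], [::]).
have part s2 u2 w k2 : normS D s2 -> rsys s2 u2 -> kerf u2 = k2 -> vrepr w k2 -> 
    allb (fun x => le1 (mkp s) f x (mkM u2)) (map (img_of D (mkp s2)) (nreps D)) =
    allb (fun j => les (mkp s ++ f) (codes (map (gimage j) [:: w]))) (iota 0 (size (nreps D))).
  move=> ns2 H2 ek2 [_ ew [s3 [u3 [[es3 eM3] sr3 H3 ek3]]]].
  have [s4 [es4 ns3 _ _]] := repsP okr sr3; rewrite -(mkp_permI es4) in ns3.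
  rewrite (@allb_nth _ x0 _ _ (size (nreps D))) ?size_map // !allbE; apply: eq_in_all => j.
  rewrite mem_iota add0n => /andP[_ jn]; rewrite codes1 (nth_map [::]) //.
  have [b [sb [bN eb _ _ _]]] := nrepsP oke okn (mem_nth [::] jn).
  have v2 := img_of_spec okf okr nslE ns2 H2 bN eb; have v3 := img_of_spec okf okr nslE ns3 H3 bN eb.
  rewrite ek2 in v2; rewrite ek3 in v3; have e23 := vcode_uniq okk okr v2 v3.
  rewrite le1E; last by case: v2 => sv [uv [ev2 _ _ _]]; rewrite -[size _]/(size (ximg _ (mkM u2)).1) ev2 size_mkp.
  rewrite e23 -es3 -eM3; congr (les _ (code _)).
  by rewrite /gimage ew [(mke D _).2.1]/= (nth_map [::]).
have vk' : vrepr (norm D tr (mkM (colF \o r))) (pullback r kc).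
  by rewrite en; split=> //; [split=> //; apply: fS'; rewrite // 1?eq_sym //; case/andP: bS' | case: (c) vc].
rewrite /axis /axisS ev -[rhos D tr [::] [:: v]]/[:: [:: norm D tr (pull (rtab v.1.1 v.2) Brow)]].
rewrite es eM Brow_mk tE pull_mk [(mke D _).2.1]/= [(mke D _).2.2]/= (part _ _ _ _ ns H ek vk).
rewrite -[allb _ [:: [:: v]; _]]/(if _ then if _ then true else false else false).
case: (allb _ _) => //; rewrite invp_mk (part _ _ _ _ ns' Hr ek' vk').
by case: (allb _ _).
Qed.

End Type_.
End CanonicalFrames.
Import CanonicalFrames.

(** * The shortened test for frames of three kernels *)

Module CanonicalVertices.
Import GroupScope.

Lemma lesE s t : les s t = if cmps s t is Gt then false else true. Proof. by []. Qed.

Lemma mins_le s l : les (mins s l) s /\ forall x, x \in l -> les (mins s l) x.1.2.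
Proof.
elim: l s => [|y l IH] s /=; first by rewrite les_refl.
have [h1 h2] := IH (if les s y.1.2 then s else y.1.2).
have [l1 l2] : les (if les s y.1.2 then s else y.1.2) s /\ les (if les s y.1.2 then s else y.1.2) y.1.2.
  by have := les_total s y.1.2; case: ifP => [h _|_ /= h]; rewrite ?les_refl.
split; first exact: les_trans h1 l1.
by move=> x; rewrite inE => /orP[/eqP ->|/h2 //]; apply: les_trans h1 l2.
Qed.

Lemma mins_mem s l : mins s l = s \/ exists2 x, x \in l & mins s l = x.1.2.
Proof.
elim: l s => [|y l IH] s /=; first by left.
have [->|[x xl ->]] := IH (if les s y.1.2 then s else y.1.2).
  by case: ifP => _; [left|right; exists y; rewrite ?inE ?eqxx].
by right; exists x; rewrite ?inE ?xl ?orbT.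
Qed.

Lemma cmin_le e x : e.2.1 != [::] -> x \in e.2.1 ++ e.2.2 -> les (cmin e) x.1.2.
Proof.
rewrite /cmin mem_cat; case: (e.2.1) => [|y l] // _.
have [h1 h2] := mins_le y.1.2 (y :: l); have [h3 h4] := mins_le (mins y.1.2 (y :: l)) e.2.2.
by case/orP=> [/h2 h|/h4 //]; apply: les_trans h3 h.
Qed.

Lemma cmin_mem e : e.2.1 != [::] -> exists2 x, x \in e.2.1 ++ e.2.2 & cmin e = x.1.2.
Proof.
rewrite /cmin; case: (e.2.1) => [|y l] // _.
have [->|[x xl ->]] := mins_mem (mins y.1.2 (y :: l)) e.2.2; last by exists x; rewrite // mem_cat xl orbT.
have [->|[x xl ->]] := mins_mem y.1.2 (y :: l); first by exists y; rewrite ?inE ?eqxx.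
by exists x; rewrite // mem_cat xl.
Qed.

Lemma cmps_Lt s t : cmps s t = Lt <-> les s t /\ s <> t.
Proof.
rewrite /les; have := cmps_Eq s t; case: (cmps s t) => h; split=> //; try by case.
  by case=> _; have := elimT h isT.
by move=> _; split=> // e; have := introT h e.
Qed.

Lemma cmps_Lt_trans s t r : cmps s t = Lt -> les t r -> cmps s r = Lt.
Proof.
move=> /cmps_Lt[lst nst] tr; apply/cmps_Lt; split; first exact: les_trans lst tr.
by move=> e; rewrite -e in tr; apply: nst; apply/les_anti; rewrite lst tr.
Qed.

(* The first components already decide the comparison unless the minimum is attained. *)
Lemma axis_Lt n f e M : cmps n (cmin e) = Lt -> e.2.1 != [::] -> axis n f e M.
Proof.
move=> h ne; have H x M' : x \in e.2.1 ++ e.2.2 -> le1 n f x M'.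
  by move=> xe; rewrite /le1 (cmps_Lt_trans h (cmin_le ne xe)).
rewrite /axis allbE (_ : all _ _ = true); last by apply/allP=> x xe; apply: H; rewrite mem_cat xe.
by rewrite allbE; apply/allP=> x xe; apply: H; rewrite mem_cat xe orbT.
Qed.

Lemma axis_Gt n f e M : cmps n (cmin e) = Gt -> e.2.1 != [::] -> axis n f e M = false.
Proof.
move=> h /cmin_mem[x + ex]; rewrite ex in h; rewrite mem_cat => xe; apply/negP; rewrite /axis !allbE.
have H M' : le1 n f x M' = false by rewrite /le1 h.
case: ifP => // /allP a1 /allP a2; case/orP: xe => xe; first by have := a1 x xe; rewrite H.
by have := a2 x xe; rewrite H.
Qed.

Lemma axis_pre n f e M : axis n f e M -> n = e.1 -> pre e.
Proof.
rewrite /axis /pre !allbE => + en; case: ifP => // /allP a1 /allP a2.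
have H x M' : le1 n f x M' -> les e.1 x.1.2 by rewrite -en /le1 /les; case: cmps.
rewrite (_ : all _ _ = true); last by apply/allP=> x /a1/H.
by apply/allP=> x /a2/H.
Qed.

Lemma axis_skip n f e M q : e.2.1 != [::] -> q = cmps n (cmin e) -> q <> Gt ->
  axis n f e M = if q is Eq then axis n f e M else true.
Proof. by move=> ne ->; case h: (cmps n _) => // _; rewrite axis_Lt. Qed.

Lemma axis_cmp n f e M : e.2.1 != [::] ->
  axis n f e M = match cmps n (cmin e) with Gt => false | Eq => axis n f e M | Lt => true end.
Proof. by move=> ne; case h: (cmps n _) => //; [rewrite axis_Lt | rewrite axis_Gt]. Qed.

Lemma quick_test (a b b' c : bool) r3 : b = b' -> c = match r3 with Gt => false | Eq => c | Lt => true end ->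
  (if r3 is Gt then false else if a then if b' then if r3 is Eq then c else true else false else false) = [&& a, b & c].
Proof. by move=> ->; case: r3 a b' c => [] [] [] []. Qed.

Lemma canonS1 D tr v c : codes [:: (v.1.1, v.2)] = c -> canonS D tr [:: v] =
  [&& axisS D tr c [:: v], axisS D tr c [:: norm D tr (pull (dtab D) v.2)] &
      axisS D tr c [:: norm D tr (pull (dtab D) (norm D tr (pull (rtab v.1.1 v.2) Brow)).2)]].
Proof.
move=> <-; have E (a1 a2 a3 : bool) : (if a1 then if a2 then (if a3 then true else false) else false else false) = [&& a1, a2 & a3].
  by case: a1 a2 a3 => [] [] [].
exact: E.
Qed.

Section Type_.
Variable D : gdata.
Let tr := mktrie D.
Implicit Types (s t : 'S_11) (b r g d : {perm flagT}) (S Z : {set kernel}).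
Hypotheses (okk : ok_keys D) (oke : ok_elts D) (okn : ok_nreps D) (okf : ok_find D) (okr : ok_reps D) (okd : ok_delta D).
Hypothesis nslE : nsl D = normrows (gens D) (elts D).
Let P := P oke.
Hypothesis conjP : forall Q : {group {perm flagT}}, Q \subset autB -> #|Q| = #|P| ->
  exists2 a, a \in autB & Q :^ a = P.
Notation frepr := (frepr oke).
Notation vrepr := (vrepr oke).

Lemma nreps_nil n : (mke D n).2.1 != [::].
Proof.
have [|g [b [gr _ _ _]]] := nreps_cover (oke := oke) okn nslE (b := 1); first exact: group1.
by rewrite /=; case: (nreps D) gr.
Qed.

Lemma norm_eq k u u' : kerf u = k -> kerf u' = k -> bpk kr k -> fixedK oke k -> norm D tr (mkM u) = norm D tr (mkM u').
Proof.
move=> e e' b f; have [c vc ->] := normE okk okf okr nslE conjP e b f; have [c' vc' ->] := normE okk okf okr nslE conjP e' b f.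
by rewrite (vcode_uniq okk okr vc vc').
Qed.

(** The second and third axes matter only when their least row permutation ties with that of [v], by
    [axis_skip] and [axis_cmp]. *)
Lemma canon1E v S q2 e2 lam (cs : mat) : framed S -> based S -> P \subset aut S -> frepr [:: v] S ->
    norm D tr (pull (dtab D) v.2) = (e2, relab lam (pull (dtab D) v.2)) -> q2 = cmps v.1.1 (cmin e2) -> q2 <> Gt ->
    look D tr (drows D cs) = (norm D tr (pull (dtab D) (pull (rtab v.1.1 v.2) Brow))).1 ->
  canon1 D tr v.1 q2 e2 lam cs v.2 = canonS D tr [:: v].
Proof.
move=> fS bS PS fv H2 eq2 nq2 H3.
have [d [ci [di [[dN dr dc] dE _ _]]]] := dtab_spec oke okd.
have bd Z : based Z -> based (act d Z).
  by case/andP=> rZ cZ; rewrite /based (mem_act_eq _ dr) (mem_act_eq _ dc) rZ cZ.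
have fd : frepr [:: norm D tr (pull (dtab D) v.2)] (act d S) := delta_spec okk okf okr nslE conjP fS bS PS fv dN dr dc dE.
have [z [ev0 vz uz Sz]] := fv; case: z ev0 vz uz Sz => [|x [|? ?]] // [ev] vz uz Sz.
have vx : vrepr v x.2 by rewrite ev; apply: vz; rewrite inE.
have xS : x.2 \in S by rewrite Sz !inE eqxx !orbT.
have n2 : kc != x.2 by apply: contraTneq uz => e; rewrite !cons_uniq !inE e eqxx andbF.
have [r [rho tE] fr0] := @rho1_spec D okk oke okf okr nslE conjP S [::] [::] x fS bS PS vz uz Sz.
rewrite -ev in tE; pose w1 := norm D tr (pull (rtab v.1.1 v.2) Brow).
have fr : frepr [:: w1] (act r S) by rewrite /w1 ev; exact: fr0.
have [rN rr rk] := rho; have bS' := based_rho bS xS rho.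
have fS' := framed_act (b := r) fS; have PS' := aut_act_norm rN PS.
have frd : frepr [:: norm D tr (pull (dtab D) w1.2)] (act d (act r S)) :=
  delta_spec okk okf okr nslE conjP fS' bS' PS' fr dN dr dc dE.
have A1 f s := axis_axisS okk okn okf okr nslE conjP s f fS bS PS fv.
have A2 f s := axis_axisS okk okn okf okr nslE conjP s f (framed_act fS) (bd _ bS) (aut_act_norm dN PS) fd.
have A3 f s := axis_axisS okk okn okf okr nslE conjP s f (framed_act fS') (bd _ bS') (aut_act_norm dN PS') frd.
have M1 : pull (rtab v.1.1 v.2) Brow = mkM (colF \o r) by rewrite tE Brow_mk pull_mk.
have k1 : kerf (colF \o r) = pullback r kc by rewrite -pullback_ker.
have k1S : pullback r kc \in act r S by rewrite mem_act; case/andP: bS.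
have k1r : kr != pullback r kc by rewrite eq_sym (pullback_eq _ rr) eq_sym (bpk_neq bpk_base).
have k1c : kc != pullback r kc by rewrite eq_sym (pullback_eq _ rk).
have fx' : forall k, k \in act r S -> fixedK oke k by apply/fixedK_stab.
have b1 : bpk kr (pullback r kc) by case/andP: bS' => ? _; apply: fS'.
have b1c : bpk kc (pullback r kc) by case/andP: bS' => _ ?; apply: fS'.
have [c1 [s1 [u1 [ec1 _ _ ku1]]] ew1] := normE okk okf okr nslE conjP k1 b1 (fx' _ k1S).
have w12 : w1.2 = mkM u1 by rewrite /w1 M1 ew1 ec1.
(* [canon1] does not normalise the intermediate labelling; the final normal form depends only on the
   kernel, so the result is the same. *)
have eM3 : norm D tr (pull (dtab D) w1.2) = norm D tr (pull (dtab D) (mkM (colF \o r))).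
  rewrite w12 dE !pull_mk; apply: (@norm_eq (pullback d (pullback r kc))).
  - by rewrite -pullback_ker ku1.
  - by rewrite -pullback_ker k1.
  - by rewrite -dc; apply: bpk_pullback.
  - by apply: fixedK_norm => //; apply: fx'.
have [s [u [[es eM] sr H ek]]] : vcode D (v.1.1, v.2) x.2 by case: vx.
have cE : codes [:: (v.1.1, v.2)] = mkp s ++ flatten v.2 by rewrite codes1 -es.
have B1 := A1 (flatten v.2) s; have B2 := A2 (flatten v.2) s; have B3 := A3 (flatten v.2) s.
have CS := canonS1 D tr cE.
have {CS}CS := etrans CS (esym (f_equal3 (fun x1 x2 x3 : bool => [&& x1, x2 & x3]) B1 B2 B3)).
rewrite eM3 H2 in CS; rewrite {}CS.
rewrite /canon1 H3 M1 -es; set M3 := pull (dtab D) (mkM _); set f := flatten _.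
have ne2 : e2.2.1 != [::].
  have [k2 [[_ e _] _ _ _]] := frepr1 fd; rewrite H2 /= in e; rewrite e; exact: nreps_nil.
set e3 := (norm D tr M3).1; have ne3 : e3.2.1 != [::].
  have [k3 [[_ e _] _ _ _]] := frepr1 frd; rewrite eM3 -/M3 -/e3 in e; rewrite e; exact: nreps_nil.
have -> : (norm D tr M3).2 = relab (relabmap e3.1 M3) M3 by [].
rewrite [(_, _).1]/= [(_, _).2]/=.
exact: (quick_test (axis v.1.1 f v.1 v.2) (axis_skip f _ ne2 eq2 nq2) (axis_cmp v.1.1 f _ ne3)).
Qed.
End Type_.
End CanonicalVertices.
Import CanonicalVertices.

(** * Label classes as lists of cells, and the depth-first search *)

Module Cells.
Import GroupScope.

(** Values sit only at depth [n], so keys of this common length are inserted and looked up without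
    interfering. *)
Fixpoint depth A n (t : trie A) {struct t} := match t with
  | Leaf None => true | Leaf (Some _) => n == 0
  | Node u v => if n is n'.+1 then depth n' u && depth n' v else false end.

Lemma tfind_update A (f : option A -> A) k k' t : depth (size k) t -> size k' = size k ->
  depth (size k) (update f k t) /\ tfind k' (update f k t) = if k' == k then Some (f (tfind k t)) else tfind k' t.
Proof.
elim: k k' t => [|b k IH] [|b' k'] [[x|]|u v] //=.
  move=> _ [sk]; have [d1 e1] := IH k' (Leaf None) isT sk; rewrite eqseq_cons.
  have L o q : tfind q (Leaf o) = o :> option A by case: q.
  by rewrite !L in e1; case: b; case: b'; rewrite /= ?d1 ?e1 ?L.
case/andP=> du dv [sk]; have [d1 e1] := IH k' u du sk; have [d2 e2] := IH k' v dv sk; rewrite eqseq_cons.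
by case: b; case: b' => /=; rewrite ?d1 ?e1 ?d2 ?e2 ?du ?dv.
Qed.

Lemma group_optionsP N (l : seq (seq (seq nat))) o : (forall o, o \in l -> size (colpat (head [::] o)) = N) -> o \in l ->
  exists2 l', tfind (colpat (head [::] o)) (group_options l) = Some l' & o \in l'.
Proof.
move=> szl; have [d _] : depth N (group_options l) /\ true.
  elim: l szl => // x l IH szl; split=> //; have [d _] := IH (fun o ol => szl o (mem_behead (s := x :: l) ol)).
  by have sx := szl x (mem_head _ _); rewrite -sx in d *; apply: (tfind_update _ d erefl).1.
elim: l szl d => //= x l IH szl d; rewrite inE => ox.
have sl o' (ol : o' \in l) := szl o' (mem_behead (s := x :: l) ol); have sx := szl x (mem_head _ _).
have dl : depth N (group_options l).
  elim: (l) sl => //= y l' IHl sl; have d' := IHl (fun o ol => sl o (mem_behead (s := y :: l') ol)).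
  by have sy := sl y (mem_head _ _); rewrite -sy in d' *; apply: (tfind_update _ d' erefl).1.
have so : size (colpat (head [::] o)) = N by apply: szl; rewrite inE.
rewrite -sx in dl; rewrite (tfind_update _ dl (etrans so (esym sx))).2.
case/orP: ox => [/eqP ->|ol]; first by rewrite eqxx; eexists; [reflexivity | rewrite inE eqxx].
rewrite sx in dl; have [l' e ol'] := IH sl dl ol; case: eqP => [<-|_]; last by exists l'.
by rewrite e /=; eexists; [reflexivity | rewrite inE ol' orbT].
Qed.

Lemma meet2_map (f g : nat -> nat) r k : (forall j, j \in r -> f j != 0 -> g j != 0 -> f j != g j) ->
  count (fun j => (f j != 0) && (g j != 0)) r = k -> meet2 k (map f r) (map g r).
Proof.
elim: r k => [|j r IH] k H /=; first by move=> <-.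
have Hr i (ir : i \in r) := H i (mem_behead (s := j :: r) ir); have Hj := H j (mem_head _ _).
case: (f j) (g j) Hj => [|x] [|y] //= Hj; rewrite ?add0n; try exact: IH.
rewrite add1n => <-; rewrite eqnE; have := Hj isT isT; rewrite eqSS => /negbTE ->; exact: IH.
Qed.

Lemma cputE c j i : j < size c -> nth 0 c j = 0 -> cput c j i = Some (set_nth 0 c j i.+1).
Proof. by elim: c j => [|x c IH] [|j] //= jc; [move=> -> | move=> h; rewrite IH]. Qed.

(** The filtering of later lists never removes an element of [os], because these are pairwise
    compatible. *)
Lemma dfs_complete m (ls : seq (seq nat * seq (seq (seq nat)))) os acc : size ls < m -> size os = size ls ->
    (forall i, i < size ls -> nth [::] os i \in (nth ([::], [::]) ls i).2) ->
    pairwise compat os ->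
  foldl (fun acc x => zip x.1 x.2 ++ acc) acc (zip (map fst ls) os) \in dfs m ls acc.
Proof.
elim: m ls os acc => [|m IH] [|[ss l] ls] [|o os] acc //=; first by rewrite inE.
move=> lm [so] H.
case/andP=> co cos; apply/flattenP.
exists (dfs m [seq (x.1, [seq o' <- x.2 | compat o o']) | x <- ls] (zip ss o ++ acc)).
  by apply/mapP; exists o => //; apply: (H 0).
have -> : map fst ls = map fst [seq (x.1, [seq o' <- x.2 | compat o o']) | x <- ls] by rewrite -map_comp.
apply: IH; rewrite ?size_map // => i il; rewrite (nth_map ([::], [::])) //= mem_filter (H i.+1 il) andbT.
by apply: (allP co); rewrite mem_nth // so.
Qed.

Lemma foldl_cat (T U : Type) (f : T -> seq U) acc l : foldl (fun acc x => f x ++ acc) acc l = flatten (rev (map f l)) ++ acc.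
Proof.
elim: l acc => //= x l IH acc; rewrite IH rev_cons -cats1 flatten_cat /= cats0.
by rewrite catA.
Qed.

Lemma assocE (F : nat -> seq nat) o s : (forall x, x \in o -> x.2 = F x.1) -> s \in map fst o -> assoc s o = F s.
Proof.
elim: o => //= x o IH H; rewrite inE eqnE; case: eqP => [-> _|_]; first by apply: H; rewrite mem_head.
by apply: IH => y yo; apply: H; rewrite inE yo orbT.
Qed.

Section Cells.
Variable u : flagT -> I11.
Hypothesis bcu : biplane colF u.
Definition tc (l j : I11) : nat := if [pick m | (colF m == j) && (u m == l)] is Some m then (rowF m).+1 else 0.
Definition tcell (l : I11) := [seq tc l (inord j) | j <- rng].

Lemma tc_flag m : tc (u m) (colF m) = (rowF m).+1.
Proof.
rewrite /tc; case: pickP => [m' /andP[/eqP ec /eqP eu]|/(_ m)]; last by rewrite !eqxx.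
by rewrite (biplane_inj bcu ec eu).
Qed.

Lemma tcP l j : (exists m, [/\ colF m = j, u m = l & tc l j = (rowF m).+1]) \/ (tc l j = 0 /\ ~~ hits u colF l j).
Proof.
case h: (hits u colF l j); last first.
  right; split=> //; rewrite /tc; case: pickP => // m /andP[/eqP ec /eqP eu].
  by have /negP[] := negbT h; apply/hitsP; exists m.
by have /hitsP[m eu ec] := h; left; exists m; rewrite -eu -ec tc_flag.
Qed.

Lemma tc_neq0 l j : (tc l j != 0) = hits u colF l j.
Proof.
have [[m [<- <- ->]]|[-> /negbTE ->]] := tcP l j; last by [].
by apply/esym/hitsP; exists m.
Qed.

Lemma nth_tcell l (j : I11) : nth 0 (tcell l) j = tc l j.
Proof. by rewrite /tcell nth_map_rng // inord_val. Qed.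

(** Labels and columns also form a biplane with their roles exchanged, which gives two common
    columns; the cells there differ since a flag has only one label. *)
Lemma meet_tcell l l' : l != l' -> meet2 2 (tcell l) (tcell l').
Proof.
move=> ll; apply: meet2_map => [j _|].
  have [[m [ec eu ->]]|[-> _]] := tcP l (inord j) => //; have [[m' [ec' eu' ->]]|[-> _]] := tcP l' (inord j) => //.
  move=> _ _; rewrite eqSS; apply: contraNneq ll => /val_inj er.
  by rewrite -eu -eu' (flag_inj er) // ec.
have h := biplane_card l l' (biplane_sym bcu); rewrite (negbTE ll) in h.
apply: etrans (etrans (esym (card_incn _)) _) h.
by apply: eq_card => j; rewrite !inE inord_val !tc_neq0.
Qed.

Hypothesis bru : biplane rowF u.

(** A stage of the recursion in [cells]: the part of the class of [l] in the rows placed so far. *)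
Definition pcell (l : I11) (Q : pred nat) := [seq if tc l (inord j) is i.+1 then if Q i then i.+1 else 0 else 0 | j <- rng].

Lemma cells_complete l rows (Q : pred nat) : uniq rows -> (forall i, i \in rows -> ~~ Q i) ->
    (forall i, i \in rows -> exists2 m, nat_of_ord (rowF m) = i & u m = l) ->
  pcell l (fun i => Q i || (i \in rows)) \in cells rows (pcell l Q).
Proof.
elim: rows Q => [|i rows IH] Q.
  move=> _ _ _; rewrite inE; apply/eqP; apply: eq_map_rng => j; case: (tc _ _) => // i; by rewrite orbF.
rewrite cons_uniq => /andP[ni ur] HQ Hm; have [m em eu] := Hm i (mem_head _ _).
rewrite [cells _ _]/(flatten [seq if cput (pcell l Q) j i is Some d then cells rows d else [::] | j <- brow i]).
apply/flattenP; exists (cells rows (pcell l (fun x => Q x || (x == i)))); last first.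
  have := IH (fun x => Q x || (x == i)) ur; rewrite (_ : pcell l _ = pcell l (fun x => Q x || (x \in i :: rows))).
    apply=> [x xr|x xr]; last by apply: Hm; rewrite inE xr orbT.
    rewrite negb_or HQ ?inE ?xr ?orbT //; by apply: contraNneq ni => <-.
  by apply: eq_map_rng => j; case: (tc _ _) => // x; rewrite inE orbA.
apply/mapP; exists (nat_of_ord (colF m)); first by rewrite -em mem_brow incn_flag.
have tm : tc l (colF m) = i.+1 by rewrite -eu tc_flag em.
rewrite cputE; first last.
- by rewrite /pcell nth_map_rng // inord_val tm (negbTE (HQ i (mem_head _ _))).
- by rewrite size_map.
congr cells; apply: (@eq_from_nth _ 0) => [|j].
  by rewrite size_set_nth !size_map size_rng (maxn_idPr _).
rewrite size_map size_rng => j11; rewrite nth_set_nth /= /pcell !nth_map_rng //.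
case: eqP => [->|/eqP nj]; first by rewrite inord_val tm eqxx orbT.
have [[m' [ec' eu' ->]]|[-> _]] := tcP l (inord j) => //.
rewrite orbC; case: eqP => // ei; case/negP: nj.
have e : m' = m by apply: (biplane_inj bru); [apply: val_inj; rewrite /= ei em | rewrite eu' eu].
by rewrite -(inordK j11) -ec' e.
Qed.

Lemma cells_tcell l rows : uniq rows -> (forall m, u m = l <-> nat_of_ord (rowF m) \in rows /\ u m = l) ->
    (forall i, i \in rows -> exists2 m, nat_of_ord (rowF m) = i & u m = l) ->
  tcell l \in cells rows (nseq 11 0).
Proof.
move=> ur H1 H2; have := @cells_complete l rows pred0 ur (fun _ _ => isT) H2.
rewrite (_ : pcell l pred0 = nseq 11 0); last first.
  apply: (@eq_from_nth _ 0) => [|j]; rewrite ?size_map // size_rng => j11.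
  by rewrite /pcell nth_map_rng // nth_nseq j11; case: (tc _ _).
rewrite (_ : pcell l _ = tcell l) //; apply: eq_map_rng => j.
have [[m [ec eu ->]]|[-> _]] := tcP l (inord j) => //=.
by have [-> _] := (H1 m).1 eu.
Qed.
End Cells.
End Cells.
Import Cells.

(** * Completeness of the search for one labelling *)

Module CellSearch.
Import GroupScope.

Definition tcs u := [seq tcell u (inord l) | l <- rng].

Lemma eqpat_map (f : nat -> bool) (g : nat -> nat) r : eqpat (map f r) (map g r) = all (fun j => f j == (g j != 0)) r.
Proof. by elim: r => //= j r ->; case: (g j) => [|x]; case: (f j). Qed.

Lemma nth_tcs u (l : I11) : nth [::] (tcs u) l = tcell u l.
Proof. by rewrite /tcs nth_map_rng // inord_val. Qed.

Lemma nth_zipcons (c : seq nat) t j : j < size c -> size c = size t -> nth [::] (zipcons c t) j = nth 0 c j :: nth [::] t j /\ size (zipcons c t) = size c.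
Proof.
elim: c t j => [|x c IH] [|y t] [|j] //= jc [e]; split=> //; case: c t e IH jc => [|a c] [|b t] // e IH jc.
- by have [_ ->] := IH (b :: t) 0 isT e.
- by have [-> _] := IH (b :: t) j jc e.
- by have [_ ->] := IH (b :: t) j jc e.
Qed.

Lemma transpE (cs : mat) j : (forall c, c \in cs -> size c = 11) -> j < 11 ->
  nth [::] (transp cs) j = [seq nth 0 c j | c <- cs] /\ size (transp cs) = 11.
Proof.
move=> H j11; elim: cs H => [|c cs IH] H; first by rewrite nth_nseq j11.
have [e sz] := IH (fun c' h => H c' (mem_behead (s := c :: cs) h)); have sc := H c (mem_head _ _).
have [e1 e2] : nth [::] (zipcons c (transp cs)) j = nth 0 c j :: nth [::] (transp cs) j /\ size (zipcons c (transp cs)) = size c.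
  by apply: nth_zipcons; rewrite ?sc ?sz.
by rewrite -[transp (c :: cs)]/(zipcons c (transp cs)) e1 e2 sc e.
Qed.

Lemma index_rng (f : nat -> nat) x (l : I11) : f l = x -> (forall l' : I11, f l' = x -> l' = l) -> index x (map f rng) = l.
Proof.
move=> fl H; have xi : x \in map f rng by rewrite -fl map_f // mem_rng.
have il : index x (map f rng) < 11 by rewrite -size_rng -(size_map f) index_mem.
have := nth_index 0 xi; rewrite (nth_map 0) ?size_rng // nth_rng // => /(H (Ordinal il)) e.
by rewrite -e.
Qed.

Lemma size_tcs u c : c \in tcs u -> size c = 11.
Proof. by case/mapP=> l _ ->; rewrite size_map. Qed.

Lemma build_tcs u : biplane colF u -> build (transp (tcs u)) = mkM u.
Proof.
move=> bcu; apply: eq_map_rng => i; rewrite inord_val; apply: (@eq_from_nth _ 0) => [|p]; rewrite size_map size_brow ?size_map // => p5.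
rewrite (nth_map 0) ?size_brow // nth_map5 //; set m := (i, inord p) : flagT.
have -> : nth 0 (brow i) p = colF m by rewrite colF_val /= inordK.
rewrite (transpE (@size_tcs u) (ltn_ord _)).1 pos_inE.
have -> : [seq nth 0 c (colF m) | c <- tcs u] = [seq tc u (inord l) (colF m) | l <- rng].
  by apply: etrans (esym (map_comp _ _ _)) _; apply: eq_map_rng => l; rewrite /= nth_tcell.
apply: index_rng => [|l]; rewrite inord_val; first exact: (tc_flag bcu m).
have [[m' [ec <- ->]]|[-> _]] := tcP bcu l (colF m) => // -[er].
by congr u; apply: flag_inj => //; apply: val_inj.
Qed.

Lemma searchE ct ps n : n = 12 -> search ct ps =
  dfs n [seq (x.1, flatten [seq if tfind p x.2 is Some l then l else [::] | p <- ps]) | x <- ct] [::].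
Proof. by move=> ->. Qed.

Lemma size_cimg x c : size (cimg x c) = 11. Proof. exact: size_map. Qed.

Lemma size_option A rows o : A != [::] -> o \in options A rows -> size (colpat (head [::] o)) = 11.
Proof.
case: A => // x A _ /mapP[c _ ->]; exact: etrans (size_map _ (cimg x c)) (size_cimg x c).
Qed.

Section Type_.
Variable D : gdata.
Let tr := mktrie D.
Implicit Types (s : 'S_11) (b r g d : {perm flagT}) (S Z : {set kernel}).
Definition ok_labels := all (fun n => let os := [seq [seq ap x l | x <- labacts D n] | l <- ordreps D n] in
  [&& size os < 12, all (fun l => l < 11) (ordreps D n), all (fun x => x \in flatten os) rng &
      pairwise (fun o o' => all (fun x => x \notin o') o) os]) (reps D).
Hypotheses (okk : ok_keys D) (oke : ok_elts D) (okn : ok_nreps D) (okf : ok_find D) (okr : ok_reps D) (okd : ok_delta D).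
Hypotheses (okl : ok_labels) (okg : ok_gens D).
Hypothesis nslE : nsl D = normrows (gens D) (elts D).
Let P := P oke.
Hypothesis conjP : forall Q : {group {perm flagT}}, Q \subset autB -> #|Q| = #|P| ->
  exists2 a, a \in autB & Q :^ a = P.
Notation frepr := (frepr oke).
Notation vrepr := (vrepr oke).

Section Labels.
Variables (s : 'S_11) (u : flagT -> I11).
Hypotheses (Hs : rsys s u) (bcu : biplane colF u).

(** A symmetry of the kernel permutes the labels. Seen through the row system this is an
    automorphism of the base biplane, which is why [labact] can compute it by [autcol]. *)
Lemma label_action b s' t' : acts_by b s' t' -> pullback b (kerf u) = kerf u ->
  exists l : 'S_11, (forall m, u (b m) = l (u m)) /\ aut_by (s * s' * s^-1) l.
Proof.
move=> B; rewrite pullback_ker => e; have [l hl] := ker_eq_perm (rsys_surj Hs) (esym e).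
exists l; split=> // i j; rewrite !permM -Hs -[in RHS](permK s i) -Hs.
apply/hitsP/hitsP=> -[m]; last by move=> em <-; exists (b m); [case: (B m) => ->; rewrite em | rewrite -hl].
move=> em eu; exists (b^-1 m).
  by apply: (@perm_inj _ s'); have [<- _] := B (b^-1 m); rewrite permKV.
by apply: (@perm_inj _ l); rewrite -hl /= permKV.
Qed.

Lemma cimg_tcell b s' (t' l : 'S_11) i : acts_by b s' t' -> (forall m, u (b m) = l (u m)) ->
  cimg (mkp s', invp (mkp t')) (tcell u i) = tcell u (l i).
Proof.
move=> B hl; rewrite /cimg invp_mk; apply: eq_map_rng => j; rewrite [_.2]/= [_.1]/= inord_val ap_mkp nth_tcell.
have [[m [ec eu ->]]|[-> nh]] := tcP bcu i (t'^-1 j).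
  have [er ec'] := B m; rewrite ap_mkp -er -(tc_flag bcu (b m)) hl eu; congr tc.
  by rewrite ec' ec permKV.
have [[m [ec eu _]]|[-> _]] := tcP bcu (l i) j => //; case/negP: nh; apply/hitsP; exists (b^-1 m).
  by apply: (@perm_inj _ l); rewrite -hl permKV.
by apply: (@perm_inj _ t'); have [_ <-] := B (b^-1 m); rewrite !permKV.
Qed.

Lemma meetE (a b : nat) : a < 11 -> b < 11 -> a != b -> meet2 2 (tcell u (inord a)) (tcell u (inord b)).
Proof.
move=> a11 b11 ab; apply: meet_tcell => //; apply: contraNneq ab => /(congr1 val); rewrite /= !inordK // => ->; exact: eqxx.
Qed.

Hypothesis fixed : forall b, b \in P -> pullback b (kerf u) = kerf u.

Lemma labactE p : p \in elts D -> exists b s' t' (l : 'S_11), [/\ b \in P, p = mkp s', aut_by s' t' /\ acts_by b s' t',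
  (forall m, u (b m) = l (u m)) & labact (mkp s) p = mkp l].
Proof.
move=> pe; have [b bP eb] := elts_P oke pe; have /setIdP[bB _] := bP; have [s' [t' [H B]]] := autB_acts bB.
have [l [hl al]] := label_action B (fixed bP); exists b, s', t', l; split=> //; first by rewrite -eb (rl_acts B).
by rewrite /labact -eb (rl_acts B) invp_mk !mulp_mkM (autcol_mk al).
Qed.

Lemma option_complete (i : I11) : [seq tcell u (inord (ap x i)) | x <- labacts D (mkp s)] \in options (acts D) (blockrows (mkp s) i).
Proof.
apply/mapP; exists (tcell u i); last first.
  rewrite /labacts /acts -!map_comp; apply/eq_in_map => p pe /=.
  have [b [s' [t' [l [bP -> [H B] hl ->]]]]] := labactE pe.
  by rewrite ap_mkp inord_val (autcol_mk H) (cimg_tcell i B hl).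
have mem_rows m : (nat_of_ord (rowF m) \in blockrows (mkp s) i) = incn (s^-1 (rowF m)) i.
  apply/mapP/idP => [[x xi ex]|h]; last by exists (nat_of_ord (s^-1 (rowF m))); rewrite ?mem_bcol // ap_mkp permKV.
  have x11 := bcol_lt xi; move: ex; rewrite (ap_mkp s (Ordinal x11)) => /val_inj ->.
  by rewrite permK -mem_bcol.
rewrite mem_filter; apply/andP; split; last first.
  apply: cells_tcell => //; first exact: rsys_biplane Hs.
  - rewrite map_inj_in_uniq => [|x y xi yi].
      by rewrite /bcol nth_map_rng // filter_uniq ?iota_uniq.
    rewrite (ap_mkp s (Ordinal (bcol_lt xi))) (ap_mkp s (Ordinal (bcol_lt yi))) => /val_inj/perm_inj.
    by move/(congr1 val).
  - by move=> m; split=> [e|[] //]; split=> //; rewrite mem_rows -Hs; apply/hitsP; exists m.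
  move=> x /mapP[y yi ->]; have y11 := bcol_lt yi; rewrite (ap_mkp s (Ordinal y11)).
  have /hitsP[m er eu] : hits rowF u (s (Ordinal y11)) i by rewrite Hs permK -mem_bcol.
  by exists m; rewrite ?er.
rewrite allbE; apply/allP=> z /mapP[x0 /mapP[p pe ->] ->].
set R := blockrows (mkp s) i; set c := tcell u i; set c' := cimg (p, invp (autcol p)) c.
change (if allb (fun y => mem_nat (ap p y) R) R then eqs c c' else meet2 2 c c'); rewrite {}/c' {}/c {}/R.
have [b [s' [t' [l [bP -> [H B] hl _]]]]] := labactE pe.
(* If the rows are preserved, so is the label, since a point is determined by its blocks; otherwise
   the image has another label and [meet_tcell] applies. *)
rewrite (autcol_mk H) (cimg_tcell i B hl); case: ifP => [|fl].
  rewrite allbE => /allP st; rewrite eqs_E; apply/eqP; congr tcell; apply/esym.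
  apply: bcol_inj => y yl; have /hitsP[m er eu] : hits rowF u (s y) (l i) by rewrite Hs permK.
  have : nat_of_ord (rowF (b^-1 m)) \in blockrows (mkp s) i.
    rewrite mem_rows -Hs; apply/hitsP; exists (b^-1 m) => //.
    by apply: (@perm_inj _ l); rewrite -hl permKV.
  move/st; rewrite mem_natE ap_mkp; have [<- _] := B (b^-1 m); rewrite permKV mem_rows er permK.
  by [].
apply: meet_tcell => //; apply: contraFneq fl => e.
rewrite allbE; apply/allP=> y /mapP[w wi ->]; have w11 := bcol_lt wi; rewrite (ap_mkp s (Ordinal w11)) mem_natE.
have /hitsP[m er eu] : hits rowF u (s (Ordinal w11)) i by rewrite Hs permK -mem_bcol.
have [em _] := B m; rewrite ap_mkp -er -em mem_rows -Hs; apply/hitsP; exists (b m) => //.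
by rewrite hl eu -e.
Qed.

(** The classes of [u], taken by orbits of labels, occur among the options and are pairwise
    compatible; by [ok_labels] the orbits are disjoint and cover all labels. *)
Lemma search_complete ps : mkp s \in reps D -> 
    (forall i : I11, colpat (tcell u i) \in ps) ->
  exists2 o, o \in search (ctries D (acts D) (mkp s)) ps & tocells o = tcs u.
Proof.
move=> sr Hps; have /and4P[h1 h2 h3 h4] := allP okl _ sr.
pose F t := tcell u (inord t); pose ss l := [seq ap x l | x <- labacts D (mkp s)].
have ss_lt (i : I11) t : t \in ss i -> t < 11.
  by case/mapP=> x /mapP[p /labactE[b [s' [t' [l [_ _ _ _ ->]]]]] ->] ->; rewrite ap_mkp.
have ss0 i : exists t l, ss i = t :: l.
  have /and5P[_ r _ _ _] := oke; rewrite /ss /labacts; case: (elts D) r => // p l _.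
  by eexists; eexists; reflexivity.
pose os := [seq map F (ss l) | l <- ordreps D (mkp s)].
pose ls := [seq (x.1, flatten [seq if tfind p x.2 is Some l then l else [::] | p <- ps]) | x <- ctries D (acts D) (mkp s)].
have lsE : ls = [seq (ss l, flatten [seq if tfind p (group_options (options (acts D) (blockrows (mkp s) l))) is Some l0
    then l0 else [::] | p <- ps]) | l <- ordreps D (mkp s)] by apply: etrans (esym (map_comp _ _ _)) _.
have e1 : map fst ls = [seq ss l | l <- ordreps D (mkp s)] by rewrite lsE -map_comp.
have sl : size ls = size (ordreps D (mkp s)) by rewrite /ls /ctries !size_map.
exists (foldl (fun acc x => zip x.1 x.2 ++ acc) [::] (zip (map fst ls) os)).
  have [n en] : exists n, n = 12 by exists 12.
  rewrite (searchE _ _ en) -/ls; apply: dfs_complete.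
  - by move: h1; rewrite sl size_map en.
  - by rewrite sl size_map.
  - move=> j jl; rewrite sl in jl; have lr := mem_nth 0 jl; have l11 := allP h2 _ lr.
    rewrite lsE (nth_map 0) // (nth_map 0) // [_.2]/=; set l := nth 0 _ j in lr l11 *.
    have [t [l' el]] := ss0 l; have := option_complete (Ordinal l11); rewrite [nat_of_ord (Ordinal l11)]/= => om.
    have -> : map F (ss l) = [seq tcell u (inord (ap x (Ordinal l11))) | x <- labacts D (mkp s)] by rewrite /ss -map_comp.
    set o := [seq tcell u _ | x <- _] in om *.
    have ho : head [::] o = tcell u (inord t) by rewrite /o (map_comp (fun y => tcell u (inord y)) (fun x => ap x l)) -/(ss l) el.
    have sz o' : o' \in options (acts D) (blockrows (mkp s) l) -> size (colpat (head [::] o')) = 11.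
      by apply: size_option; have /and5P[_ r _ _ _] := oke; rewrite /acts; case: (elts D) r.
    have [g eg og] := group_optionsP sz om.
    apply/flattenP; exists g => //; apply/mapP; exists (colpat (head [::] o)); last by rewrite eg.
    by rewrite ho.
  have: pairwise (fun o o' => all (fun x => x \notin o') o) [seq ss l | l <- ordreps D (mkp s)] by [].
  rewrite /os; elim: (ordreps D (mkp s)) h2 => //= l q IH /andP[l11 q11] /andP[ha hb]; rewrite IH // andbT.
  apply/allP=> _ /mapP[l' l'q ->]; have [t [r et]] := ss0 l; rewrite et -[compat _ _]/(allb (meet2 2 (F t)) (map F (ss l'))) allbE.
  apply/allP=> _ /mapP[t' t'l' ->].
  have tt : t \in ss l by rewrite et mem_head.
  have /allP/(_ t tt) tn : all (fun x => x \notin ss l') (ss l) by apply: (allP ha); apply: map_f.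
  apply: meetE; first exact: (ss_lt (Ordinal l11)).
    exact: (ss_lt (Ordinal (allP q11 _ l'q))).
  by apply: contraNneq tn => ->.
rewrite foldl_cat cats0 e1; set O := flatten _.
have zipF (q : seq nat) : zip q (map F q) = [seq (x, F x) | x <- q] by elim: q => //= x q ->.
have eO : O = flatten (rev [seq [seq (x, F x) | x <- ss l] | l <- ordreps D (mkp s)]).
  rewrite /O /os; congr (flatten (rev _)); elim: (ordreps D (mkp s)) => //= l q ->; by rewrite zipF.
have memO x : (x \in O) -> x.2 = F x.1.
  by rewrite eO => /flattenP[q]; rewrite mem_rev => /mapP[l _ ->] /mapP[y _ ->].
apply: eq_map_rng => i; rewrite (assocE (F := F)) // /F ?inord_val //.
have /flattenP[q /mapP[l lr ->] iq] := allP h3 _ (etrans (mem_rng i) (ltn_ord i)).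
apply/mapP; exists (nat_of_ord i, F i) => //; rewrite eO; apply/flattenP; exists [seq (x, F x) | x <- ss l].
  by rewrite mem_rev; apply/mapP; exists l.
by apply/mapP; exists (nat_of_ord i).
Qed.

End Labels.

Section Pattern.
Variables (s k lam : 'S_11) (u : flagT -> I11) (d : {perm flagT}) (ci di : 'S_11).
Hypotheses (Hs : rsys s u) (hd : forall m, rowF (d m) = ci (colF m) /\ colF (d m) = di (rowF m)).
Hypotheses (dr : drow D = mkp di^-1) (Hk : rsys k (lam \o (u \o d))).

(** The duality turns columns into rows, so the columns of a label class form a block in the row
    system of the dual labelling, whose normal form is [k]. *)
Lemma hits_pat (l j : I11) : hits u colF l j = incn (k^-1 (di^-1 j)) (lam l).
Proof.
rewrite -Hk; apply/hitsP/hitsP=> -[m].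
  move=> eu ec; exists (d^-1 m); last by rewrite /= permKV eu.
  by apply: (@perm_inj _ di); have [_ <-] := hd (d^-1 m); rewrite !permKV.
by move=> er /perm_inj eu; exists (d m) => //; have [_ ->] := hd m; rewrite er permKV.
Qed.

Lemma pats_mk : pats D (mkp k) = [seq [seq incn (k^-1 (di^-1 (inord j))) (inord t : I11) | j <- rng] | t <- rng].
Proof.
apply: eq_map_rng => t; apply: eq_map_rng => j; rewrite !inord_val dr ap_mkp sysV_mk /mkV !nth_map_rng // !inord_val.
by case: (incn _ _).
Qed.

Lemma eqpat_tcs (biC : biplane colF u) (t l : I11) : eqpat (nth [::] (pats D (mkp k)) t) (tcell u l) = (t == lam l).
Proof.
rewrite pats_mk nth_map_rng // inord_val eqpat_map; apply/all_rngE/eqP => [H|-> j]; last first.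
  by rewrite inord_val tc_neq0 // hits_pat.
apply: bcol_inj => i; have := H (di (k i)); rewrite inord_val !permK tc_neq0 // hits_pat !permK.
by move/eqP=> ->.
Qed.

Lemma colpat_tcs (biC : biplane colF u) (l : I11) : colpat (tcell u l) \in pats D (mkp k).
Proof.
rewrite pats_mk; apply/mapP; exists (nat_of_ord (lam l)); first by rewrite mem_rng.
apply: etrans (esym (map_comp _ _ _)) _; apply: eq_map_rng => j; rewrite /= !inord_val -hits_pat -(tc_neq0 biC).
by case: (tc _ _).
Qed.

Lemma lambda_tcs (biC : biplane colF u) : lambda (pats D (mkp k)) (tcs u) = mkp lam.
Proof.
apply: etrans (esym (map_comp _ _ _)) _; apply: eq_map_rng => l; rewrite /comp !inord_val.
apply: (@findd_eq (fun t => eqpat (nth [::] (pats D (mkp k)) t) (tcell u l))) => [|t]; rewrite eqpat_tcs //.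
by move/eqP.
Qed.

Lemma cols_tcs (biC : biplane colF u) : cols_ok (pats D (mkp k)) (mkp lam) (tcs u).
Proof. by rewrite /cols_ok allbE; apply/all_rngE => l; rewrite ap_mkp nth_tcs eqpat_tcs. Qed.

(** Rows and dual labelling form a biplane by [rsys_biplane]; undoing the duality turns the rows
    into the columns. *)
Lemma pattern_biplane : biplane colF u.
Proof.
apply: bpkE; have b := biplane_bpk (rsys_biplane Hk).
have ed : pullback d kc = kr.
  by apply/setP=> z; rewrite !inE; have [_ ->] := hd z.1; have [_ ->] := hd z.2; rewrite (inj_eq perm_inj).
have ek : kerf (lam \o (u \o d)) = pullback d (kerf u).
  by rewrite pullback_ker; apply/eqP/ker_eqP=> m m'; rewrite /= (inj_eq perm_inj).
rewrite ek -ed in b; have := @bpk_pullback d^-1 _ _ b; by rewrite !pullbackK.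
Qed.
End Pattern.

(** A row has only five places, so one that contains the five labels of its block contains nothing
    else. *)
Lemma rows_okE s (M : mat) : size M = 11 -> (forall i, i < 11 -> size (nth [::] M i) = 5) ->
  rows_ok (mkp s) M <-> exists2 u, M = mkM u & rsys s u.
Proof.
move=> sM sr; rewrite /rows_ok invp_mk allbE; split=> [/all_rngE H|[u -> H]]; last first.
  apply/all_rngE => i; rewrite allbE ap_mkp; apply/all_brow => j ij; rewrite mem_natE mem_mkM H.
  by [].
have sub (i j : I11) : incn (s^-1 i) j -> (nat_of_ord j \in nth [::] M i).
  by move=> ij; have := H i; rewrite allbE ap_mkp => /all_brow/(_ _ ij); rewrite mem_natE.
have mem (i : I11) : nth [::] M i =i brow (s^-1 i).
  have ub : uniq (brow (s^-1 i)) by rewrite /brow nth_map_rng // filter_uniq ?iota_uniq.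
  have sb : {subset brow (s^-1 i) <= nth [::] M i}.
    move=> x xb; have x11 := brow_lt xb; apply: (sub i (Ordinal x11)); by rewrite -mem_brow.
  by have [_ e] := uniq_min_size ub sb (eq_leq (etrans (sr i (ltn_ord i)) (esym (size_brow _)))); move=> x; rewrite e.
pose u (m : flagT) : I11 := inord (nth 0 (nth [::] M m.1) m.2).
have uE (i : I11) p : p < 5 -> nat_of_ord (u (i, inord p)) = nth 0 (nth [::] M i) p.
  move=> p5; rewrite /u [nat_of_ord (_, inord p).2](inordK p5) inordK //.
  by apply: (@brow_lt (s^-1 i)); rewrite -mem mem_nth ?sr.
have eM : M = mkM u.
  apply: (@eq_from_nth _ [::]) => [|i]; rewrite sM ?size_map // => i11; rewrite /mkM nth_map_rng //.
  apply: (@eq_from_nth _ 0) => [|p]; rewrite sr ?size_map // => p5; rewrite nth_map5 //.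
  by rewrite -(uE (Ordinal i11)) // (_ : inord i = Ordinal i11) //; apply: val_inj; rewrite /= inordK.
exists u => // i j; rewrite -mem_mkM -eM mem mem_brow; by [].
Qed.
End Type_.
End CellSearch.
Import CellSearch.

(** * The tests applied to a labelling that has been found *)

Module VertexTests.
Import GroupScope.

Lemma has3_colpat a b c a' b' c' : colpat a = colpat a' -> colpat b = colpat b' -> colpat c = colpat c' -> has3 a b c = has3 a' b' c'.
Proof.
elim: a b c a' b' c' => [|x a IH] [|y b] [|z c] [|x' a'] [|y' b'] [|z' c'] //= [ex ea] [ey eb] [ez ec].
by case: x x' ex => [|x] [|x'] //; case: y y' ey => [|y] [|y'] //; case: z z' ez => [|z] [|z'] // *; apply: IH.
Qed.

Lemma uniqnE s : uniqn s = uniq s.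
Proof. by elim: s => //= x s <-; rewrite mem_natE; case: (x \in s). Qed.

Lemma eqmatE M N : eqmat M N = (M == N).
Proof. by elim: M N => [|x M IH] [|y N] //=; rewrite eqs_E eqseq_cons IH; case: (x == y). Qed.

Lemma mem_dedup l : dedup l =i l.
Proof.
elim: l => //= M l IH N; case: ifP => [/hasP[M' M'l]|_]; rewrite !inE IH //.
by rewrite eqmatE => /eqP ->; case: eqP => [->|].
Qed.

Lemma uniq_dedup l : uniq (dedup l).
Proof.
elim: l => //= M l IH; case: ifP => //= h; rewrite IH mem_dedup andbT; apply/negP=> Ml.
by move/negP: h; apply; apply/hasP; exists M; rewrite // eqmatE.
Qed.

Lemma eqpat_colpat p c : eqpat p c -> p = colpat c.
Proof. by elim: p c => [|b p IH] [|x c] //=; case: x => [|x]; case: b => //= /IH ->. Qed.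

Lemma rowvecs_mk u : rowvecs (mkM u) = mkV (fun i j => hits rowF u i j).
Proof.
rewrite /rowvecs {1}/mkM; apply: etrans (esym (map_comp _ _ _)) _; apply: eq_map_rng => i.
apply: eq_map_rng => j; rewrite mem_natE !inord_val -mem_mkM; congr nat_of_bool.
by rewrite /mkM nth_map_rng // inord_val.
Qed.

Lemma nth_mkM u i : i < 11 -> size (nth [::] (mkM u) i) = 5.
Proof. by move=> i11; rewrite /mkM nth_map_rng // size_map. Qed.

Section Type_.
Variable D : gdata.
Let tr := mktrie D.
Implicit Types (s : 'S_11) (b r g d : {perm flagT}) (S Z : {set kernel}).
Hypotheses (okk : ok_keys D) (oke : ok_elts D) (okn : ok_nreps D) (okf : ok_find D) (okr : ok_reps D) (okd : ok_delta D).
Hypotheses (okl : ok_labels D) (okg : ok_gens D).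
Hypothesis nslE : nsl D = normrows (gens D) (elts D).
Let P := P oke.
Hypothesis conjP : forall Q : {group {perm flagT}}, Q \subset autB -> #|Q| = #|P| ->
  exists2 a, a \in autB & Q :^ a = P.
Notation frepr := (frepr oke).
Notation vrepr := (vrepr oke).

(** If [b] preserves the kernel, its action on labels is forced by [label_action], so comparison
    with that single renaming decides. *)
Lemma act_inv s u b : rsys s u -> b \in autB ->
  isaut (conjact (mkp s) (rl b)) && invariant (atab (rl b) (autcol (rl b))) (autcol (conjact (mkp s) (rl b))) (mkM u)
  = (pullback b (kerf u) == kerf u).
Proof.
move=> Hs bB; have [s' [t' [H B]]] := autB_acts bB; rewrite (rl_acts B) (autcol_mk H) (atab_mk H B).
rewrite /conjact invp_mk !mulp_mkM /invariant pull_mk eqmatE; apply/andP/eqP => [[/isautP[l hl]]|e].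
  rewrite (autcol_mk hl) relab_mk => /eqP/mkM_inj e; rewrite pullback_ker.
  by apply/eqP/ker_eqP=> m m'; have := e m; have := e m'; rewrite /= => -> ->; rewrite (inj_eq perm_inj).
have [l [hl al]] := label_action Hs B e; split; first by apply/isautP; exists l.
by rewrite (autcol_mk al) relab_mk; apply/eqP/eq_mkM => m; rewrite /= hl.
Qed.

Lemma actions_all s u (f : bool -> bool) X : rsys s u -> {subset X <= K} ->
  allb (fun z => f (invariant z.1 z.2 (mkM u))) (actions (mkp s) [seq (x, atab x (autcol x)) | x <- X]) =
  all (fun x => isaut (conjact (mkp s) x) ==> f (invariant (atab x (autcol x)) (autcol (conjact (mkp s) x)) (mkM u))) X.
Proof.
move=> Hs XK; rewrite allbE /actions all_map; elim: X XK => //= x X IH XK.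
have e := IH (fun y yX => XK y (mem_behead (s := x :: X) yX)).
by case: (isaut _) => /=; rewrite e.
Qed.

Lemma gens_aut s x : normS D s^-1 -> x \in elts D -> isaut (conjact (mkp s) x).
Proof.
move=> ns xe; have [q qe e] := ns x xe; have [s' [t' [ex _]]] := elts_perm oke xe.
have [s2 [t2 [eq H2]]] := elts_perm oke qe; rewrite ex eq !mulp_mkM in e; have {}e := mkp_permI e.
rewrite /conjact ex invp_mk !mulp_mkM -mulgA e mulgA mulgV mul1g; apply/isautP; by exists t2.
Qed.

Lemma gens_sub : {subset gens D <= elts D}. Proof. by case/and5P: oke => _ _ _ _ /allP. Qed.

(* Invariance under the generators suffices. *)
Lemma fixed_gens k : (forall b, b \in autB -> rl b \in gens D -> pullback b k = k) -> fixedK oke k.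
Proof.
move=> H; suff prod p : p \in products D -> exists b, [/\ b \in autB, rl b = p & pullback b k = k].
  move=> x /setIdP[xB xe]; have [b [bB e bk]] := prod _ (allP okg _ xe).
  by have -> : x = b by apply: rl_inj.
suff: forall N, p \in iter N (fun l => l ++ [seq mulp a q | a <- l, q <- gens D]) [:: rng] ->
    exists b, [/\ b \in autB, rl b = p & pullback b k = k] by apply.
move=> N; elim: N p => [|n IH] p.
  by rewrite inE => /eqP ->; exists 1; rewrite group1 rl1 pullback1.
rewrite iterS mem_cat => /orP[/IH //|/allpairsP[[a g] [/= /IH[b [bB <- bk]] gg ->]]].
have [c cB e] := K_rl (elts_K oke (gens_sub gg)).
by exists (b * c); split; [exact: groupM | rewrite rlM // e | rewrite pullbackM H ?e].
Qed.

Lemma frame3 k : bpk kr k -> bpk kc k -> fixedK oke k ->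
  [/\ framed [set kr; kc; k], based [set kr; kc; k], P \subset aut [set kr; kc; k],
      forall c, vcode D c k -> frepr [:: (mke D c.1, c.2)] [set kr; kc; k] & #|[set kr; kc; k]| = 3].
Proof.
move=> b1 b2 fk; have n0 := bpk_neq bpk_base; have n1 := bpk_neq b1; have n2 := bpk_neq b2.
have [f1 f2] := fixedK_base oke.
split.
- move=> x y; rewrite !inE => /orP[/orP[]|]/eqP-> /orP[/orP[]|]/eqP->; rewrite ?eqxx // => _ //;
    by [apply: bpk_base | apply: bpk_sym | apply: bpk_sym; apply: bpk_base].
- by rewrite /based !inE !eqxx ?orbT.
- by apply/fixedK_stab=> x; rewrite !inE => /orP[/orP[]|]/eqP->.
- move=> c vc; exists [:: (mke D c.1, c.2, k)]; split=> //.
  + by move=> x; rewrite inE => /eqP ->; split=> //; case: c vc.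
  + by rewrite /= !inE negb_or n0 n1 n2.
  by move=> x; rewrite !inE orbA.
by rewrite setUC cardsU1 !inE negb_or ![k == _]eq_sym n1 n2 cards2 n0.
Qed.

(** A key sees only which cells are empty, and on the third axis labels have become rows; its row
    system is therefore read off the column patterns of the label classes. *)
Lemma look_drows s u d (ci di : 'S_11) r (cs : mat) : (forall m, rowF (d m) = ci (colF m) /\ colF (d m) = di (rowF m)) ->
    drow D = mkp di^-1 -> dtab D = mkT d -> biplane colF u ->
    rtab (mkp s) (mkM u) = mkT r -> (forall m, u (r m) = colF m) -> acts_rows r s ->
    (forall l : I11, colpat (nth [::] cs l) = colpat (tcell u l)) ->
  look D tr (drows D cs) = (norm D tr (pull (dtab D) (pull (rtab (mkp s) (mkM u)) Brow))).1.
Proof.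
move=> hd dr dE biC tE ur hr Hcs; rewrite tE dE Brow_mk !pull_mk; set u3 := (colF \o r) \o d.
have -> : (norm D tr (mkM u3)).1 = look D tr (rowvecs (mkM u3)) by [].
rewrite rowvecs_mk /look; congr (if tfind _ _ is Some e then e else _).
apply/eq_in_map => -[[i j] k] /(allP okk)/and3P[/= i11 j11 k11].
have row (x : I11) : colpat (nth [::] (drows D cs) x) = colpat (nth [::] (mkV (fun i j => hits rowF u3 i j)) x).
  rewrite /drows /mkV !nth_map_rng // dr invp_mk invgK ap_mkp Hcs inord_val.
  apply: etrans (esym (map_comp _ _ _)) _; apply: etrans _ (map_comp _ _ _); apply: eq_map_rng => y; rewrite /comp inord_val.
  have -> : hits rowF u3 x y = hits u colF (di x) y; last by rewrite -(tc_neq0 biC); case: (tc _ _ _).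
  apply/hitsP/hitsP=> -[m].
    by move=> er ec; exists (r (d m)); [rewrite ur; have [_ ->] := hd m; rewrite er | rewrite -ec].
  move=> eu ec; have [_ ed] := hd (d^-1 (r^-1 m)); rewrite permKV -ur permKV eu in ed.
  by exists (d^-1 (r^-1 m)); [exact: (esym (perm_inj ed)) | rewrite /u3 /= !permKV].
by rewrite /h3; apply: has3_colpat; [exact: (row (Ordinal i11))|exact: (row (Ordinal j11))|exact: (row (Ordinal k11))].
Qed.

(** Collects what locates a vertex in the search: its row permutation [s], that of its dual [k], and
    the renaming [lam] between the labels of the two. *)
Lemma vertex_pattern v S : framed S -> based S -> P \subset aut S -> frepr [:: v] S ->
  exists (s k lam ci di : 'S_11) u d,
  [/\ v = (mke D (mkp s), mkM u), [/\ mkp s \in reps D, rsys s u, biplane colF u, kerf u \in S & fixedK oke (kerf u)],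
      [/\ mkp k \in reps D, rsys k (lam \o (u \o d)) & norm D tr (pull (dtab D) v.2) = (mke D (mkp k), relab (mkp lam) (pull (dtab D) v.2))],
      [/\ drow D = mkp di^-1, dtab D = mkT d & forall m, rowF (d m) = ci (colF m) /\ colF (d m) = di (rowF m)] &
      frepr [:: norm D tr (pull (dtab D) v.2)] (act d S) /\ [/\ d \in 'N(P), pullback d kr = kc & pullback d kc = kr]].
Proof.
move=> fS bS PS fv; have [k0 [vk kS _ _]] := frepr1 fv; have [[b1 b2 fk] ev [s [u [[es eM] sr Hs ek]]]] := vk.
have [d [ci [di [[dN dr dc] dE [_ eD] hd]]]] := dtab_spec oke okd.
have fd : frepr [:: norm D tr (pull (dtab D) v.2)] (act d S) := delta_spec okk okf okr nslE conjP fS bS PS fv dN dr dc dE.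
have ek1 : kerf (u \o d) = pullback d k0 by rewrite -pullback_ker ek.
have b1' : bpk kr (pullback d k0) by rewrite -dc; apply: bpk_pullback.
have [c [k [u2 [ec kr' Hk ek2]]] en] := normE okk okf okr nslE conjP ek1 b1' (fixedK_norm dN fk).
have su j : exists m, (u \o d) m = j by have [m <-] := rsys_surj Hs j; exists (d^-1 m); rewrite /= permKV.
have [lam hlam] := ker_eq_perm su (etrans ek1 (esym ek2)).
exists s, k, lam, ci, di, u, d; split=> //.
- by rewrite (surjective_pairing v) ev es eM.
- split=> //; rewrite ?ek //; apply: bpkE; by rewrite ek.
- split=> //; first by move=> i j; rewrite -Hk; apply/hitsP/hitsP=> -[m em eu]; exists m => //;
      [exact: etrans (hlam m) eu | exact: etrans (esym (hlam m)) eu].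
  rewrite eM dE pull_mk en ec relab_mk; congr pair; apply: eq_mkM => m; exact: hlam.
Qed.

Definition wtab := map (fun x => (x, atab x (autcol x))).

Lemma check_tcs (can : bool) s (k lam : 'S_11) u M2 q2 (X : seq (seq nat)) o : rsys s u -> biplane colF u -> 
    tocells o = tcs u -> lambda (pats D (mkp k)) (tcs u) = mkp lam -> cols_ok (pats D (mkp k)) (mkp lam) (tcs u) -> {subset X <= K} ->
    (can -> canon1 D tr (mke D (mkp s)) q2 M2 (mkp (lam : 'S_11)) (tcs u) (mkM u)) ->
    (forall b, b \in autB -> rl b \in gens D -> pullback b (kerf u) = kerf u) ->
    (forall b, b \in autB -> rl b \in X -> pullback b (kerf u) != kerf u) ->
  check D tr can (mke D (mkp s)) q2 M2 (pats D (mkp k)) (actions (mkp s) (wtab (gens D))) (actions (mkp s) (wtab X)) o = [:: mkM u].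
Proof.
move=> Hs biC eo elam cok XK can1 Hg HX; rewrite /check eo build_tcs // elam.
have -> : (if can then canon1 D tr (mke D (mkp s)) q2 M2 (mkp lam) (tcs u) (mkM u) else true) = true.
  by case: (can) can1 => // ->.
have -> : rows_ok (mke D (mkp s)).1 (mkM u) = true.
  by apply/(rows_okE s (M := mkM u)); rewrite ?size_map //; [move=> i; apply: nth_mkM | exists u].
rewrite cok uniqnE (_ : uniq (mkp lam)); last first.
  rewrite map_inj_in_uniq ?iota_uniq // => x y; rewrite !mem_rng => x11 y11 /val_inj/perm_inj/(congr1 val).
  by rewrite /= !inordK.
have gK x : x \in gens D -> x \in K by move=> xg; apply: (elts_K oke); apply: gens_sub.
rewrite (actions_all id Hs gK) (actions_all negb Hs XK).
have -> : all (fun x => isaut (conjact (mkp s) x) ==> id (invariant (atab x (autcol x)) (autcol (conjact (mkp s) x)) (mkM u))) (gens D) = true.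
  apply/allP=> x xg; have [b bB eb] := K_rl (gK x xg); have := act_inv Hs bB; rewrite eb (Hg b bB) ?eb // eqxx.
  by case/andP=> -> ->.
have -> // : all (fun x => isaut (conjact (mkp s) x) ==> ~~ invariant (atab x (autcol x)) (autcol (conjact (mkp s) x)) (mkM u)) X = true.
apply/allP=> x xX; have [b bB eb] := K_rl (XK x xX); have := act_inv Hs bB; rewrite eb (negbTE (HX b bB _)) ?eb //.
by move/negbT; rewrite negb_and implybE.
Qed.
End Type_.
End VertexTests.
Import VertexTests.

(** * Soundness and completeness of the enumeration of single kernels *)

Module SearchCorrectness.
Import GroupScope.

Lemma perm_rng s : uniq s -> size s = 11 -> all (fun x => x < 11) s -> perm_eq s rng.
Proof.
move=> us ss /allP H; have sub : {subset s <= rng} by move=> x /H; rewrite mem_rng.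
have [_ e] := uniq_min_size us sub (eq_leq (esym ss)); by apply: uniq_perm => //; rewrite iota_uniq.
Qed.

Section Type_.
Variable D : gdata.
Let tr := mktrie D.
Implicit Types (s : 'S_11) (b r g d : {perm flagT}) (S Z : {set kernel}) (X : seq (seq nat)).
Hypotheses (okk : ok_keys D) (oke : ok_elts D) (okn : ok_nreps D) (okf : ok_find D) (okr : ok_reps D) (okd : ok_delta D).
Hypotheses (okl : ok_labels D) (okg : ok_gens D).
Hypothesis nslE : nsl D = normrows (gens D) (elts D).
Let P := P oke.
Hypothesis conjP : forall Q : {group {perm flagT}}, Q \subset autB -> #|Q| = #|P| ->
  exists2 a, a \in autB & Q :^ a = P.
Notation frepr := (frepr oke).
Notation vrepr := (vrepr oke).

Definition sol_cell can X n n2 :=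
  if (if can then (if cmps n (cmin (mke D n2)) is Gt then true else false) else false) then [::] else
  flatten [seq check D tr can (mke D n) (cmps n (cmin (mke D n2))) (mke D n2) (pats D n2) (actions n (wtab (gens D))) (actions n (wtab X)) o
    | o <- search (ctries D (acts D) n) (pats D n2)].
Definition sol_row can X n := [seq (mke D n, M) | M <- dedup (flatten [seq sol_cell can X n n2 | n2 <- reps D])].

Lemma leaves_tr : leaves tr = map (mke D) (reps D).
Proof. by rewrite /tr trE leaves_tmap. Qed.

Lemma solsE (can : bool) X : sols D tr can X = [seq sol_row can X n | n <- [seq n <- reps D | if can then pre (mke D n) else true]].
Proof.
rewrite /sols leaves_tr !filter_map -!map_comp; apply: eq_map => n; rewrite /comp /sol_row; congr (map _ (dedup (flatten _))).
by rewrite -!map_comp.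
Qed.

Lemma third S u : based S -> #|S| = 3 -> kerf u \in S -> bpk kr (kerf u) -> bpk kc (kerf u) -> S = [set kr; kc; kerf u].
Proof.
case/andP=> rS cS c3 uS b1 b2; apply/esym/eqP; rewrite eqEcard c3; apply/andP; split.
  by apply/subsetP=> x; rewrite !inE => /orP[/orP[]|]/eqP->.
by rewrite setUC cardsU1 !inE negb_or ![kerf u == _]eq_sym (bpk_neq b1) (bpk_neq b2) cards2 (bpk_neq bpk_base).
Qed.

Lemma frepr_card Q S : frepr Q S -> #|S| = (size Q).+2.
Proof.
case=> z [-> _ uz Sz]; rewrite (eq_card Sz) (card_uniqP uz) /= !size_map; by [].
Qed.

(** The cell of [s] and [k] is not skipped, because a canonical frame passes [axis] and this implies
    [pre] and excludes the outcome [Gt]; in that cell the search meets the classes of [u]. *)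
Lemma sols_complete (can : bool) X S v : framed S -> based S -> P \subset aut S -> frepr [:: v] S ->
    (can -> canonical oke S) -> {subset X <= K} -> (forall b, b \in autB -> rl b \in X -> b \notin aut S) ->
  v \in flatten (sols D tr can X).
Proof.
move=> fS bS PS fv hcan XK HX.
have [s [k [lam [ci [di [u [d [ev [sr Hs biC uS fu] [kr' Hk nE] [eD dE hd] [fd [dN dr dc]]]]]]]]]] :=
  vertex_pattern okk okf okr okd nslE conjP fS bS PS fv.
have b1 : bpk kr (kerf u) := biplane_bpk (rsys_biplane Hs); have b2 : bpk kc (kerf u) := biplane_bpk biC.
have S3 := third bS (frepr_card fv) uS b1 b2.
have bd : based (act d S) by case/andP: bS => rS cS; rewrite /based (mem_act_eq _ dr) (mem_act_eq _ dc) rS cS.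
have can_axis : can -> axis (mkp s) (flatten v.2) v.1 v.2 /\ axis (mkp s) (flatten v.2) (mke D (mkp k)) (relab (mkp lam) (pull (dtab D) v.2)).
  move=> c; have := (canonSP okk okn okf okr okd nslE conjP fS bS PS fv).2 (hcan c).
  have cE : codes [:: (v.1.1, v.2)] = mkp s ++ flatten v.2 by rewrite codes1 ev.
  rewrite (canonS1 D _ cE) => /and3P[a1 a2 _].
  have A1 := axis_axisS okk okn okf okr nslE conjP s (flatten v.2) fS bS PS fv.
  have A2 := axis_axisS okk okn okf okr nslE conjP s (flatten v.2) (framed_act fS) bd (aut_act_norm dN PS) fd.
  by rewrite A1 a1; rewrite nE in A2 a2; rewrite A2 a2.
have q2 : can -> cmps (mkp s) (cmin (mke D (mkp k))) <> Gt.
  move=> /can_axis[_ a2] h; have := axis_Gt (flatten v.2) (relab (mkp lam) (pull (dtab D) v.2)) h (nreps_nil oke okn nslE _).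
  by rewrite a2.
rewrite solsE; apply/flattenP; exists (sol_row can X (mkp s)).
  apply: map_f; rewrite mem_filter sr andbT.
  case c: can => //; have [a1 _] := can_axis c; rewrite ev in a1; exact: axis_pre a1 erefl.
rewrite ev; apply/mapP; exists (mkM u) => //; rewrite mem_dedup; apply/flattenP.
exists (sol_cell can X (mkp s) (mkp k)); first exact: map_f.
rewrite /sol_cell.
have -> : (if can then (if cmps (mkp s) (cmin (mke D (mkp k))) is Gt then true else false) else false) = false.
  by case c: can q2 => // /(_ isT); case: (cmps _ _).
have [o os eo] := search_complete okl Hs biC fu sr (colpat_tcs hd eD Hk biC).
apply/flattenP; exists [:: mkM u]; last exact: mem_head.
apply/mapP; exists o => //; apply/esym; apply: check_tcs => //.
- exact: lambda_tcs hd eD Hk biC.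
- exact: cols_tcs hd eD Hk biC.
- move=> c; have [s' [es' ns ns' _]] := repsP okr sr; rewrite -(mkp_permI es') in ns ns'.
  have [r [_ tE hr ur]] := rtab_spec ns' Hs erefl fu.
  have := canon1E okk okn okf okr okd nslE conjP fS bS PS fv nE erefl; rewrite ev => ->.
  + rewrite -ev; exact: (canonSP okk okn okf okr okd nslE conjP fS bS PS fv).2 (hcan c).
  + exact: q2 c.
  by apply: (look_drows okk hd eD dE biC tE ur hr) => l; rewrite nth_tcs.
- by move=> b bB bg; apply: fu; apply/setIdP; split=> //; apply: gens_sub.
move=> b bB bX; apply: contra (HX b bB bX) => /eqP e; have [fr fc] := in_autB _ bB.
by apply/autP=> x; rewrite S3 !inE => /orP[/orP[]|]/eqP->.
Qed.

(** The argument rests on [check] alone: its final tests force the matrix to be a row system and its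
    classes to have the column patterns of [k]. *)
Lemma sols_sound (can : bool) X v : {subset X <= K} -> v \in flatten (sols D tr can X) ->
  exists S, [/\ framed S, based S, P \subset aut S, frepr [:: v] S &
    (can -> canonical oke S) /\ (forall b, b \in autB -> rl b \in X -> b \notin aut S)].
Proof.
move=> XK; rewrite solsE => /flattenP[L0 /mapP[n]]; rewrite mem_filter => /andP[_ nr] ->.
case/mapP=> M; rewrite mem_dedup => /flattenP[L1 /mapP[n2 n2r ->]] + ->.
have [s [en ns ns' fs]] := repsP okr nr; have [k [ek _ _ _]] := repsP okr n2r; rewrite en in nr *; rewrite ek in n2r *.
rewrite /sol_cell; case: ifP => // nq /flattenP[q /mapP[o os ->]].
have [d [ci [di [[dN dr dc] dE [_ eD] hd]]]] := dtab_spec oke okd.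
rewrite /check; set cs := tocells o; set M' := build _; set lam0 := lambda _ _.
case hc: (if can then _ else _) => //; case hr: (rows_ok _ _) => //; case hcol: (cols_ok _ _ _) => //.
case hu: (uniqn _) => //; case hg: (allb _ _) => //; case hx: (allb _ _) => //; rewrite inE => /eqP eM.
have sM i : i < 11 -> size (nth [::] M' i) = 5.
  by move=> i11; rewrite /M' /build nth_map_rng // size_map; have := size_brow (Ordinal i11).
have [|u eu Hs] := (rows_okE s (M := M') _ sM).1 hr; first by rewrite size_map.
have [lam el] : exists lam : 'S_11, lam0 = mkp lam.
  apply: mkp_perm; apply: perm_rng; rewrite ?size_map //; first by rewrite -uniqnE.
  by apply/allP=> z /mapP[c _ ->]; apply: findd_lt.
have pcs (l : I11) : colpat (nth [::] cs l) = [seq incn (k^-1 (di^-1 (inord j))) (lam l) | j <- rng].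
  move: hcol; rewrite /cols_ok allbE => /all_rngE/(_ l)/eqpat_colpat <-.
  by rewrite el ap_mkp (pats_mk k eD) nth_map_rng // inord_val.
have szc c : c \in cs -> size c = 11.
  move=> cc; have ci' : index c cs < 11 by rewrite -[X in _ < X](size_map (assoc^~ o) rng) index_mem.
  have e : nth [::] cs (Ordinal ci') = c := nth_index _ cc.
  by have := congr1 size (pcs (Ordinal ci')); rewrite e /colpat !size_map.
(* [build] finds a label as a position among the 11 cells of a column; a position below 11 means
   that the row was really found there. *)
have at_u m : nth 0 (nth [::] cs (u m)) (colF m) = (rowF m).+1.
  have e1 : nat_of_ord (u m) = index (rowF m).+1 [seq nth 0 c (colF m) | c <- cs].
    rewrite -at_mkM -eu /M' /at_ [_.1]/= [_.2]/= /build nth_map_rng // (nth_map 0) ?size_brow //.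
    by rewrite -/(colp m.1 m.2) -(colF_val m) (transpE szc (ltn_ord _)).1 pos_inE.
  have ii : (rowF m).+1 \in [seq nth 0 c (colF m) | c <- cs].
    by rewrite -index_mem -e1 size_map size_map; apply: ltn_ord.
  by have := nth_index 0 ii; rewrite -e1 (nth_map [::]) // size_map; apply: ltn_ord.
have nz (l j : I11) : (nth 0 (nth [::] cs l) j != 0) = incn (k^-1 (di^-1 j)) (lam l).
  have sl : size (nth [::] cs l) = 11 by rewrite szc // mem_nth // size_map; apply: ltn_ord.
  have := congr1 (fun p => nth false p j) (pcs l); rewrite /colpat (nth_map 0) ?sl // nth_map_rng // inord_val => <-.
  by case: (nth 0 _ _).
(* The five flags labelled [l] lie in distinct columns of a pattern of five, so they fill it. *)
have hp (l j : I11) : hits u colF l j = incn (k^-1 (di^-1 j)) (lam l).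
  have sub : colF @: [set m | u m == l] \subset [set j' | incn (k^-1 (di^-1 j')) (lam l)].
    by apply/subsetP=> _ /imsetP[m + ->]; rewrite !inE => /eqP <-; rewrite -nz at_u.
  have inj : {in [set m | u m == l] &, injective colF}.
    move=> m m'; rewrite !inE => /eqP em /eqP em' ec; apply: flag_inj => //; apply: val_inj.
    by have := at_u m; rewrite em -em' ec at_u => -[].
  have /eqP/setP/(_ j) : colF @: [set m | u m == l] == [set j' | incn (k^-1 (di^-1 j')) (lam l)].
    rewrite eqEcard sub (card_in_imset inj) (biplane_fiber l (biplane_sym (rsys_biplane Hs))).
    have -> : [set j' | incn (k^-1 (di^-1 j')) (lam l)] = (k * di) @: [set j' : I11 | incn j' (lam l)].
      apply/setP=> j'; rewrite inE; apply/idP/imsetP => [h|[x]].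
        by exists (k^-1 (di^-1 j')); rewrite ?inE // permM !permKV.
      by rewrite inE => h ->; rewrite permM !permK.
    rewrite card_imset; last exact: perm_inj.
    rewrite (card_incn (fun i => incn i (lam l))) andTb.
    by apply: (@all_rng (fun j => count (fun i => incn i j) rng <= 5) _ (lam l) (ltn_ord _)); vm_compute.
  rewrite inE => <-; apply/hitsP/imsetP => [[m <- <-]|[m]]; first by exists m; rewrite ?inE.
  by rewrite inE => /eqP <- ->; exists m.
have Hk : rsys k (lam \o (u \o d)).
  move=> i t; rewrite -(permKV lam t) -(permK di i) -{2}[di i]/(di i) -hp; apply/hitsP/hitsP=> -[m] /=.
    by move=> er /perm_inj eu'; exists (d m) => //; have [_ ->] := hd m; rewrite er permKV.
  move=> eu' ec; exists (d^-1 m); last by rewrite permKV eu'.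
  by apply: (@perm_inj _ di); have [_ <-] := hd (d^-1 m); rewrite !permKV.
have biC := pattern_biplane hd Hk.
have b1 : bpk kr (kerf u) := biplane_bpk (rsys_biplane Hs); have b2 : bpk kc (kerf u) := biplane_bpk biC.
have gK z : z \in gens D -> z \in K by move=> zg; apply: (elts_K oke); apply: gens_sub.
rewrite eu in hg hx hc; have G1 := actions_all id Hs gK; have X1 := actions_all negb Hs XK.
have {}hg : all (fun x => isaut (conjact (mkp s) x) ==> id (invariant (atab x (autcol x)) (autcol (conjact (mkp s) x)) (mkM u))) (gens D).
  by rewrite -G1; exact: hg.
have {}hx : all (fun x => isaut (conjact (mkp s) x) ==> ~~ (invariant (atab x (autcol x)) (autcol (conjact (mkp s) x)) (mkM u))) X.
  by rewrite -X1; exact: hx.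
have fu : fixedK oke (kerf u).
  apply: (fixed_gens okg) => b bB bg; apply/eqP; rewrite -(act_inv Hs bB).
  have ga := gens_aut oke ns' (gens_sub oke bg); have := allP hg _ bg; by rewrite ga.
have [fS bS PS fr c3] := frame3 b1 b2 fu; have vc : vcode D (mkp s, mkM u) (kerf u) by exists s, u.
have {}fr := fr _ vc; exists [set kr; kc; kerf u]; rewrite eM eu; split=> //; split; last first.
  move=> b bB bX; apply/negP=> /autP/(_ (kerf u)); rewrite !inE eqxx orbT => /(_ isT)/eqP.
  by rewrite -(act_inv Hs bB) => /andP[ia iv]; have := allP hx _ bX; rewrite ia iv.
move=> c; rewrite c in hc nq; apply/(canonSP okk okn okf okr okd nslE conjP fS bS PS fr).
have [r [_ tE hr' ur]] := rtab_spec ns' Hs erefl fu.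
have ek1 : kerf (u \o d) = pullback d (kerf u) by rewrite -pullback_ker.
have b1' : bpk kr (pullback d (kerf u)) by rewrite -dc; apply: bpk_pullback.
have [c' vc' en'] := normE okk okf okr nslE conjP ek1 b1' (fixedK_norm dN fu).
have vck : vcode D (mkp k, mkM (lam \o (u \o d))) (pullback d (kerf u)).
  by exists k, (lam \o (u \o d)); split=> //; rewrite -ek1; apply/eqP/ker_eqP=> m m'; rewrite /= (inj_eq perm_inj).
have nE : norm D tr (pull (dtab D) (mkM u)) = (mke D (mkp k), relab (mkp lam) (pull (dtab D) (mkM u))).
  by rewrite dE pull_mk en' (vcode_uniq okk okr vc' vck) relab_mk.
rewrite -(canon1E okk okn okf okr okd nslE conjP fS bS PS fr nE erefl (cs := cs)).
- by rewrite -el.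
- by move: nq => /[swap] ->.
apply: (look_drows okk hd eD dE biC tE ur hr') => l; rewrite pcs.
apply: etrans _ (map_comp _ _ _); apply: eq_map_rng => j; rewrite /comp !inord_val -hp -(tc_neq0 biC).
by case: (tc _ _ _).
Qed.

Lemma sols_uniq (can : bool) X : uniq (flatten (sols D tr can X)).
Proof.
rewrite solsE; have : uniq (reps D) by case/andP: okr.
have row n : exists2 l, uniq l & sol_row can X n = [seq (mke D n, M) | M <- l] by exists (dedup (flatten [seq sol_cell can X n n2 | n2 <- reps D])); [exact: uniq_dedup | ].
move: (sol_row can X) row => f row; move: (fun n => if can then pre (mke D n) else true) => p.
elim: (reps D) => [//|n l IH]; rewrite cons_uniq => /andP[nl ul]; rewrite [filter _ _]/=.
case: ifP => _; last exact: IH.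
rewrite map_cons [flatten _]/(f n ++ flatten (map f (filter p l))) cat_uniq IH // andbT; have [le ule ->] := row n; apply/andP; split.
  by rewrite map_inj_uniq // => M N [].
apply/hasPn=> v /flattenP[q /mapP[n']]; rewrite mem_filter => /andP[_ n'l] ->; have [le' _ ->] := row n'; case/mapP=> M _ ->.
apply/negP=> /mapP[N _ e]; case/negP: nl; have := congr1 (fun v : entry * mat => v.1.1) e; rewrite [LHS]/= [RHS]/= => <-; exact: n'l.
Qed.
End Type_.
End SearchCorrectness.
Import SearchCorrectness.

(** * Cliques, canonical frames and transversals of equivalence *)

Module Transversals.
Import GroupScope.

Lemma cliquesS (T : eqType) (r : rel T) k v c :
  cliques r k.+1 (v :: c) = [seq v :: Q | Q <- cliques r k [seq w <- c | r v w]] ++ cliques r k.+1 c.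
Proof. by []. Qed.

Lemma cliquesP (T : eqType) (r : rel T) k c Q :
  reflect [/\ subseq Q c, size Q = k & pairwise r Q] (Q \in cliques r k c).
Proof.
elim: k c Q => [|k IHk] c Q.
  rewrite inE; apply: (iffP eqP) => [->|[_ /size0nil ->]] //; split=> //; exact: sub0seq.
elim: c Q => [|v c IHc] Q; first by constructor; case=> /eqP; case: Q.
rewrite cliquesS mem_cat; apply: (iffP orP) => [[/mapP[Q' /IHk[+ <- pQ] ->]|/IHc[sQ zQ pQ]]|[]].
- rewrite subseq_filter => /andP[aQ sQ]; split=> //=; first by rewrite eqxx.
  by rewrite aQ.
- by split=> //; apply: (subseq_trans sQ); apply: subseq_cons.
case: Q => [|x Q] //; rewrite [subseq _ _]/=; case: eqP => [-> sQ [zQ] /= /andP[aQ pQ]|_ sQ zQ pQ]; [left|right].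
  by apply: map_f; apply/IHk; rewrite subseq_filter aQ.
by apply/IHc.
Qed.

Lemma cliques_uniq (T : eqType) (r : rel T) k c : uniq c -> uniq (cliques r k c).
Proof.
elim: k c => [|k IHk] c //; elim: c => [|v c IHc] //; rewrite cons_uniq => /andP[vc uc].
rewrite cliquesS cat_uniq IHc // (map_inj_uniq (f := cons v)); last by move=> x y [].
rewrite IHk ?filter_uniq // andbT andTb; apply/hasPn=> Q /cliquesP[sQ _ _]; apply/negP=> /mapP[Q' _ e].
by case/negP: vc; apply: (mem_subseq sQ); rewrite e mem_head.
Qed.

Lemma uniq_flatten_key (T U : eqType) (F : T -> seq U) (h : U -> T) s : uniq s -> (forall x, uniq (F x)) ->
  (forall x y, y \in F x -> h y = x) -> uniq (flatten (map F s)).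
Proof.
move=> us uF hF; elim: s us => //= x s IH /andP[xs us]; rewrite cat_uniq uF IH // andbT.
apply/hasPn=> y /flattenP[_ /mapP[x' x's ->] yx']; apply/negP=> yx.
by case/negP: xs; rewrite -(hF _ _ yx) (hF _ _ yx').
Qed.

Lemma exists_min (T : eqType) (f : T -> seq nat) (s : seq T) : s <> [::] ->
  exists2 v, v \in s & forall w, w \in s -> les (f v) (f w).
Proof.
elim: s => // x [|y s] IH _.
  by exists x; rewrite ?mem_head // => w; rewrite inE => /eqP->; apply: les_refl.
have [//|v vs Hv] := IH; have /orP[xv|vx] := les_total (f x) (f v).
  exists x; rewrite ?mem_head // => w; rewrite inE => /predU1P[->|/Hv]; first exact: les_refl.
  exact: les_trans.
by exists v; [rewrite inE vs orbT|move=> w; rewrite inE => /predU1P[->|/Hv]].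
Qed.

Lemma pairwise2E l : pairwise2 l = pairwise (fun u w => count_common u w == 2) l.
Proof. by elim: l => //= u l ->; rewrite allbE; under eq_all do rewrite eqnE; case: all. Qed.

Lemma codes_head l : l != [::] -> exists m s, [/\ codes l = m ++ s, m \in map code l & forall y, y \in map code l -> les m y].
Proof.
move=> nl; have p := insort_perm (map code l); have so := insort_sorted (map code l); rewrite /codes.
case: (foldr _ _ _) p so => [|m s] p so; first by have := perm_size p; rewrite size_map; case: l nl {p}.
exists m, (flatten s); split=> //; first by rewrite -(perm_mem p) mem_head.
move=> y; rewrite -(perm_mem p) inE => /predU1P[->|]; first exact: les_refl.
by move: y; apply/allP; apply: order_path_min so; apply: les_trans.
Qed.

Lemma les_cat a b a' b' : size a = size a' -> les (a ++ b) (a' ++ b') -> les a a'.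
Proof. by rewrite /les => /cmps_cat ->; case: (cmps a a'). Qed.

Arguments cellsM : simpl never.

Section Compat.
Variables (u w w0 : flagT -> I11).
Hypothesis bu : biplane u w0.
Let fib (a : I11) := [seq w m | m <- enum [set m | u m == a]].

Lemma cell_perm (a : I11) : perm_eq [seq at_ (mkM w) m | m <- nth [::] (cellsM (mkM u)) a] (map val (fib a)).
Proof.
rewrite /cellsM nth_map_rng //; set c := flatten _.
have -> : c = [seq z <- [seq (i, p) | i <- rng, p <- iota 0 5] | at_ (mkM u) z == a].
  rewrite /c filter_flatten -map_comp; congr flatten; by apply: eq_map => i; exact: (esym (filter_map _ _ _)).
rewrite /fib -map_comp (eq_map (g := (at_ (mkM w) \o (fun m : flagT => (nat_of_ord m.1, nat_of_ord m.2))))); last first.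
  by move=> m; rewrite /= at_mkM.
rewrite map_comp; apply: perm_map; apply: uniq_perm.
- by apply: filter_uniq; apply: allpairs_uniq; rewrite ?iota_uniq // => -[? ?] [? ?].
- rewrite map_inj_uniq ?enum_uniq // => -[x y] [x' y'] [/= /val_inj -> /val_inj ->] //.
move=> [i p]; rewrite mem_filter; apply/andP/mapP => [[e]|[m]].
  case/allpairsP=> -[i' p'] [h1 h2 [e1 e2]]; rewrite mem_rng in h1; rewrite mem_iota in h2; rewrite e1 e2 in e *.
  exists (Ordinal h1, Ordinal h2) => //; rewrite mem_enum inE; apply/eqP/val_inj.
  by have h := at_mkM u (Ordinal h1, Ordinal h2); apply: etrans (esym h) _; apply/eqP.
rewrite mem_enum inE => /eqP <- [-> ->]; rewrite at_mkM eqxx; split=> //.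
by apply/allpairsP; exists (nat_of_ord m.1, nat_of_ord m.2); rewrite mem_rng mem_iota !ltn_ord.
Qed.

Lemma mem_fib a c : (c \in fib a) = hits u w a c.
Proof.
apply/mapP/hitsP=> [[m + ->]|[m e <-]]; first by rewrite mem_enum inE => /eqP e; exists m.
by exists m; rewrite ?mem_enum ?inE ?e.
Qed.

Lemma common_fib a b : uniq (fib a) -> count (mem (map val (fib b))) (map val (fib a)) = #|[set c | hits u w a c && hits u w b c]|.
Proof.
move=> ua; rewrite count_map -size_filter.
have /card_uniqP <- : uniq [seq c <- fib a | preim val (mem (map val (fib b))) c] by rewrite filter_uniq.
by apply: eq_card => c; rewrite mem_filter inE /= (mem_map val_inj) !mem_fib andbC.
Qed.

(** Only pairs of distinct classes have to be compared: [bu] gives every class of [u] five flags,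
    and their labels under [w] have been tested to be distinct. *)
Lemma compatE x y : compatM (x, mkM u) (y, mkM w) = biplane u w.
Proof.
have -> : compatM (x, mkM u) (y, mkM w) = if allb (fun c => uniqn [seq at_ (mkM w) m | m <- c]) (cellsM (mkM u)) then
  pairwise2 [seq [seq at_ (mkM w) m | m <- c] | c <- cellsM (mkM u)] else false by exact: erefl.
rewrite allbE pairwise2E.
have sz : size (cellsM (mkM u)) = 11 by rewrite size_map.
have uE : all (fun c => uniqn [seq at_ (mkM w) m | m <- c]) (cellsM (mkM u)) = [forall a, uniq (fib a)].
  apply/(all_nthP [::])/forallP=> [H a|H i].
    by have := H a; rewrite sz ltn_ord uniqnE (perm_uniq (cell_perm a)) (map_inj_uniq val_inj); apply.
  by rewrite sz => i11; rewrite uniqnE (perm_uniq (cell_perm (Ordinal i11))) (map_inj_uniq val_inj).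
rewrite uE; case: forallP => [U|nU]; last first.
  apply/esym/negP=> b; case: nU => a; rewrite map_inj_in_uniq ?enum_uniq // => m m'.
  by rewrite !mem_enum !inE => /eqP e /eqP e'; apply: (biplane_inj b); rewrite e.
have cE (a b : I11) : count_common [seq at_ (mkM w) m | m <- nth [::] (cellsM (mkM u)) a]
    [seq at_ (mkM w) m | m <- nth [::] (cellsM (mkM u)) b] = #|[set c | hits u w a c && hits u w b c]|.
  rewrite -common_fib // -(seq.permP (cell_perm a)); apply: eq_count => z /=.
  by rewrite mem_natE (perm_mem (cell_perm b)).
have -> : biplane u w = [forall a, forall b, (a != b) ==> (#|[set c | hits u w a c && hits u w b c]| == 2)].
  rewrite /biplane; apply/idP/forallP=> [/andP[_ /forallP H] a|H]; first by apply/forallP=> b; have /forallP/(_ b)/eqP -> := H a; case: (a == b).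
  apply/andP; split; first apply/forallP=> m; apply/forallP=> m'.
    apply/implyP=> /andP[/eqP e /eqP e']; have := U (u m); rewrite /fib; set A := [set m0 | _] => uA.
    have /imset_injP inj : #|w @: A| == #|A|.
      rewrite [X in _ == X]cardE -(size_map w) -(card_uniqP uA); apply/eqP/eq_card => c.
      by apply/imsetP/mapP=> -[z zA ->]; exists z; rewrite ?mem_enum // -mem_enum.
    by apply/eqP/inj; rewrite ?inE ?e.
  rename m' into a; apply/forallP=> b; case: (eqVneq a b) (forallP (H a) b) => [<- _|//].
  have -> : [set c | hits u w a c && hits u w a c] = [set c in fib a] by apply/setP=> c; rewrite !inE andbb mem_fib.
  by rewrite cardsE (card_uniqP (U a)) size_map -cardE (biplane_fiber a bu).
have nE (a : I11) : nth [::] [seq [seq at_ (mkM w) m | m <- c] | c <- cellsM (mkM u)] a = [seq at_ (mkM w) m | m <- nth [::] (cellsM (mkM u)) a].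
  by rewrite (nth_map [::]) ?sz.
apply/(pairwiseP [::])/forallP=> [H a|H i j].
  have Hlt (a1 b1 : I11) : a1 < b1 -> #|[set c | hits u w a1 c && hits u w b1 c]| == 2.
    by have := H a1 b1; rewrite !inE size_map sz !ltn_ord !nE cE; apply.
  apply/forallP=> b; apply/implyP=> ne; case: (ltngtP a b) => [ab|ba|/val_inj e]; last by rewrite e eqxx in ne.
    exact: Hlt.
  rewrite (_ : [set c | _] = [set c | hits u w b c && hits u w a c]); last by apply/setP=> c; rewrite !inE andbC.
  exact: Hlt.
rewrite !inE size_map sz => i11 j11 ij; rewrite (nE (Ordinal i11)) (nE (Ordinal j11)) (cE (Ordinal i11) (Ordinal j11)).
have /forallP/(_ (Ordinal j11)) := H (Ordinal i11); rewrite -val_eqE /= ltn_eqF //.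
Qed.
End Compat.

Section Frames.
Variable D : gdata.
Let tr := mktrie D.
Implicit Types (s t : 'S_11) (b r g d : {perm flagT}) (S Z : {set kernel}).
Hypotheses (okk : ok_keys D) (oke : ok_elts D) (okn : ok_nreps D) (okf : ok_find D) (okr : ok_reps D) (okd : ok_delta D).
Hypotheses (okl : ok_labels D) (okg : ok_gens D).
Hypothesis nslE : nsl D = normrows (gens D) (elts D).
Let P := P oke.
Hypothesis conjP : forall Q : {group {perm flagT}}, Q \subset autB -> #|Q| = #|P| ->
  exists2 a, a \in autB & Q :^ a = P.
Notation vrepr := (vrepr oke).
Notation frepr := (frepr oke).
Notation L1 := (flatten (sols D tr true [::])).
Notation V := (flatten (sols D tr false [::])).

Definition kerv (v : entry * mat) : kernel := kerf (fun m : flagT => inord (at_ v.2 (nat_of_ord m.1, nat_of_ord m.2)) : I11).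
Definition dec (Q : frame) : {set kernel} := [set k in kr :: kc :: map kerv Q].
Notation vcode_of v := (code (v.1.1, v.2)).

Lemma kerv_mk e u : kerv (e, mkM u) = kerf u.
Proof. by apply/eqP/ker_eqP=> m m'; rewrite !at_mkM !inord_val. Qed.

Lemma vrepr_kerv v k : vrepr v k -> kerv v = k.
Proof.
case: v => e M [_ _ [s [u [eM _ _ <-]]]]; have -> : M = mkM u by case: eM.
exact: kerv_mk.
Qed.

Lemma vreprK v k : vrepr v k -> vrepr v (kerv v).
Proof. by move=> h; rewrite (vrepr_kerv h). Qed.

Lemma vrepr_inj v w k : vrepr v k -> vrepr w k -> v = w.
Proof.
case: v w => [e M] [e' M'] [_ ev cv] [_ ew cw]; have := vcode_uniq okk okr cv cw => -[e1 ->].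
by congr pair; move: ev ew; rewrite /= => -> ->; rewrite /= e1.
Qed.

Lemma kerv_inj v w : vrepr v (kerv v) -> vrepr w (kerv w) -> kerv v = kerv w -> v = w.
Proof. by move=> hv hw e; rewrite e in hv; apply: vrepr_inj hv hw. Qed.

Lemma compatP v w : vrepr v (kerv v) -> vrepr w (kerv w) -> compatM v w <-> bpk (kerv v) (kerv w).
Proof.
case: v w => [e M] [e' M'] [[b1 _ _] _ [s [u [eM _ _ eu]]]] [_ _ [s' [u' [eM' _ _ eu']]]].
have {eM} eM : M = mkM u by case: eM. have {eM'} eM' : M' = mkM u' by case: eM'.
rewrite -eu -eu' eM eM'; rewrite -eu in b1.
rewrite (compatE _ (biplane_sym (bpkE b1))); split; [exact: biplane_bpk|exact: bpkE].
Qed.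

Lemma code_vrepr v w : vrepr v (kerv v) -> vrepr w (kerv w) -> vcode_of v = vcode_of w -> v = w.
Proof. by move=> hv hw e; apply: kerv_inj => //; case: hv hw => [_ _ cv] [_ _ cw]; apply: (code_inj cv cw). Qed.

Lemma frepr_dec Q : (forall w, w \in Q -> vrepr w (kerv w)) -> uniq Q -> frepr Q (dec Q).
Proof.
move=> vQ uQ; exists [seq (w, kerv w) | w <- Q]; rewrite -!map_comp map_id; split=> //.
- by move=> _ /mapP[w wQ ->]; apply: vQ.
- have uk : uniq [seq kerv w | w <- Q] by rewrite map_inj_in_uniq // => v w vv ww; apply: kerv_inj; apply: vQ.
  rewrite /= !inE negb_or (bpk_neq bpk_base) uk andbT; apply/andP; split; apply/negP=> /mapP[w /vQ[[b1 b2 _] _ _] e].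
    by have := bpk_neq b1; rewrite e eqxx.
  by have := bpk_neq b2; rewrite e eqxx.
by move=> k; rewrite inE.
Qed.

Lemma frepr1_dec v : vrepr v (kerv v) -> [/\ framed (dec [:: v]), based (dec [:: v]), P \subset aut (dec [:: v]) & frepr [:: v] (dec [:: v])].
Proof.
move=> vv; have [[b1 b2 fk] _ _] := vv; have [fS bS PS _ _] := frame3 b1 b2 fk.
have -> : dec [:: v] = [set kr; kc; kerv v] by apply/setP=> k; rewrite !inE orbA.
split=> //; have := frepr_dec (Q := [:: v]); rewrite /dec /= => h.
have -> : [set kr; kc; kerv v] = [set k in [:: kr; kc; kerv v]] by apply/setP=> k; rewrite !inE orbA.
by apply: h => // w; rewrite inE => /eqP ->.
Qed.

Lemma mem_V v : v \in V <-> vrepr v (kerv v).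
Proof.
split=> [/(sols_sound okk okn okf okr okd okg nslE conjP)[//|S [_ _ _ /frepr1[k [vk _ _ _]] _]]|vv]; first exact: vreprK vk.
have [fS bS PS fr] := frepr1_dec vv.
by apply: (sols_complete okk okn okf okr okd okl nslE conjP fS bS PS fr).
Qed.

Lemma mem_L1 v : v \in L1 <-> vrepr v (kerv v) /\ canonical oke (dec [:: v]).
Proof.
split=> [/(sols_sound okk okn okf okr okd okg nslE conjP)[//|S [fS bS PS fr [c _]]]|[vv c]].
  have [k [vk kS _ _]] := frepr1 fr; have vv := vreprK vk; split=> //.
  suff -> : dec [:: v] = S by apply: c.
  have [_ _ _ fr'] := frepr1_dec vv.
  by apply: (scode_inj (frepr_scode fr')); apply: (frepr_scode fr).
have [fS bS PS fr] := frepr1_dec vv.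
by apply: (sols_complete okk okn okf okr okd okl nslE conjP fS bS PS fr).
Qed.

Definition verts S := [seq w <- V | kerv w \in S].

Lemma verts_frepr S : framed S -> based S -> P \subset aut S -> frepr (verts S) S /\ dec (verts S) = S.
Proof.
move=> fS bS PS; have e : dec (verts S) = S.
  have /andP[rS cS] := bS; apply/setP=> k; rewrite !inE; apply/or3P/idP=> [[/eqP->|/eqP->|/mapP[w + ->]]|kS] //.
    by rewrite mem_filter => /andP[].
  case: (eqVneq k kr) => [_|n1]; first by constructor.
  case: (eqVneq k kc) => [_|n2]; first by constructor 2.
  have fk : fixedK oke k by apply: (fixedK_stab oke S).2.
  have b1 : bpk kr k by apply: fS; rewrite // eq_sym.
  have b2 : bpk kc k by apply: fS; rewrite // eq_sym.
  have [c vc] := vcode_exists okf okr nslE conjP b1 fk.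
  have vr : vrepr (mke D c.1, c.2) k by split=> //; case: c vc.
  constructor 3; apply/mapP; exists (mke D c.1, c.2); last by rewrite (vrepr_kerv vr).
  by rewrite mem_filter (vrepr_kerv vr) kS; apply/mem_V; apply: vreprK vr.
split=> //; rewrite -[S in frepr _ S]e; apply: frepr_dec; last by apply: filter_uniq; apply: sols_uniq.
by move=> w; rewrite mem_filter => /andP[_ /mem_V].
Qed.

(** A permutation that lowers the code of the least vertex also produces an image of [S] with a
    smaller least vertex. Codes are sorted and of equal length, so the first vertex decides. *)
Lemma canonical_min S v : framed S -> based S -> P \subset aut S -> canonical oke S -> v \in verts S ->
  (forall w, w \in verts S -> les (vcode_of v) (vcode_of w)) -> canonical oke (dec [:: v]).
Proof.
move=> fS bS PS cS vS vmin b c c' bN bT sc sc'.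
have vv : vrepr v (kerv v) by move: vS; rewrite mem_filter => /andP[_ /mem_V].
have kS : kerv v \in S by move: vS; rewrite mem_filter => /andP[].
have [fT bsT PT fr] := frepr1_dec vv; have sub : dec [:: v] \subset S.
  by apply/subsetP=> k; rewrite !inE => /or3P[]/eqP-> //; case/andP: bS.
have ub : act b (dec [:: v]) \subset act b S by apply: imsetS.
have bbS : based (act b S) by case/andP: bT => x y; rewrite /based !(subsetP ub).
have PbS := aut_act_norm bN PS; have PbT := aut_act_norm bN PT.
have [fr' _] := verts_frepr (framed_act fS) bbS PbS; have [frT eT] := verts_frepr (framed_act fT) bT PbT.
have [fr0 _] := verts_frepr fS bS PS.
have -> : c = vcode_of v by rewrite (scode_uniq okk okr sc (frepr_scode fr)) codes1.
have cT : #|act b (dec [:: v])| = 3 by rewrite card_act (frepr_card fr).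
have : size (verts (act b (dec [:: v]))) = 1%N by have := frepr_card frT; rewrite cT => -[].
case eW: (verts (act b (dec [:: v]))) => [|w [|]] // _; rewrite eW in frT.
have -> : c' = vcode_of w by rewrite (scode_uniq okk okr sc' (frepr_scode frT)) codes1.
have wS : w \in verts (act b S).
  have : w \in verts (act b (dec [:: v])) by rewrite eW mem_head.
  by rewrite !mem_filter => /andP[wT ->]; rewrite (subsetP ub).
have := cS b _ _ bN bbS (frepr_scode fr0) (frepr_scode fr').
have [|m [q [-> mM mmin]]] := codes_head (l := map (@plain) (verts S)); first by case: (verts S) vS.
have [|m' [q' [-> mM' mmin']]] := codes_head (l := map (@plain) (verts (act b S))); first by case: (verts _) wS.
have s66 x y : x \in map code (map plain (verts y)) -> size x = 66.
  case/mapP=> _ /mapP[x' + ->] ->; rewrite mem_filter => /andP[_ /mem_V[_ _ [s [u [e _ _ _]]]]]; rewrite /plain e; exact: size_code_mk.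
move/les_cat; rewrite (s66 _ _ mM) (s66 _ _ mM') => /(_ erefl) mm'.
have vm : les (vcode_of v) m by case/mapP: mM => _ /mapP[x xS ->] ->; apply: vmin.
apply: les_trans vm (les_trans mm' _); apply: mmin'.
by apply/mapP; exists (plain w) => //; apply: map_f.
Qed.

Definition candP v w := compatM v w && ~~ les (vcode_of w) (vcode_of v).

Lemma framesE k Q0 : reflect (exists v Q, [/\ Q0 = v :: Q, v \in L1, Q \in cliques compatM k [seq w <- V | candP v w] & canonS D tr (v :: Q)])
  (Q0 \in frames D tr k (candidates L1 V)).
Proof.
rewrite /frames /candidates -map_comp.
apply: (iffP flattenP) => [[_ /mapP[v vL ->] /mapP[Q + ->]]|[v [Q [-> vL Qc cQ]]]].
  by rewrite mem_filter => /andP[cQ Qc]; exists v, Q.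
eexists; first by apply: map_f vL.
by apply/mapP; exists Q => //; rewrite mem_filter cQ.
Qed.

Lemma frames_elt k Q0 : Q0 \in frames D tr k (candidates L1 V) -> exists v Q,
  [/\ Q0 = v :: Q, subseq Q V, {in Q0, forall w, vrepr w (kerv w)}, {in Q, forall w, candP v w} & [/\ uniq Q0, size Q = k & pairwise compatM Q0]].
Proof.
case/framesE=> v [Q [-> vL /cliquesP[sQ zQ pQ] _]]; exists v, Q.
have sV : subseq Q V by apply: subseq_trans sQ (filter_subseq _ _).
have cQ : {in Q, forall w, candP v w} by move=> w /(mem_subseq sQ); rewrite mem_filter => /andP[].
have uV : uniq V by apply: sols_uniq.
split=> //; first by move=> w; rewrite inE => /predU1P[->|/(mem_subseq sV)/mem_V //]; have [] := (mem_L1 v).1 vL.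
split=> //=; rewrite ?pQ ?(subseq_uniq sV) ?andbT //.
  by apply/negP=> /cQ/andP[_]; rewrite les_refl.
by apply/allP=> w /cQ/andP[].
Qed.

Lemma frames_sound k Q0 : Q0 \in frames D tr k (candidates L1 V) ->
  [/\ framed (dec Q0), based (dec Q0), P \subset aut (dec Q0), #|dec Q0| = k.+3 & canonical oke (dec Q0)].
Proof.
move=> Q0f; have [v [Q [e sV vQ cQ [uQ zQ pQ]]]] := frames_elt Q0f.
have fr := frepr_dec vQ uQ.
have fS : framed (dec Q0).
  have H : {in Q0 &, forall x y, x != y -> bpk (kerv x) (kerv y)}.
    move=> x y xQ yQ ne; have ix : index x Q0 < size Q0 by rewrite index_mem.
    have iy : index y Q0 < size Q0 by rewrite index_mem.
    have [hx hy] := (vQ _ xQ, vQ _ yQ); have /(pairwiseP x) pP := pQ.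
    case: (ltngtP (index x Q0) (index y Q0)) => [lt|lt|ee]; last by move: ne; rewrite -(nth_index x xQ) ee (nth_index x yQ) eqxx.
      by apply/(compatP hx hy); have := pP _ _ ix iy lt; rewrite !nth_index.
    by apply/bpk_sym/(compatP hy hx); have := pP _ _ iy ix lt; rewrite !nth_index.
  move=> k1 k2; rewrite !inE => /or3P[/eqP->|/eqP->|/mapP[x xQ ->]] /or3P[/eqP->|/eqP->|/mapP[y yQ ->]]; rewrite ?eqxx // => ne.
  - exact: bpk_base.
  - by case: (vQ _ yQ) => [[]].
  - exact: bpk_sym bpk_base.
  - by case: (vQ _ yQ) => [[]].
  - by apply: bpk_sym; case: (vQ _ xQ) => [[]].
  - by apply: bpk_sym; case: (vQ _ xQ) => [[]].
  by apply: H => //; apply: contraNneq ne => ->.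
have bS : based (dec Q0) by rewrite /based !inE !eqxx orbT.
have PS : P \subset aut (dec Q0).
  apply/fixedK_stab=> k1; rewrite !inE => /or3P[/eqP->|/eqP->|/mapP[x xQ ->]]; try by have [] := fixedK_base oke.
  by case: (vQ _ xQ) => [[]].
split=> //; first by rewrite (frepr_card fr) e /= zQ.
apply/(canonSP okk okn okf okr okd nslE conjP fS bS PS fr).
by case/framesE: Q0f => ? [? [-> _ _]].
Qed.

(** The vertex of least code is canonical by [canonical_min]; the others have larger codes and form
    a clique in the order of [V]. *)
Lemma frames_complete k S : framed S -> based S -> P \subset aut S -> #|S| = k.+3 -> canonical oke S ->
  exists2 Q0, Q0 \in frames D tr k (candidates L1 V) & dec Q0 = S.
Proof.
move=> fS bS PS cS can; have [fr eS] := verts_frepr fS bS PS.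
have sz : size (verts S) = k.+1 by have := frepr_card fr; rewrite cS => -[].
have [|v vS vmin] := exists_min (fun w : entry * mat => vcode_of w) (s := verts S); first by case: (verts S) sz.
have uW : uniq (verts S) by apply: filter_uniq; apply: sols_uniq.
have vW w : w \in verts S -> vrepr w (kerv w) by rewrite mem_filter => /andP[_ /mem_V].
set Q := rem v (verts S); have p : perm_eq (verts S) (v :: Q) := perm_to_rem vS.
have sQ : subseq Q (verts S) := rem_subseq _ _.
have dE : dec (v :: Q) = S by rewrite -eS; apply/setP=> x; have h := perm_mem (perm_map kerv p) x; rewrite !inE in h *; rewrite h.
have wbp w w' : w \in verts S -> w' \in verts S -> w != w' -> compatM w w'.
  move=> wS w'S ne; apply/compatP; try exact: vW.
  by apply: fS; try (by move: wS w'S; rewrite !mem_filter => /andP[? _] /andP[? _]); apply: contraNneq ne => /(kerv_inj (vW _ wS) (vW _ w'S)) ->.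
have frQ : frepr (v :: Q) S.
  by rewrite -[S]dE; apply: frepr_dec; rewrite -?(perm_uniq p) // => w; rewrite -(perm_mem p); apply: vW.
exists (v :: Q) => //; apply/framesE; exists v, Q; split=> //.
- by apply/mem_L1; split; [exact: vW|exact: canonical_min vS vmin].
- have uvQ : uniq (v :: Q) by rewrite -(perm_uniq p).
  apply/cliquesP; split; last 1 first.
  + have : pairwise (fun x y => x != y) Q by rewrite -uniq_pairwise; case/andP: uvQ.
    apply: (@sub_in_pairwise _ [in Q] _ _ _ Q _); last by apply/allP.
    by move=> x y xQ yQ; apply: wbp; apply: (mem_subseq sQ).
  + rewrite subseq_filter (subseq_trans sQ (filter_subseq _ _)) andbT; apply/allP=> w wQ.
    have wS := mem_subseq sQ wQ; have ne : v != w by apply: contraTneq wQ => <-; case/andP: uvQ.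
    rewrite /candP wbp //; apply/negP=> wv; case/negP: ne; apply/eqP/code_vrepr; try exact: vW.
    by apply: les_anti; rewrite vmin.
  by rewrite size_rem // sz.
exact/(canonSP okk okn okf okr okd nslE conjP fS bS PS frQ).
Qed.

(** A frame determines its least vertex, and the others, being a subsequence of [V], are determined
    by their set. *)
Lemma frames_uniq k : uniq (map dec (frames D tr k (candidates L1 V))).
Proof.
have uV : uniq V by apply: sols_uniq.
rewrite map_inj_in_uniq; last first.
  move=> Q1 Q2 Q1f Q2f e.
  have [v [Q [e1 sV vQ cQ _]]] := frames_elt Q1f; have [v' [Q' [e2 sV' vQ' cQ' _]]] := frames_elt Q2f.
  have sub A B : dec A = dec B -> {in A, forall w, vrepr w (kerv w)} -> {in B, forall w, vrepr w (kerv w)} -> {subset A <= B}.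
    move=> eAB vA vB x xA; have : kerv x \in dec B by rewrite -eAB !inE map_f ?orbT.
    have [[b1 b2 _] _ _] := vA x xA.
    rewrite !inE => /or3P[/eqP ek|/eqP ek|/mapP[y yB /kerv_inj h]].
    - by have := bpk_neq b1; rewrite ek eqxx.
    - by have := bpk_neq b2; rewrite ek eqxx.
    by rewrite (h (vA _ xA) (vB _ yB)).
  have s12 := sub _ _ e vQ vQ'; have s21 := sub _ _ (esym e) vQ' vQ.
  have ev : v = v'.
    have := s12 v; rewrite e1 e2 mem_head inE => /(_ isT)/predU1P[//|/cQ'/andP[_ h]].
    have := s21 v'; rewrite e1 e2 mem_head inE => /(_ isT)/predU1P[//|/cQ/andP[_ h']].
    by have := les_total (vcode_of v) (vcode_of v'); rewrite (negbTE h) (negbTE h').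
  rewrite e1 e2 -ev; congr cons; rewrite (subseq_uniqP uV sV) (subseq_uniqP uV sV').
  apply: eq_filter => x; apply/idP/idP => xQ.
    have := s12 x; rewrite e1 e2 !inE xQ orbT => /(_ isT)/predU1P[xv|//].
    by have /andP[_] := cQ x xQ; rewrite xv ev les_refl.
  have := s21 x; rewrite e1 e2 !inE xQ orbT => /(_ isT)/predU1P[xv|//].
  by have /andP[_] := cQ' x xQ; rewrite xv ev les_refl.
rewrite /frames /candidates -map_comp; apply: (uniq_flatten_key (h := head ([::], ([::], [::]), [::]))).
- exact: sols_uniq.
- move=> v; rewrite map_inj_uniq; last by move=> x y [].
  by apply: filter_uniq; apply: cliques_uniq; apply: filter_uniq.
by move=> v Q0 /mapP[Q _ ->].
Qed.

Lemma canonical_exists S0 (Q : {group {perm flagT}}) : framed S0 -> 1 < #|S0| -> Q \subset aut S0 -> #|Q| = #|P| ->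
  exists b, [/\ based (act b S0), P \subset aut (act b S0) & canonical oke (act b S0)].
Proof.
move=> fS /card_gt1P[k [k' [kS k'S ne]]] QS cQ.
have [b0 [br bc eP]] := base_move conjP fS kS k'S ne QS cQ.
set S := act b0 S0; have {}fS : framed S := framed_act fS.
have bS : based S by rewrite /based /S (mem_act_eq _ br) (mem_act_eq _ bc) kS k'S.
have PS : P \subset aut S by have : Q :^ b0^-1 \subset aut S; [rewrite aut_act conjSg|rewrite eP].
pose f b := codes (map plain (verts (act b S))).
have [|b1 + Hb1] := exists_min f (s := enum [set b in 'N(P) | based (act b S)]).
  by move=> e; have : (1 : {perm flagT}) \in enum [set b in 'N(P) | based (act b S)]; [rewrite mem_enum inE group1 act1|rewrite e].
rewrite mem_enum inE => /andP[b1N b1S]; exists (b1 * b0); rewrite actM -/S; have PbS := aut_act_norm b1N PS; split=> //.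
move=> b c c' bN bbS sc sc'; have bb : based (act (b * b1) S) by rewrite actM.
have N' : b * b1 \in 'N(P) by rewrite groupM.
have [fr1 _] := verts_frepr (framed_act (b := b1) fS) b1S PbS.
have [fr2 _] := verts_frepr (framed_act (b := b * b1) fS) bb (aut_act_norm N' PS).
rewrite actM in fr2; rewrite (scode_uniq okk okr sc (frepr_scode fr1)) (scode_uniq okk okr sc' (frepr_scode fr2)) -actM.
by apply: Hb1; rewrite mem_enum inE N'.
Qed.

(** By [norm_move] the two frames lie in one orbit of the normaliser, so each code bounds the
    other. *)
Lemma canonical_eq S b : framed S -> based S -> based (act b S) -> P \subset aut S -> P \subset aut (act b S) ->
  canonical oke S -> canonical oke (act b S) -> sylow_in P (act b S) -> act b S = S.
Proof.
move=> fS bS bbS PS PbS cS cbS syl; have [b' b'N e] := norm_move PS PbS syl.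
have [fr _] := verts_frepr fS bS PS; have [fr' _] := verts_frepr (framed_act (b := b) fS) bbS PbS.
have sc := frepr_scode fr; have sc' := frepr_scode fr'.
apply/esym; apply: (scode_inj sc); have -> // : codes (map plain (verts S)) = codes (map plain (verts (act b S))).
apply: les_anti; rewrite (cS b' _ _ b'N _ sc); rewrite ?e //.
by rewrite (cbS b'^-1 _ _ _ _ sc') ?groupV -?e ?actK // e.
Qed.

(** [E] restricts the order of the automorphism group, an invariant of equivalence; transversals for
    exclusive conditions can thus be joined. *)
Definition transversal n (E : nat -> bool) (L : seq {set kernel}) := [/\ uniq L,
  forall S, S \in L -> [/\ framed S, #|S| = n & E #|aut S|],
  forall S, framed S -> #|S| = n -> E #|aut S| -> exists b, act b S \in L &
  forall S b, S \in L -> act b S \in L -> act b S = S].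

(** [F] is the condition imposed by the enumeration. A copy of [P] inside the group gives existence
    of a canonical image, and the Sylow property gives its uniqueness. *)
Lemma transversal_type n (E : nat -> bool) (F : {set kernel} -> Prop) L : 1 < n -> uniq L ->
    (forall S, S \in L <-> [/\ framed S, based S, P \subset aut S, #|S| = n & canonical oke S /\ F S]) ->
    (forall S, framed S -> based S -> P \subset aut S -> F S <-> E #|aut S|) ->
    (forall S, framed S -> 1 < #|S| -> E #|aut S| -> exists2 Q : {group {perm flagT}}, Q \subset aut S & #|Q| = #|P|) ->
    (forall S, framed S -> based S -> P \subset aut S -> E #|aut S| -> sylow_in P S) ->
  transversal n E L.
Proof.
move=> n1 uL LP FE HQ HS; split=> //.
- by move=> S /LP[fS bS PS cS [_ /(FE _ fS bS PS)]].
- move=> S fS cS ES; have n1' : 1 < #|S| by rewrite cS.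
  have [Q QS cQ] := HQ S fS n1' ES; have [b [bS PS can]] := canonical_exists fS n1' QS cQ.
  have fbS := framed_act (b := b) fS.
  exists b; apply/LP; split=> //; first by rewrite card_act.
  by split=> //; apply/(FE _ fbS bS PS); rewrite aut_act cardJg.
move=> S b /LP[fS bS PS cS [can FS]] /LP[fbS bbS PbS _ [canb Fb]].
by apply: canonical_eq => //; apply: HS => //; apply/(FE _ fbS bbS PbS).
Qed.

Lemma sols_type X : {subset X <= K} -> let L := map (fun v => dec [:: v]) (flatten (sols D tr true X)) in
  uniq L /\ forall S, S \in L <-> [/\ framed S, based S, P \subset aut S, #|S| = 3 &
    canonical oke S /\ (forall b, b \in autB -> rl b \in X -> b \notin aut S)].
Proof.
move=> XK L; have snd v : v \in flatten (sols D tr true X) -> vrepr v (kerv v) /\ [/\ framed (dec [:: v]), based (dec [:: v]), P \subset aut (dec [:: v]), #|dec [:: v]| = 3 &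
    canonical oke (dec [:: v]) /\ (forall b, b \in autB -> rl b \in X -> b \notin aut (dec [:: v]))].
  case/(sols_sound okk okn okf okr okd okg nslE conjP XK) => S [fS bS PS fr [c x]].
  have [k [vk kS _ _]] := frepr1 fr; have vv := vreprK vk; have [_ _ _ fr'] := frepr1_dec vv.
  have -> : dec [:: v] = S by apply: (scode_inj (frepr_scode fr')); apply: (frepr_scode fr).
  by split=> //; split=> //; [exact: frepr_card fr|split=> //; apply: c].
split.
  rewrite map_inj_in_uniq; first exact: sols_uniq.
  move=> v w /snd[vv _] /snd[ww _] e; have : kerv v \in dec [:: w] by rewrite -e !inE eqxx !orbT.
  have [[b1 b2 _] _ _] := vv.
  rewrite !inE => /or3P[/eqP ek|/eqP ek|/eqP/kerv_inj]; last by apply.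
    by have := bpk_neq b1; rewrite ek eqxx.
  by have := bpk_neq b2; rewrite ek eqxx.
move=> S; split=> [/mapP[v /snd[_ h] ->] //|[fS bS PS cS [can x]]].
have [fr eS] := verts_frepr fS bS PS; have : size (verts S) = 1%N by have := frepr_card fr; rewrite cS => -[].
case eV: (verts S) => [|v [|]] // _; rewrite eV in eS fr; apply/mapP; exists v => //.
exact: (sols_complete okk okn okf okr okd okl nslE conjP fS bS PS fr).
Qed.

Lemma frames_type k : let L := map dec (frames D tr k (candidates L1 V)) in
  uniq L /\ forall S, S \in L <-> [/\ framed S, based S, P \subset aut S, #|S| = k.+3 & canonical oke S /\ True].
Proof.
move=> L; split; first exact: frames_uniq.
move=> S; split=> [/mapP[Q /frames_sound[? ? ? ? ?] ->] //|[fS bS PS cS [can _]]].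
by have [Q Qf <-] := frames_complete fS bS PS cS can; apply: map_f.
Qed.
End Frames.

Lemma transversal_cat n (E1 E2 : nat -> bool) L1 L2 : (forall m, ~~ (E1 m && E2 m)) -> transversal n E1 L1 -> transversal n E2 L2 ->
  transversal n (fun m => E1 m || E2 m) (L1 ++ L2).
Proof.
move=> dE [u1 H1 c1 i1] [u2 H2 c2 i2]; split.
- rewrite cat_uniq u1 u2 andbT; apply/hasPn=> S /H2[_ _ e2]; apply/negP=> /H1[_ _ e1].
  by have := dE #|aut S|; rewrite e1 e2.
- by move=> S; rewrite mem_cat => /orP[/H1|/H2] [? ? ->]; rewrite ?orbT.
- move=> S fS cS /orP[e|e]; [have [b bL] := c1 S fS cS e|have [b bL] := c2 S fS cS e]; exists b; rewrite mem_cat bL ?orbT //.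
have aE S b : #|aut (act b S)| = #|aut S| by rewrite aut_act cardJg.
move=> S b; rewrite !mem_cat => /orP[x|x] /orP[y|y]; [exact: i1| | |exact: i2].
  by have [_ _ e1] := H1 _ x; have [_ _ e2] := H2 _ y; rewrite aE in e2; have := dE #|aut S|; rewrite e1 e2.
by have [_ _ e1] := H1 _ y; have [_ _ e2] := H2 _ x; rewrite aE in e1; have := dE #|aut S|; rewrite e1 e2.
Qed.

Lemma transversal_ext n (E E' : nat -> bool) L : (forall S, framed S -> #|S| = n -> E #|aut S| = E' #|aut S|) ->
  transversal n E L -> transversal n E' L.
Proof.
move=> e [u H c i]; split=> //; first by move=> S /H[fS cS ES]; rewrite -e.
by move=> S fS cS ES; apply: c; rewrite ?e.
Qed.

Lemma transversal_count n L : 1 < n -> transversal n (fun m => m != 1%N) L ->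
  count_up_to_equivalence (nontrivial_Pcubes n 11 5 2) = size L.
Proof.
move=> n1 [u H c i]; apply: count_frames => // [S /H[fS cS ES]|S fS cS ES].
  by split=> //; rewrite trivg_card1.
by apply: c; rewrite -?trivg_card1.
Qed.
End Transversals.
Import Transversals.

(** * The groups used, and the lists to be computed *)

Module Data.
Fixpoint powers (p q : seq nat) k := if k is k'.+1 then q :: powers p (mulp q p) k' else [::].
(** Automorphisms of orders 2, 3, 5 and 11, given on rows; the first three fix row 0 and the last is
    the shift. *)
Definition a2 := [::0;1;3;2;6;8;4;10;5;9;7].
Definition a3 := [::0;1;4;10;7;8;3;2;9;5;6].
Definition a5 := [::0;2;5;1;9;8;7;10;3;6;4].
Definition a11 := [::1;2;3;4;5;6;7;8;9;10;0].
Definition e2 := powers a2 rng 2. Definition e3 := powers a3 rng 3. Definition e5 := powers a5 rng 5. Definition e11 := powers a11 rng 11.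
(** Together with [a2] it generates a Klein four-group, a Sylow 2-subgroup of PSL(2,11). *)
Definition b2 := nth [::] [seq a <- K | eqs (mulp a a) rng && negb (eqs a rng) && negb (eqs a a2) && eqs (mulp a a2) (mulp a2 a)] 0.
(** Negation between rows and columns is a duality, since j - i = (-i) - (-j). In [mk] it is
    composed with an automorphism so that it normalises the group. *)
Definition neg := [seq mod11 (11 - i) | i <- rng].
Definition mk es gs ks := let ns := normrows gs es in
  let nr := cosets es [seq a <- ns | isaut a] [::] in
  let d := nth rng [seq g <- K | allb (fun p => has (eqs (mulp (mulp (invp (mulp neg g)) (autcol p)) (mulp neg g))) es) gs] 0 in
  GD es gs ks nr ns (mulp neg d) (mulp neg (autcol d)).
(** Any triples that pass [ok_find] and [ok_reps] would do here and in the next three lists. *)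
Definition k2 := [:: (0, 2, 3); (1, 2, 3); (2, 4, 5); (2, 4, 7); (0, 5, 7); (1, 2, 4); (2, 4, 8); (1, 5, 7); (0, 5, 8); (0, 4, 6); (0, 1, 4)].
Definition k3 := [:: (0, 2, 3); (0, 2, 5); (1, 3, 8); (2, 3, 4); (2, 4, 9); (3, 5, 6); (0, 2, 9)].
Definition k5 := [:: (0, 1, 2); (1, 2, 4); (1, 4, 5); (1, 2, 9); (1, 4, 8)].
Definition k11 := [:: (0, 1, 3)].
Definition e4 := [:: rng; a2; b2; mulp a2 b2].
Definition D2 := mk e2 [:: a2] k2. Definition D3 := mk e3 [:: a3] k3. Definition D5 := mk e5 [:: a5] k5. Definition D11 := mk e11 [:: a11] k11.
Definition D4 := mk e4 [:: a2; b2] k2.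
Definition t2 := mktrie D2. Definition t3 := mktrie D3. Definition t5 := mktrie D5. Definition t11 := mktrie D11. Definition t4 := mktrie D4.
Definition ordp p := [seq a <- K | eqs (iter p (mulp a) rng) rng && ~~ eqs a rng].
Definition invols := ordp 2. Definition ord3 := ordp 3. Definition ord5 := ordp 5.
(** A subgroup of PSL(2,11) containing [a2] has order divisible by 4 exactly when it contains one of
    these. *)
Definition X2 := [seq a <- invols | eqs (mulp a a2) (mulp a2 a) && ~~ eqs a a2].
Definition L4 := flatten (sols D4 t4 true [::]).
Definition L2 := flatten (sols D2 t2 true X2).
Definition L3 := flatten (sols D3 t3 true invols).
Definition L5 := flatten (sols D5 t5 true (invols ++ ord3)).
Definition L5' := flatten (sols D5 t5 true [::]).
Definition V5 := flatten (sols D5 t5 false [::]).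
Definition a5m := [seq mod11 (3 * i) | i <- rng].
(** Kernels invariant under the shift but not under multiplication by 3, which has order 5 modulo
    11. *)
Definition L11 := flatten (sols D11 t11 false [:: a5m]).
(** The separate conditions written out, so that the trie and the lists are shared during
    evaluation. *)
Definition ok_all D := let t0 := trie0 D in let rs := leaves t0 in let N := nsl D in let fd V := tfind (key D V) t0 in
  [&& [&& ok_keys D, ok_elts D, ok_delta D, ok_gens D & uniq rs],
    all (fun m => if fd (sysV m) is Some n then (n \in rs) && isaut (mulp m (invp n)) else false) N,
    all (fun g => [&& isaut g, perm_eq g rng, normal D g & normal D (invp g)]) (nreps D),
    all (fun a => isaut a ==> has (fun g => has (fun p => a == mulp p g) (elts D)) (nreps D)) N,
    all (fun n => [&& perm_eq n rng, normal D n, normal D (invp n) & fd (sysV n) == Some n]) rs &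
    all (fun n => let os := [seq [seq ap x l | x <- labacts D n] | l <- ordreps D n] in
      [&& size os < 12, all (fun l : nat => l < 11) (ordreps D n), all (in_mem^~ (mem (flatten os))) rng
        & pairwise (fun o o' : seq nat => all (fun x => x \notin o') o) os]) rs].
Definition conj2 := all (fun a => has (fun g => eqs (mulp a g) (mulp g a2)) K) invols.
Definition cent2 := all (fun a => [&& eqs (iter 4 (mulp a) rng) rng, eqs (mulp a a2) (mulp a2 a) & ~~ has (eqs a) e2] ==> has (eqs a) X2) K.
Definition four a := GD [:: rng; a2; a; mulp a2 a] [::] [::] [::] [::] [::] [::].
Definition fours := all (fun a => ok_elts (four a)) X2.
Definition tat (t : table) (m : nat * nat) := nth (0, 0) (nth [::] t m.1) m.2.
Definition fixedfl a := let t := atab a (autcol a) in [seq m <- [seq (i, p) | i <- rng, p <- iota 0 5] | tat t m == m].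
End Data.
Import Data.

(** * The five groups and the Sylow arguments for them *)

Module Types.
Import GroupScope.

Implicit Types (S : {set kernel}) (b y : {perm flagT}) (k : kernel).

Lemma ok_allP D : ok_all D -> [/\ ok_keys D, ok_elts D, ok_nreps D, ok_find D & [/\ ok_reps D, ok_delta D, ok_labels D & ok_gens D]].
Proof.
case/and5P=> /and5P[h1 h2 h3 h4 h5] h6 h7 h8 /andP[h9 h10]; split=> //; first by apply/andP.
by split=> //; apply/andP.
Qed.

Lemma ok2 : ok_all D2. Proof. by vm_compute. Qed.
Lemma ok3 : ok_all D3. Proof. by vm_compute. Qed.
Lemma ok4 : ok_all D4. Proof. by vm_compute. Qed.
Lemma ok5 : ok_all D5. Proof. by vm_compute. Qed.
Lemma ok11 : ok_all D11. Proof. by vm_compute. Qed.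

Lemma conj2_ok : conj2. Proof. by vm_compute. Qed.
Lemma cent2_ok : cent2. Proof. by vm_compute. Qed.
Lemma fours_ok : fours. Proof. by vm_compute. Qed.
Lemma unlock_X2 : X2 = [seq a <- ordp 2 | eqs (mulp a a2) (mulp a2 a) && ~~ eqs a a2]. Proof. by []. Qed.
Lemma elts2 : elts D2 = e2. Proof. by []. Qed.
Lemma elts_a2 : a2 \in elts D2. Proof. by vm_compute. Qed.
Lemma elts_a3 : a3 \in elts D3. Proof. by vm_compute. Qed.

Lemma elts_ok D : ok_all D -> ok_elts D. Proof. by case/ok_allP. Qed.
Notation P2 := (P (elts_ok ok2)).
Notation P3 := (P (elts_ok ok3)).
Notation P4 := (P (elts_ok ok4)).
Notation P5 := (P (elts_ok ok5)).
Notation P11 := (P (elts_ok ok11)).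

Lemma card_P2 : #|P2| = 2. Proof. by rewrite card_P; vm_compute. Qed.
Lemma card_P3 : #|P3| = 3. Proof. by rewrite card_P; vm_compute. Qed.
Lemma card_P4 : #|P4| = 4. Proof. by rewrite card_P; vm_compute. Qed.
Lemma card_P5 : #|P5| = 5. Proof. by rewrite card_P; vm_compute. Qed.
Lemma card_P11 : #|P11| = 11. Proof. by rewrite card_P; vm_compute. Qed.

Opaque K X2 D2 D3 D4 D5 D11 mulp a2 a3 a5 a11.

Lemma conj_of_sylow (gT : finGroupType) p (G H : {group gT}) : p.-Sylow(G) H ->
  forall Q : {group gT}, Q \subset G -> #|Q| = #|H| -> exists2 a, a \in G & Q :^ a = H.
Proof.
move=> sH Q QG cQ; have sQ : p.-Sylow(G) Q by rewrite pHallE QG cQ (card_Hall sH) eqxx.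
by have [a aG e] := Sylow_trans sQ sH; exists a.
Qed.

Lemma sylow_autB (p : nat) (H : {group {perm flagT}}) : H \subset autB -> #|H| = (660`_p)%N -> p.-Sylow(stab_group [:: kr; kc]) H.
Proof. by move=> HB cH; rewrite pHallE HB cH card_autB eqxx. Qed.

Lemma sylow3 : 3.-Sylow(stab_group [:: kr; kc]) P3.
Proof. by apply: sylow_autB; [exact: PB|rewrite card_P3 p_part]. Qed.
Lemma sylow4 : 2.-Sylow(stab_group [:: kr; kc]) P4.
Proof. by apply: sylow_autB; [exact: PB|rewrite card_P4 p_part]. Qed.
Lemma sylow5 : 5.-Sylow(stab_group [:: kr; kc]) P5.
Proof. by apply: sylow_autB; [exact: PB|rewrite card_P5 p_part]. Qed.
Lemma sylow11 : 11.-Sylow(stab_group [:: kr; kc]) P11.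
Proof. by apply: sylow_autB; [exact: PB|rewrite card_P11 p_part]. Qed.

Definition conj3 := conj_of_sylow sylow3.
Definition conj4 := conj_of_sylow sylow4.
Definition conj5 := conj_of_sylow sylow5.
Definition conj11 := conj_of_sylow sylow11.

Lemma prime_cycle (gT : finGroupType) (Q : {group gT}) x : prime #|Q| -> x \in Q -> x != 1 -> <[x]> = Q.
Proof.
move=> pQ xQ x1; apply/eqP; rewrite eqEcard cycle_subG xQ /=; have := order_dvdG xQ.
by case/primeP: pQ => _ H /H /orP[]; rewrite ?order_eq1 ?(negbTE x1) // => /eqP <-.
Qed.

Lemma prime_gen (gT : finGroupType) (Q : {group gT}) : prime #|Q| -> exists2 x, x \in Q & x != 1.
Proof. by move=> pQ; apply/trivgPn; rewrite trivg_card1; case: eqP pQ => // ->. Qed.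

Lemma rlX b n : b \in autB -> rl (b ^+ n) = iter n (mulp (rl b)) rng.
Proof. by move=> bB; elim: n => [|n IH]; rewrite ?rl1 // expgS rlM ?groupX // IH. Qed.

Lemma mem_ordp p b : b \in autB -> (rl b \in ordp p) = (b ^+ p == 1) && (b != 1).
Proof.
move=> bB; rewrite mem_filter rl_K // andbT !eqs_E -rlX // -rl1.
by rewrite !(inj_in_eq rl_inj) ?groupX ?group1.
Qed.

Lemma ordp_K p : {subset ordp p <= K}. Proof. by move=> a; rewrite mem_filter => /andP[]. Qed.

Lemma ordp_aut p S : prime p -> based S ->
  (forall b, b \in autB -> rl b \in ordp p -> b \notin aut S) <-> ~~ (p %| #|aut S|).
Proof.
move=> pp bS; split=> [H|nd b bB]; first apply/negP=> /(Cauchy pp)[x xS ox].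
  have xB := subsetP (aut_based bS) x xS; have := H x xB.
  by rewrite mem_ordp // -ox expg_order eqxx -order_eq1 ox; case: p pp {H ox} => [|[|]] // q _; rewrite xS => /(_ isT).
rewrite mem_ordp // => /andP[bp b1]; apply: contra nd => bS'; have <- : #[b] = p.
  by have := order_dvdn b p; rewrite bp; case/primeP: (pp) => _ H hd; have := H _ hd; rewrite order_eq1 (negbTE b1) => /eqP.
exact: order_dvdG.
Qed.


(** [P2] is not a Sylow subgroup of the base group; in its place [conj2] verifies that every
    involution is conjugate to [a2]. *)
Lemma conj_P2 (Q : {group {perm flagT}}) : Q \subset autB -> #|Q| = #|P2| -> exists2 a, a \in autB & Q :^ a = P2.
Proof.
move=> QB cQ; rewrite card_P2 in cQ; have [|x xQ x1] := @prime_gen _ Q; first by rewrite cQ.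
have xB := subsetP QB x xQ; have x2 : x ^+ 2 = 1 by have := expg_cardG xQ; rewrite cQ.
have : rl x \in invols by rewrite mem_ordp // x2 eqxx.
move/(allP conj2_ok)/hasP=> [g gK]; have [b bB <-] := K_rl gK.
have [y yP ey] := elts_P (elts_ok ok2) elts_a2.
have yB : y \in autB := subsetP (PB _) y yP; rewrite eqs_E -ey -(rlM xB bB) -(rlM bB yB) => /eqP/(rl_inj (groupM xB bB) (groupM bB yB)) e.
have {}e : x ^ b = y by rewrite conjgE e mulKg.
have pQ : prime #|Q| by rewrite cQ.
have pP : prime #|P2| by rewrite card_P2.
exists b; first exact: bB.
rewrite -(prime_cycle pQ xQ x1) -cycleJ e; apply: (prime_cycle pP yP).
by rewrite -e -(conj1g b) (inj_eq (conjg_inj b)).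
Qed.

(** Moving two kernels to the base conjugates the group into [autB]. With the trivial group as [P],
    [base_move] has no conjugacy to satisfy. *)
Lemma card_aut_dvd S : framed S -> 1 < #|S| -> #|aut S| %| 660.
Proof.
move=> fS /card_gt1P[k [k' [kS k'S ne]]].
have [Q QB|b [br bc _]] := @base_move 1%G _ S 1%G k k' fS kS k'S ne (sub1G _) erefl.
  by rewrite cards1 => /eqP; rewrite -trivg_card1 => /eqP->; exists 1; rewrite ?group1 ?conjsg1.
have bS : based (act b S) by rewrite /based (mem_act_eq _ br) (mem_act_eq _ bc) kS.
by rewrite -(cardJg _ b^-1) -aut_act -card_autB cardSg // aut_based.
Qed.

Lemma sylow_in_hall p (H : {group {perm flagT}}) S : p.-Sylow(aut S) H -> sylow_in H S.
Proof. exact: conj_of_sylow. Qed.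

Lemma sylow_in_autB p (H : {group {perm flagT}}) S : based S -> H \subset aut S -> p.-Sylow(stab_group [:: kr; kc]) H -> sylow_in H S.
Proof. by move=> bS HS sH; apply: (@sylow_in_hall p); apply: pHall_subl sH => //; apply: aut_based. Qed.

Lemma all660 (p : pred nat) : all p (divisors 660) -> forall S, framed S -> 1 < #|S| -> p #|aut S|.
Proof.
move=> + S fS nS; have := card_aut_dvd fS nS; have N0 : 0 < 660 by []; move: N0.
by move: 660 => N N0 d /allP; apply; rewrite -dvdn_divisors.
Qed.

Lemma cauchy_group p S : prime p -> p %| #|aut S| -> exists2 Q : {group {perm flagT}}, Q \subset aut S & #|Q| = p.
Proof. by move=> pp /(Cauchy pp)[x xS ox]; exists <[x]>%G; rewrite ?cycle_subG. Qed.

Lemma based_gt1 S : based S -> 1 < #|S|.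
Proof. by case/andP=> r c; apply/card_gt1P; exists kr, kc; split=> //; apply: bpk_neq bpk_base. Qed.


Lemma X2_K : {subset X2 <= K}.
Proof. by move=> a; rewrite [X2]unlock_X2 mem_filter => /andP[_ h]; exact: (@ordp_K 2 a h). Qed.

Lemma part4 : all (fun m => (4 %| m) ==> (logn 2 m == 2)) (divisors 660).
Proof. by vm_compute. Qed.

(** If 4 divides the order, [P2] lies in a subgroup of order 4, which is abelian, and an element of
    it outside [P2] commutes with [a2], hence is in [X2] by [cent2_ok]. Conversely such an element
    and [a2] generate a group of order 4. *)
Lemma X2_aut S : framed S -> based S -> P2 \subset aut S ->
  (forall b, b \in autB -> rl b \in X2 -> b \notin aut S) <-> ~~ (4 %| #|aut S|).
Proof.
move=> fS bS PS; have sB := subsetP (aut_based bS).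
have [y yP ey] := elts_P (elts_ok ok2) elts_a2.
have yS := subsetP PS y yP; have yB := sB y yS; split=> [H|n4 b bB bX].
  apply/negP=> d4; have [|R sR PR] := Sylow_superset PS (p := 2).
    by rewrite /pgroup card_P2.
  have RS := pHall_sub sR; have cR : #|R| = (2 ^ 2)%N.
    rewrite (card_Hall sR); have := all660 part4 fS (based_gt1 bS).
    by rewrite d4 p_part => /eqP ->.
  have ab := card_p2group_abelian (isT : prime 2) cR.
  have /subsetPn[x xR xP] : ~~ (R \subset P2) by apply: contraL (isT : ~~ (4 <= 2)) => /subset_leq_card; rewrite cR card_P2 => ->.
  have xS := subsetP RS x xR; have xB := sB x xS; suff hX : rl x \in X2 by case/negP: (H x xB hX).
  have := allP cent2_ok _ (rl_K xB); rewrite -(rlX 4 xB).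
  have -> : x ^+ 4 = 1 by have := expg_cardG xR; rewrite cR.
  rewrite rl1 -ey -(rlM xB yB) -(rlM yB xB) (centsP ab x xR y (subsetP PR y yP)).
  rewrite !eqs_E !eqxx (_ : ~~ has _ _); last first.
    apply: contra xP => /hasP[a ae]; rewrite eqs_E => /eqP e; apply/setIdP; rewrite e.
    by split; [exact: xB|rewrite elts2].
  by case/hasP=> a aX; rewrite eqs_E => /eqP ->.
apply: contra n4 => bS'; have ok4' := allP fours_ok _ bX.
suff : #|P ok4'| %| #|aut S| by rewrite card_P.
have E : elts (four (rl b)) = [:: rl (1 : {perm flagT}); rl y; rl b; rl (y * b)] by rewrite (rlM yB bB) ey rl1.
apply: cardSg; apply/subsetP=> x /setIdP[xB]; rewrite E !in_cons in_nil orbF.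
by case/or4P=> /eqP/rl_inj->; rewrite ?group1 ?groupM.
Qed.
End Types.
Import Types.

(** * No automorphisms of order 2 or 3 with four or more kernels *)

Module NoSmallPrimes.
Import GroupScope.

Implicit Types (S : {set kernel}) (b y : {perm flagT}) (k : kernel).

Lemma fixed_frame (H : {group {perm flagT}}) S (Q : {group {perm flagT}}) :
  (forall Q : {group {perm flagT}}, Q \subset autB -> #|Q| = #|H| -> exists2 a, a \in autB & Q :^ a = H) ->
  framed S -> 1 < #|S| -> Q \subset aut S -> #|Q| = #|H| -> exists b, based (act b S) /\ H \subset aut (act b S).
Proof.
move=> conjH fS /card_gt1P[k [k' [kS k'S ne]]] QS cQ; have [b [br bc eP]] := base_move conjH fS kS k'S ne QS cQ.
exists b; split; first by rewrite /based (mem_act_eq _ br) (mem_act_eq _ bc) kS.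
by have : Q :^ b^-1 \subset aut (act b S); [rewrite aut_act conjSg|rewrite eP].
Qed.

Lemma two_more S : based S -> 3 < #|S| -> exists k k', [/\ k \in S, k' \in S, k != k' & [/\ k != kr, k != kc, k' != kr & k' != kc]].
Proof.
case/andP=> rS cS S3; have : 1 < #|(S :\ kr) :\ kc|.
  by move: S3; rewrite (cardsD1 kr) rS (cardsD1 kc (S :\ kr)) !inE cS eq_sym (bpk_neq bpk_base).
by case/card_gt1P=> k [k' []]; rewrite !inE => /and3P[? ? ?] /and3P[? ? ?] ?; exists k, k'.
Qed.

Lemma tat_mkT y m : tat (mkT y) (nat_of_ord m.1, nat_of_ord m.2) = (nat_of_ord (y m).1, nat_of_ord (y m).2).
Proof. by rewrite /tat nth_map_rng ?nth_map5 ?ltn_ord // !inord_val -surjective_pairing. Qed.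

Lemma mem_fixedfl y m : y \in autB -> ((nat_of_ord m.1, nat_of_ord m.2) \in fixedfl (rl y)) = (y m == m).
Proof.
move=> yB; have [s [t [st yst]]] := autB_acts yB.
rewrite mem_filter (rl_acts yst) (autcol_mk st) (atab_mk st yst) tat_mkT.
have -> : ((nat_of_ord m.1, nat_of_ord m.2) \in [seq (i, p) | i <- rng, p <- iota 0 5]).
  by apply/allpairsP; exists (nat_of_ord m.1, nat_of_ord m.2); rewrite mem_rng mem_iota !ltn_ord.
by rewrite andbT; move: (y m) => [i p]; case: m.
Qed.

Lemma fixed_label y u : pullback y (kerf u) = kerf u -> forall m m', (u (y m) == u (y m')) = (u m == u m').
Proof. by rewrite pullback_ker => /eqP/ker_eqP. Qed.

Notation flg i p := (@Ordinal 11 i isT, @Ordinal 5 p isT).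

Lemma fixedfl3 : fixedfl a3 = ([:: (0, 2); (0, 3); (1, 1); (1, 2)])%N. Proof. by vm_compute. Qed.
Lemma fixedfl2 : fixedfl a2 = ([:: (0, 4); (1, 3); (9, 3)])%N. Proof. by vm_compute. Qed.

(* A class of five flags fixed by a group of order 3 contains at least two of the four fixed flags, which are
   the intersections of two rows and two columns. *)
Lemma same_label3 u : bpk kr (kerf u) -> bpk kc (kerf u) -> fixedK (elts_ok ok3) (kerf u) -> u (flg 0 2) = u (flg 1 2).
Proof.
move=> b1 b2 fu; have [y yP ey] := elts_P (elts_ok ok3) elts_a3.
have yB := subsetP (PB _) y yP; set f0 := flg 0 2; have bu := bpkE b1; have bu' := bpkE b2.
have fixE (m : flagT) : (y m == m) = ((nat_of_ord m.1, nat_of_ord m.2) \in fixedfl a3) by rewrite -ey mem_fixedfl.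
have y0 : y f0 = f0 by apply/eqP; rewrite fixE fixedfl3.
have y1 : y != 1 by apply/eqP=> e; move: ey; rewrite e rl1.
have cyc : <[y]> = P3 by apply: prime_cycle => //; rewrite card_P3.
pose C := [set m | u m == u f0]; have cC : #|C| = 5 := biplane_fiber _ (biplane_sym bu).
have xf0 x : x \in P3 -> x f0 = f0.
  rewrite -cyc => /cycleP[n ->]; elim: n => [|n IH]; first by rewrite perm1.
  by rewrite expgSr permM IH.
have acts : [acts P3, on C | 'P].
  by apply/actsP=> x xP m; rewrite !inE /= /aperm -{1}(xf0 x xP) (fixed_label (fu x xP)).
have pP : 3.-group P3 by rewrite /pgroup card_P3.
have := pgroup_fix_mod pP acts; rewrite cC => h.
have : 1 < #|'Fix_(C | 'P)(P3)| by case: (#|_|) h => [|[|]].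
case/card_gt1P=> m1 [m2 [m1F m2F ne]].
have [m mF m0] : exists2 m, m \in 'Fix_(C | 'P)(P3) & m != f0.
  by case: (eqVneq m1 f0) => [e|n0]; [exists m2; rewrite // -e eq_sym|exists m1].
have /setIP[mC /afixP mfix] := mF; have ym : y m = m := mfix y yP.
have um : u m = u f0 by apply/eqP; move: mC; rewrite inE.
have := fixE m; rewrite ym eqxx fixedfl3 => /esym; rewrite !inE !xpair_eqE => /or4P[]/andP[/eqP e1 /eqP e2].
- by case/eqP: m0; apply/eqP; rewrite -pair_eqE /pair_eq -!val_eqE /= e1 e2.
- case/eqP: m0; apply: (biplane_inj bu) => //; exact: val_inj.
- case/eqP: m0; apply: (biplane_inj bu') => //; apply: val_inj; rewrite -[LHS]/(nat_of_ord (colF m)) -[RHS]/(nat_of_ord (colF f0)) !colF_val e1 e2; by vm_compute.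
by rewrite -um; congr u; apply/eqP; rewrite -pair_eqE /pair_eq -!val_eqE /= e1 e2.
Qed.

(** Any two kernels beyond the base pair identify the same two flags by [same_label3], which joint
    injectivity forbids. *)
Lemma no_order3 S : framed S -> 3 < #|S| -> ~~ (3 %| #|aut S|).
Proof.
move=> fS S3; apply/negP=> /cauchy_group[//|Q QS cQ].
have [||b [bS PS]] := fixed_frame conj3 fS _ QS; rewrite ?card_P3 //; first exact: ltn_trans S3.
have {}fS := framed_act (b := b) fS; rewrite -(card_act b) in S3.
have [k [k' [kS k'S ne [n1 n2 n3 n4]]]] := two_more bS S3; have /andP[rS cS] := bS.
have [u [w [eu ew bi]]] := fS _ _ kS k'S ne.
have fk := (fixedK_stab (elts_ok ok3) _).2 PS.
have := biplane_inj bi (m := flg 0 2) (m' := flg 1 2); rewrite !same_label3 ?eu ?ew; try exact: fk.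
- by move=> /(_ erefl erefl).
all: by apply: fS => //; rewrite eq_sym.
Qed.

Section Involution.
Variables (y : {perm flagT}).
Hypotheses (yB : y \in autB) (ey : rl y = a2).
Let fixE (m : flagT) : (y m == m) = ((nat_of_ord m.1, nat_of_ord m.2) \in fixedfl a2).
Proof. by rewrite -ey mem_fixedfl. Qed.

(** For labellings that form a biplane these sets are disjoint; bounding their sizes by classes from
    below and by rows from above leads to a contradiction. *)
Let moved (u : flagT -> I11) := [set m | (y m != m) && (u (y m) == u m)].
Let rowpart (u : flagT -> I11) (r : I11) := [set m in moved u | rowF m == r].

Lemma involution2 : y ^+ 2 = 1.
Proof. by apply: (rl_inj (groupX _ yB) (group1 _)); rewrite rlX // ey rl1. Qed.

Lemma fixed2 m : y m = m -> [\/ m = flg 0 4, m = flg 1 3 | m = flg 9 3].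
Proof.
move/eqP; rewrite fixE fixedfl2 !inE !xpair_eqE => /or3P[]/andP[/eqP e1 /eqP e2]; [constructor 1|constructor 2|constructor 3];
by apply/eqP; rewrite -pair_eqE /pair_eq -!val_eqE /= e1 e2.
Qed.

Lemma pair_stable (p : 'S_11) (T : {set I11}) c : #|T| = 2 -> (forall x, x \in T -> p x \in T) -> c \in T -> p c = c ->
  forall x, x \in T -> p x = x.
Proof.
move=> /eqP/cards2P[a [b [ab ->]]] st; rewrite !inE => /orP[]/eqP-> e x; rewrite !inE => /orP[]/eqP-> //.
  have := st b; rewrite !inE eqxx orbT => /(_ isT)/orP[]/eqP // eb.
  by case/eqP: ab; apply: (@perm_inj _ p); rewrite eb e.
have := st a; rewrite !inE eqxx => /(_ isT)/orP[]/eqP // eb.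
by case/eqP: ab; apply: (@perm_inj _ p); rewrite eb e.
Qed.

Variable u : flagT -> I11.
Hypotheses (b1 : bpk kr (kerf u)) (fu : pullback y (kerf u) = kerf u).
Let bu : biplane rowF u := bpkE b1.

Lemma label_perm : exists p : 'S_11, forall m, u (y m) = p (u m).
Proof.
have sur a : exists m, u m = a by have [m] := biplane_surjr a bu; exists m.
have [p Hp] := ker_eq_perm sur (etrans (esym fu) (pullback_ker y u)); by exists p.
Qed.

Lemma row_perm2 : exists2 s : 'S_11, mkp s = a2 & forall m, rowF (y m) = s (rowF m).
Proof. by have [s [t [_ yst]]] := autB_acts yB; exists s; [rewrite -ey (rl_acts yst)|move=> m; case: (yst m)]. Qed.

Let common (r r' : I11) := [set c | hits rowF u r c && hits rowF u r' c].
Lemma card_common r r' : r != r' -> #|common r r'| = 2.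
Proof. by move=> ne; rewrite (biplane_card _ _ bu) (negbTE ne). Qed.

(** Otherwise the involution fixes one of the two labels common to the two rows, hence both, and
    then two flags of one row; but the three fixed flags lie in different rows. *)
Lemma distinct2 m m' : y m = m -> y m' = m' -> m != m' -> u m != u m'.
Proof.
move=> ym ym' ne; apply/eqP=> e; have [p Hp] := label_perm; have [s es Hs] := row_perm2.
have rne : rowF m != rowF m'.
  by apply: contraNneq ne => er; apply/eqP; apply: (biplane_inj bu).
have st x : x \in common (rowF m) (rowF m') -> p x \in common (rowF m) (rowF m').
  rewrite !inE => /andP[/hitsP[m1 r1 <-] /hitsP[m2 r2 e2]]; rewrite -Hp; apply/andP; split; apply/hitsP.
    by exists (y m1) => //; rewrite Hs r1 -Hs ym.
  by exists (y m2); rewrite ?Hs ?r2 -?Hs ?ym' // Hp e2 -Hp.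
have cm : u m \in common (rowF m) (rowF m').
  by rewrite inE; apply/andP; split; apply/hitsP; [exists m|exists m'].
have pm : p (u m) = u m by rewrite -Hp ym.
have all := pair_stable (card_common rne) st cm pm.
have /eqP/cards2P[a [b [ab eT]]] := card_common rne.
have [c cT cn] : exists2 c, c \in common (rowF m) (rowF m') & c != u m.
  by case: (eqVneq a (u m)) => [ea|na]; [exists b; rewrite ?eT ?inE ?eqxx ?orbT // -ea eq_sym|exists a; rewrite // eT !inE eqxx].
have pc := all c cT; move: cT; rewrite inE => /andP[/hitsP[m1 r1 e1] _].
have y1 : y m1 = m1 by apply: (biplane_inj bu); rewrite ?Hs ?r1 -?Hs ?ym // Hp e1.
case/eqP: cn; rewrite -e1; congr u; move: r1.
by case: (fixed2 y1) => ->; case: (fixed2 ym) => ->.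
Qed.

(** The classes of the three fixed flags are distinct and invariant, and the four other flags of
    each are moved. *)
Lemma card_moved : 12 <= #|moved u|.
Proof.
have [p Hp] := label_perm.
have F i p0 : (i, p0) \in fixedfl a2 -> forall (hi : i < 11) (hp : p0 < 5), y (Ordinal hi, Ordinal hp) = (Ordinal hi, Ordinal hp).
  by move=> h hi hp; apply/eqP; rewrite fixE.
have y1 : y (flg 0 4) = flg 0 4 by apply: F; rewrite fixedfl2.
have y2 : y (flg 1 3) = flg 1 3 by apply: F; rewrite fixedfl2.
have y3 : y (flg 9 3) = flg 9 3 by apply: F; rewrite fixedfl2.
pose B (g : flagT) := [set m | u m == u g] :\ g.
have cB g : #|B g| = 4.
  by have := biplane_fiber (u g) (biplane_sym bu); rewrite (cardsD1 g) inE eqxx => -[].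
have sB g : y g = g -> B g \subset moved u.
  move=> yg; apply/subsetP=> m; rewrite !inE => /andP[ne /eqP e]; rewrite Hp e -Hp yg eqxx andbT.
  by apply: contra ne => /eqP ym; apply/eqP/eqP/negPn/negP=> ne; have := distinct2 ym yg ne; rewrite e eqxx.
have dB g g' : y g = g -> y g' = g' -> g != g' -> [disjoint B g & B g'].
  move=> yg yg' ne; apply/pred0P=> m; rewrite !inE; apply/negP=> /andP[/andP[_ /eqP e] /andP[_ /eqP e']].
  by have := distinct2 yg yg' ne; rewrite -e -e' eqxx.
apply: (@leq_trans #|B (flg 0 4) :|: (B (flg 1 3) :|: B (flg 9 3))|); last first.
  by apply: subset_leq_card; rewrite !subUset !sB.
have e23 : B (flg 1 3) :&: B (flg 9 3) = set0 by apply: disjoint_setI0; apply: dB.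
have e12 : B (flg 0 4) :&: B (flg 1 3) = set0 by apply: disjoint_setI0; apply: dB.
have e13 : B (flg 0 4) :&: B (flg 9 3) = set0 by apply: disjoint_setI0; apply: dB.
by rewrite cardsU setIUr e12 e13 setU0 cardsU e23 cards0 !cB.
Qed.

Lemma rowpart_fixed r : (forall m, rowF m = r -> rowF (y m) = r) -> rowpart u r = set0.
Proof.
move=> hr; apply/setP=> m; rewrite !inE; apply/negP=> /andP[/andP[ne /eqP e] /eqP er].
by case/eqP: ne; apply: (biplane_inj bu) => //; rewrite hr // er.
Qed.

(** A flag counted here has a label common to row r and to its image row, fixed by the involution.
    Two rows have two common labels, and if one is fixed so is the other. *)
Lemma card_rowpart r : #|rowpart u r| = 0 \/ #|rowpart u r| = 2.
Proof.
have [p Hp] := label_perm; have [s es Hs] := row_perm2.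
case: (set_0Vmem (rowpart u r)) => [->|[m0]]; first by left; rewrite cards0.
rewrite !inE => /andP[/andP[n0 /eqP e0] /eqP r0]; right.
have sr : r != s r by apply: contraNneq n0 => er; apply/eqP; apply: (biplane_inj bu) => //; rewrite Hs r0 -er.
have yy m : y (y m) = m by have /permP/(_ m) := involution2; rewrite expgS expg1 permM perm1.
have ss : s (s r) = r by rewrite -r0 -!Hs yy.
have st x : x \in common r (s r) -> p x \in common r (s r).
  rewrite !inE => /andP[/hitsP[m1 r1 <-] /hitsP[m2 r2 e2]]; rewrite -Hp; apply/andP; split; apply/hitsP.
    by exists (y m2); rewrite ?Hs ?r2 ?ss // Hp e2 -Hp.
  by exists (y m1); rewrite ?Hs ?r1.
have c0 : u m0 \in common r (s r).
  by rewrite inE; apply/andP; split; apply/hitsP; [exists m0|exists (y m0); rewrite ?Hs ?r0].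
have all := pair_stable (card_common sr) st c0 (etrans (esym (Hp m0)) e0).
have inj : {in rowpart u r &, injective u}.
  by move=> m m'; rewrite !inE => /andP[_ /eqP e] /andP[_ /eqP e'] eu; apply: (biplane_inj bu) => //; rewrite e e'.
apply: etrans (esym (card_in_imset inj)) (etrans _ (card_common sr)).
apply: eq_card => c; apply/imsetP/idP => [[m + ->]|cT].
  rewrite !inE => /andP[/andP[_ /eqP eu] /eqP er]; apply/andP; split; apply/hitsP; first by exists m.
  by exists (y m); rewrite ?Hs ?er.
have pc := all c cT; move: cT; rewrite inE => /andP[/hitsP[m er ec] _]; exists m => //.
rewrite !inE er eqxx andbT Hp ec pc eqxx andbT; apply: contra sr => /eqP ym.
by rewrite -{2}er -Hs ym er.
Qed.

Lemma moved_rows : #|moved u| = \sum_r #|rowpart u r|.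
Proof.
rewrite -sum1_card (partition_big rowF predT) //=; apply: eq_bigr => r _.
by rewrite -sum1_card; apply: eq_bigl => m; rewrite !inE.
Qed.
End Involution.

(** The columns and two further labellings give at least 3 * 12 = 36 moved flags. A row fixed by the
    involution contributes none; each of the eight others contributes 0 or 2 for each labelling,
    hence at most 4 of its five flags, in all at most 32. *)
Lemma no_order2 S : framed S -> 3 < #|S| -> ~~ (2 %| #|aut S|).
Proof.
move=> fS S3; apply/negP=> /cauchy_group[//|Q QS cQ].
have [||b [bS PS]] := fixed_frame conj_P2 fS _ QS; rewrite ?card_P2 //; first exact: ltn_trans S3.
have {}fS := framed_act (b := b) fS; rewrite -(card_act b) in S3.
have [k [k' [kS k'S ne [n1 n2 n3 n4]]]] := two_more bS S3; have /andP[rS cS] := bS.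
have [u [w [eu ew bi]]] := fS _ _ kS k'S ne; move: (act b S) => Z in bS PS fS kS k'S rS cS *.
have fk := (fixedK_stab (elts_ok ok2) _).2 PS.
have [y yP ey] := elts_P (elts_ok ok2) elts_a2.
have yB := subsetP (PB _) y yP.
have fU k0 : k0 \in Z -> pullback y k0 = k0 by move=> kZ; apply: (fk _ kZ) yP.
have bc : bpk kr (kerf colF) := bpk_base; have bU : bpk kr (kerf u) by rewrite eu; apply: fS => //; rewrite eq_sym.
have bW : bpk kr (kerf w) by rewrite ew; apply: fS => //; rewrite eq_sym.
have bUc : biplane u colF by apply: bpkE; rewrite eu; apply: fS.
have bWc : biplane w colF by apply: bpkE; rewrite ew; apply: fS.
have fc : pullback y (kerf colF) = kerf colF by apply: fU.
have fu : pullback y (kerf u) = kerf u by rewrite eu; apply: fU.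
have fw : pullback y (kerf w) = kerf w by rewrite ew; apply: fU.
pose M (v : flagT -> I11) := [set m | (y m != m) && (v (y m) == v m)].
pose R v r := [set m in M v | rowF m == r].
have dM v v' r : biplane v v' -> R v r :&: R v' r = set0.
  move=> bi'; apply/setP=> m; rewrite !inE; apply/negP=> /andP[/andP[/andP[nm /eqP e] _] /andP[/andP[_ /eqP e'] _]].
  by case/eqP: nm; apply: (biplane_inj bi').
have [s es Hs] := row_perm2 yB ey.
have row4 r : #|R colF r| + #|R u r| + #|R w r| <= (s r != r) * 4.
  case: eqP => [sr|_].
    by rewrite /R !rowpart_fixed // ?cards0 // => m e; rewrite Hs e.
  have c5 : #|[set m | rowF m == r]| = 5 by apply: (biplane_fiber _ base_biplane).
  have sub v : R v r \subset [set m | rowF m == r] by apply/subsetP=> m; rewrite !inE => /andP[].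
  have US : R u r :|: (R w r :|: R colF r) \subset [set m | rowF m == r] by rewrite !subUset !sub.
  have := subset_leq_card US; rewrite c5 cardsU setIUr (dM _ _ _ bi) (dM _ _ _ bUc) setU0 cardsU (dM _ _ _ bWc) cards0 !subn0.
  case: (card_rowpart yB ey bc fc r) => ->; case: (card_rowpart yB ey bU fu r) => ->; by case: (card_rowpart yB ey bW fw r) => ->.
have : 36 <= #|M colF| + #|M u| + #|M w| by rewrite (leq_add (m1 := 24)) ?(leq_add (m1 := 12)) ?(card_moved yB ey).
rewrite !moved_rows -!big_split /=; apply/negP; rewrite -ltnNge.
apply: (@leq_ltn_trans (\sum_(r : I11) (s r != r) * 4)); first by apply: leq_sum => r _; apply: row4.
rewrite -big_distrl /= (eq_bigr (fun r : I11 => nat_of_bool (ap a2 r != r))) => [|r _]; last by rewrite -es ap_mkp.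
rewrite -(big_mkord predT (fun i => nat_of_bool (ap a2 i != i))) /index_iota -[11 - 0]/11; by rewrite unlock; vm_compute.
Qed.
End NoSmallPrimes.
Import NoSmallPrimes.

(** * The results of the computations *)

Module Computations.
Import GroupScope.

Implicit Types (S T : {set kernel}) (b y : {perm flagT}) (k : kernel).

Lemma size_L4 : size L4 = 76. Proof. by vm_compute. Qed.
Lemma size_L2 : size L2 = 5066. Proof. by vm_compute. Qed.
Lemma size_L3 : size L3 = 4753. Proof. by vm_compute. Qed.
Lemma size_L5 : size L5 = 283. Proof. by vm_compute. Qed.
Lemma L11_nil : L11 = [::]. Proof. by vm_compute. Qed.
Lemma a5m_K : a5m \in K. Proof. by vm_compute. Qed.
Lemma a5m_ord5 : a5m \in ordp 5. Proof. by vm_compute. Qed.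
(** Frames for the argument n have n + 3 kernels, so the list runs from 4 to 12 kernels. *)
Lemma size_frames : (fun c => [seq size (frames D5 t5 n c) | n <- iota 1 9]) (candidates L5' V5) = [:: 443; 8; 7; 4; 2; 1; 1; 1; 0]%N.
Proof. by vm_compute. Qed.
Lemma part2 : all (fun m => (2 %| m) && ~~ (4 %| m) ==> (logn 2 m == 1%N)) (divisors 660).
Proof. by vm_compute. Qed.
(** The four exclusive cases. They exhaust the nontrivial divisors of 660 that are divisible by 5
    whenever they are divisible by 11. *)
Definition types m := (2 %| m) && (4 %| m) || ((2 %| m) && ~~ (4 %| m) || ((3 %| m) && ~~ (2 %| m) || (5 %| m) && (~~ (2 %| m) && ~~ (3 %| m)))).
Lemma types3 : all (fun m => ((11 %| m) ==> (5 %| m)) ==> (types m == (m != 1%N))) (divisors 660).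
Proof. by vm_compute. Qed.
Lemma types4 : all (fun m => [&& ~~ (2 %| m), ~~ (3 %| m) & (11 %| m) ==> (5 %| m)] ==> ((5 %| m) == (m != 1%N))) (divisors 660).
Proof. by vm_compute. Qed.

Lemma nsl2 : nsl D2 = normrows (gens D2) (elts D2). Proof. by []. Qed.
Lemma nsl3 : nsl D3 = normrows (gens D3) (elts D3). Proof. by []. Qed.
Lemma nsl4 : nsl D4 = normrows (gens D4) (elts D4). Proof. by []. Qed.
Lemma nsl5 : nsl D5 = normrows (gens D5) (elts D5). Proof. by []. Qed.
Lemma nsl11 : nsl D11 = normrows (gens D11) (elts D11). Proof. by []. Qed.

Lemma L11E : L11 = flatten (sols D11 (mktrie D11) false [:: a5m]). Proof. by []. Qed.
End Computations.
Import Computations.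

Import GroupScope.

Implicit Types (S T : {set kernel}) (b y : {perm flagT}) (k : kernel).

Opaque K X2 D2 D3 D4 D5 D11 mulp a2 a3 a5 a11 a5m ordp.

(** * Transversals for each number of coordinates, and the final count *)

Section Family.
Variables (D : gdata) (ok : ok_all D) (nslE : nsl D = normrows (gens D) (elts D)).
Hypothesis conjP : forall Q : {group {perm flagT}}, Q \subset autB -> #|Q| = #|P (elts_ok ok)| ->
  exists2 a, a \in autB & Q :^ a = P (elts_ok ok).
Variable E : nat -> bool.
Hypothesis HQ : forall S, framed S -> 1 < #|S| -> E #|aut S| -> exists2 Q : {group {perm flagT}}, Q \subset aut S & #|Q| = #|P (elts_ok ok)|.
Hypothesis HS : forall S, framed S -> based S -> P (elts_ok ok) \subset aut S -> E #|aut S| -> sylow_in (P (elts_ok ok)) S.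

Lemma sols_family X : {subset X <= K} ->
    (forall S, framed S -> based S -> P (elts_ok ok) \subset aut S ->
       (forall b, b \in autB -> rl b \in X -> b \notin aut S) <-> E #|aut S|) ->
  transversal 3 E (map (fun v => dec [:: v]) (flatten (sols D (mktrie D) true X))).
Proof.
move=> XK FE; have [h1 h2 h3 h4 [h5 h6 h7 h8]] := ok_allP ok.
have [uL HL] := sols_type h1 h3 h4 h5 h6 h7 h8 nslE conjP XK.
exact: (transversal_type h1 h3 h4 h5 h6 h7 h8 nslE conjP (isT : 1 < 3) uL HL FE HQ HS).
Qed.

Lemma frames_family n : (forall S, framed S -> based S -> P (elts_ok ok) \subset aut S -> E #|aut S|) ->
  transversal n.+3 E (map dec (frames D (mktrie D) n (candidates (flatten (sols D (mktrie D) true [::])) (flatten (sols D (mktrie D) false [::]))))).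
Proof.
move=> FE; have [h1 h2 h3 h4 [h5 h6 h7 h8]] := ok_allP ok.
have [uL HL] := frames_type h1 h3 h4 h5 h6 h7 h8 nslE conjP n.
apply: (transversal_type h1 h3 h4 h5 h6 h7 h8 nslE conjP _ uL HL _ HQ HS) => // S fS bS PS.
by split=> // _; apply: FE.
Qed.
End Family.

Lemma transversal_V4 : transversal 3 (fun m => (2 %| m) && (4 %| m)) (map (fun v => dec [:: v]) L4).
Proof.
apply: (@sols_family D4 ok4 nsl4 conj4 _ _ _ [::]) => //.
- move=> S fS S1 /andP[_ d4]; have [Q sQ] := Sylow_exists 2 (aut S); exists Q; first exact: pHall_sub sQ.
  by rewrite card_P4 (card_Hall sQ) p_part; have := all660 part4 fS S1; rewrite d4 => /eqP->.
- by move=> S fS bS PS _; apply: (@sylow_in_autB 2 _ _ bS PS sylow4).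
move=> S fS bS PS; split=> // _; have := cardSg PS; rewrite card_P4 => d; rewrite d andbT; exact: dvdn_trans d.
Qed.

Lemma transversal_2 : transversal 3 (fun m => (2 %| m) && ~~ (4 %| m)) (map (fun v => dec [:: v]) L2).
Proof.
apply: (@sols_family D2 ok2 nsl2 conj_P2 _ _ _ X2 X2_K).
- by move=> S fS S1 /andP[d2 _]; rewrite card_P2; apply: cauchy_group.
- move=> S fS bS PS d; apply: (@sylow_in_hall 2); rewrite pHallE PS card_P2 p_part.
  by have := all660 part2 fS (based_gt1 bS); rewrite d => /eqP->.
move=> S fS bS PS; have := cardSg PS; rewrite card_P2 => d; rewrite d andTb; exact: X2_aut.
Qed.

Lemma transversal_3 : transversal 3 (fun m => (3 %| m) && ~~ (2 %| m)) (map (fun v => dec [:: v]) L3).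
Proof.
apply: (@sols_family D3 ok3 nsl3 conj3 _ _ _ (ordp 2) (@ordp_K 2)).
- by move=> S fS S1 /andP[d3 _]; rewrite card_P3; apply: cauchy_group.
- by move=> S fS bS PS _; apply: (@sylow_in_autB 3 _ _ bS PS sylow3).
move=> S fS bS PS; have := cardSg PS; rewrite card_P3 => d; rewrite d andTb; exact: ordp_aut.
Qed.

Lemma transversal_5 : transversal 3 (fun m => (5 %| m) && (~~ (2 %| m) && ~~ (3 %| m))) (map (fun v => dec [:: v]) L5).
Proof.
apply: (@sols_family D5 ok5 nsl5 conj5 _ _ _ (ordp 2 ++ ordp 3)).
- by move=> S fS S1 /andP[d5 _]; rewrite card_P5; apply: cauchy_group.
- by move=> S fS bS PS _; apply: (@sylow_in_autB 5 _ _ bS PS sylow5).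
- by move=> a; rewrite mem_cat => /orP[]; apply: ordp_K.
move=> S fS bS PS; have := cardSg PS; rewrite card_P5 => d; rewrite d andTb.
have [h2 h2'] := @ordp_aut 2 S isT bS; have [h3 h3'] := @ordp_aut 3 S isT bS.
have m23 (p q : seq (seq nat)) a : (a \in p ++ q) = (a \in p) || (a \in q) by rewrite mem_cat.
split=> [H|/andP[/h2' n2 /h3' n3] b bB]; last by rewrite m23 => /orP[/(n2 b bB)|/(n3 b bB)].
apply/andP; split.
  by apply: h2 => b bB bX; apply: (H b bB); rewrite m23; apply/orP; left; exact: bX.
by apply: h3 => b bB bX; apply: (H b bB); rewrite m23; apply/orP; right; exact: bX.
Qed.

(** As [L11] is empty, every kernel that the shift fixes and that is compatible with the base is
    also fixed by [a5m], so [a5m] is an automorphism of the whole frame. *)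
Lemma order11 S : framed S -> 1 < #|S| -> 11 %| #|aut S| -> 5 %| #|aut S|.
Proof.
move=> fS S1 /cauchy_group[//|Q QS cQ].
have [||b [bS PS]] := fixed_frame conj11 fS _ QS; rewrite ?card_P11 //.
have <- : #|aut (act b S)| = #|aut S| by rewrite aut_act cardJg.
have {S1 QS} := framed_act (b := b) fS; move: (act b S) bS PS => {fS}S bS PS fS.
have [c cB ec] := K_rl a5m_K; apply/negPn/negP=> n5.
have [_ /(_ n5 c cB)] := @ordp_aut 5 S isT bS; rewrite ec a5m_ord5 => /(_ isT)/negP[].
have [cr cc] := in_autB _ cB; have /andP[rS kS] := bS; apply/autP=> k kk.
case: (eqVneq k kr) => [->//|n1]; case: (eqVneq k kc) => [->//|n2].
have b1 : bpk kr k by apply: (fS _ _ rS kk); rewrite eq_sym.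
have b2 : bpk kc k by apply: (fS _ _ kS kk); rewrite eq_sym.
have fk : fixedK (elts_ok ok11) k by apply: (fixedK_stab (elts_ok ok11) S).2.
have [fT bT PT fr _] := frame3 b1 b2 fk.
have [h1 _ h3 h4 [h5 h6 h7 _]] := ok_allP ok11.
have [v vk] := vcode_exists h4 h5 nsl11 conj11 b1 fk.
apply/eqP/negPn/negP=> nk; suff : (mke D11 v.1, v.2) \in L11 by rewrite L11_nil.
rewrite L11E.
apply: (sols_complete h1 h3 h4 h5 h6 h7 nsl11 conj11 (can := false) (X := [:: a5m]) fT bT PT (fr _ vk)); first by [].
  by move=> a; rewrite inE => /eqP->; apply: a5m_K.
move=> y yB; rewrite inE -ec => /eqP/(rl_inj yB cB) ->; apply: contra nk => /autP/(_ k) e; apply/eqP; apply: e.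
by rewrite !inE eqxx orbT.
Qed.

(** Two kernels are a biplane, which is unique, and its group of order 660 is not trivial. *)
Lemma transversal_pair : transversal 2 (fun m => m != 1%N) [:: [set kr; kc]].
Proof.
have ne : kr != kc := bpk_neq bpk_base; have c2 : #|[set kr; kc]| = 2 by rewrite cards2 ne.
split=> //.
- move=> S; rewrite inE => /eqP->; split=> //.
    move=> k k'; rewrite !inE => /orP[]/eqP-> /orP[]/eqP->; rewrite ?eqxx // => _; [exact: bpk_base|exact: bpk_sym bpk_base].
  have sub : autB \subset aut [set kr; kc].
    by apply/subsetP=> b /in_autB[r c]; apply/autP=> k; rewrite !inE => /orP[]/eqP->.
  by have := subset_leq_card sub; rewrite card_autB; case: eqP => // ->.
- move=> S fS /eqP/cards2P[k [k' [n eS]]] _; rewrite eS in fS.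
  have [b br bc] := bpk_base_change (fS k k' (set21 _ _) (set22 _ _) n).
  exists b^-1; rewrite inE eS /act imsetU1 imset_set1 -br -bc !pullbackK; exact: eqxx.
by move=> S b; rewrite !inE => /eqP-> /eqP.
Qed.

(** With orders 2 and 3 excluded and 11 bringing 5 along, a nontrivial group is one whose order is
    divisible by 5. *)
Lemma transversal_n n : 0 < n -> transversal n.+3 (fun m => m != 1%N) (map dec (frames D5 t5 n (candidates L5' V5))).
Proof.
move=> n0; apply: (@transversal_ext _ (fun m => 5 %| m)) => [S fS cS|].
  have S3 : 3 < #|S| by rewrite cS.
  have S1 : 1 < #|S| by apply: leq_trans S3.
  have := all660 types4 fS S1; rewrite (no_order2 fS S3) (no_order3 fS S3) (introT implyP (order11 fS S1)).
  by move/eqP.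
apply: (@frames_family D5 ok5 nsl5 conj5).
- by move=> S fS S1 d5; rewrite card_P5; apply: cauchy_group.
- by move=> S fS bS PS _; apply: (@sylow_in_autB 5 _ _ bS PS sylow5).
by move=> S _ _ PS; have := cardSg PS; rewrite card_P5.
Qed.

(** Indexed by the number of coordinates; the last entry, for 12, yields the upper bound 11. *)
Definition class_counts := [:: 0; 0; 1; 10178; 443; 8; 7; 4; 2; 1; 1; 1; 0]%N.

Lemma transversal_union (T : Type) (f : T -> {set kernel}) l4 l2 l3 l5 :
  transversal 3 (fun m => (2 %| m) && (4 %| m)) (map f l4) ->
  transversal 3 (fun m => (2 %| m) && ~~ (4 %| m)) (map f l2) ->
  transversal 3 (fun m => (3 %| m) && ~~ (2 %| m)) (map f l3) ->
  transversal 3 (fun m => (5 %| m) && (~~ (2 %| m) && ~~ (3 %| m))) (map f l5) ->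
  size l4 = 76 -> size l2 = 5066 -> size l3 = 4753 -> size l5 = 283 ->
  exists2 L, transversal 3 (fun m => m != 1%N) L & size L = nth 0 class_counts 3.
Proof.
move=> T4 T2 T3 T5 s4 s2 s3 s5; exists (map f l4 ++ (map f l2 ++ (map f l3 ++ map f l5))); last first.
  by rewrite !size_cat !size_map s4 s2 s3 s5; vm_compute.
apply: (@transversal_ext _ types) => [S fS cS|].
  have S1 : 1 < #|S| by rewrite cS.
  by have := all660 types3 fS S1; rewrite (introT implyP (order11 fS S1)) => /eqP.
apply: transversal_cat T4 _ => [m|]; first by case: (2 %| m); case: (4 %| m); rewrite ?andbF.
apply: transversal_cat T2 _ => [m|]; first by case: (2 %| m); rewrite ?andbF.
by apply: transversal_cat T3 T5 => m; case: (2 %| m); case: (3 %| m); rewrite ?andbF.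
Qed.

Lemma nth_sizes (h : nat -> nat) l n : [seq h i | i <- iota 1 9] = l -> n < 9 -> h n.+1 = nth 0 l n.
Proof. by move=> <- n9; rewrite (nth_map 0) ?size_iota // nth_iota // add1n. Qed.

Lemma transversal_map (T : Type) (f : T -> {set kernel}) n E l m : transversal n E (map f l) -> size l = m ->
  exists2 L, transversal n E L & size L = m.
Proof. by move=> t s; exists (map f l); rewrite ?size_map. Qed.

Lemma transversals n : 1 < n < 13 -> exists2 L, transversal n (fun m => m != 1%N) L & size L = nth 0 class_counts n.
Proof.
case: n => [|[|[|[|n]]]] // n13.
- by exists [:: [set kr; kc]]; first exact: transversal_pair.
- exact: (transversal_union transversal_V4 transversal_2 transversal_3 transversal_5 size_L4 size_L2 size_L3 size_L5).
have n9 : n < 9 by [].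
have e := nth_sizes (h := fun i => size (frames D5 t5 i (candidates L5' V5))) size_frames n9.
exact: (transversal_map (transversal_n (isT : 0 < n.+1)) e).
Qed.

Lemma exists_frame n : 1 < n -> (exists C : cube n 11, C \in Pcubes n 11 5 2 /\ autotopy_group C :!=: 1%g) <->
  exists S, [/\ framed S, #|S| = n & aut S :!=: 1].
Proof.
move=> n1; split=> [[C [CP a1]]|[S [fS cS aS]]].
  have /(nontrivialP n1)[f [pf _ af]] : C \in nontrivial_Pcubes n 11 5 2 by rewrite inE CP.
  by exists (kset f); split=> //; [exact: framed_kset|exact: card_kset].
have [f pf eS] := ksetP n1 fS cS; have : cube_of f \in nontrivial_Pcubes n 11 5 2 by rewrite nontrivial_kset // eS.
by rewrite inE => /andP[? ?]; exists (cube_of f).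
Qed.

(** Dropping kernels can only enlarge the automorphism group. *)
Lemma subframe n S : framed S -> n <= #|S| -> aut S :!=: 1 -> exists T, [/\ framed T, #|T| = n & aut T :!=: 1].
Proof.
move=> fS nS aS; pose T := [set k in take n (enum S)].
have TS k : k \in T -> k \in S by rewrite inE => /mem_take; rewrite mem_enum.
exists T; split; first by move=> k k' /TS kS /TS k'S; apply: fS.
  by rewrite cardsE (card_uniqP _) ?take_uniq ?enum_uniq // size_take_min -cardE; apply/minn_idPl.
apply: contra aS => /eqP aT; rewrite -subG1 -aT; apply/subsetP=> b /autP H; apply/autP=> k /TS; exact: H.
Qed.

Close Scope group_scope.

Theorem theorem3p8 :
  (forall n : nat, 2 <= n ->
     (exists C : cube n 11, C \in Pcubes n 11 5 2 /\ autotopy_group C :!=: 1%g)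
       <-> 2 <= n <= 11) /\
  [seq count_up_to_equivalence (nontrivial_Pcubes n 11 5 2)
     | n <- [:: 2; 3; 4; 5; 6; 7; 8; 9; 10; 11]] =
  [:: 1; 10178; 443; 8; 7; 4; 2; 1; 1; 1].
Proof.
split=> [n n2|].
  rewrite exists_frame // n2; split=> [[S [fS cS aS]]|n11].
    (* More than eleven kernels would contain twelve that still have a nontrivial automorphism, and
       the transversal for twelve is empty. *)
    rewrite leqNgt; apply/negP=> n12; rewrite -cS in n12; have [T [fT cT aT]] := subframe fS n12 aS.
    have [L [_ _ cov _] sL] := @transversals 12 isT; have [|b] := cov T fT cT; first by rewrite -trivg_card1.
    by rewrite (size0nil sL).
  have [|L [_ HL _ _] sL] := @transversals n; first by rewrite n2 (leq_ltn_trans n11).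
  have : all (fun i => 0 < nth 0 class_counts i) (iota 2 10) by vm_compute.
  move/allP/(_ n); rewrite mem_iota n2 ltnS n11 -sL => /(_ isT); case: L HL {sL} => // S L HL _.
  have [fS cS aS] := HL S (mem_head _ _); exists S; split=> //; by rewrite trivg_card1.
transitivity [seq nth 0 class_counts n | n <- [:: 2; 3; 4; 5; 6; 7; 8; 9; 10; 11]]; last by vm_compute.
apply/eq_in_map => n ns.
have /andP[n1 n13] : 1 < n < 13.
  by have /allP/(_ n ns) : all (fun i => 1 < i < 13) [:: 2; 3; 4; 5; 6; 7; 8; 9; 10; 11] by [].
have [|L tL <-] := @transversals n; first by rewrite n1.
exact: transversal_count.
Qed.
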